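(* Suppose $(M,\mathcal T)$ is a compact pseudo 3-manifold with a $1$-$3$ type closed triangulation $\mathcal T$ which supports a positive angle structure. If $\alpha$ is a non-negative angle structure and $\alpha$ maximizes the volume in the space of all non-negative angle structures on $(M,\mathcal T)$, then there exists an edge length assignment $l:E\to\mathbb R$ such that for each tetrahedron $\sigma$ in $\mathcal T$: (1) if all angles of $\alpha$ in $\sigma$ are positive, then the angles of $\alpha$ in $\sigma$ are the dihedral angles of the decorated $1$-$3$ type hyperbolic tetrahedron with edge lengths given by $l$; and (2) if one angle of $\sigma$ in $\alpha$ is $0$, then the angles of $\sigma$ in $\alpha$ are $0,0,0,0,\pi,\pi$, and the numbers assigned by $l$ to the edges of $\sigma$ are not the edge lengths of any decorated $1$-$3$ type hyperbolic tetrahedron. Conversely, let $l:E\to\mathbb R$ be any edge length function and let $\alpha=\alpha(l)$ be the corresponding angles of $l$. If $\alpha$ is a non-negative angle structure on $(M,\mathcal T)$ for which (1) and (2) hold with this $l$, then $\alpha$ maximizes the volume in the space of all non-negative angle structures on $(M,\mathcal T)$.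
   Context: Work in the Klein model, $\mathbb H^3$ = open unit ball in $\mathbb R^3\subset\mathbb RP^3$. A $1$-$3$ type hyperbolic tetrahedron is obtained from a projective tetrahedron with vertices $v_1,\dots,v_4$, where $v_1$ (the hyperideal vertex) lies outside the closed ball, $v_2,v_3,v_4$ (the ideal vertices) lie on $\partial\mathbb H^3$, and all six edges meet $\mathbb H^3$, by intersecting with $\mathbb H^3$ and truncating at $v_1$ by the hyperbolic plane dual to $v_1$ (orthogonal to the three edges from $v_1$). The truncated triangle and its sides are not counted as faces/edges. The edges are $e_{ij}$, $1\le i<j\le4$, with dihedral angles $\alpha_{ij}=\alpha_{ji}$. A decoration is a choice of horosphere $H_i$ at each $v_i$, $i=2,3,4$. Edge lengths: $l_{ij}$ ($i,j\in\{2,3,4\}$) is the signed distance along $e_{ij}$ between $H_i$ and $H_j$ (positive iff disjoint), $l_{1i}$ is the signed distance along $e_{1i}$ from the truncating plane to $H_i$ (positive iff the point of $e_{1i}$ on that plane is outside the horoball). A compact pseudo 3-manifold with triangulation $\mathcal T$ is the quotient of a finite disjoint union of tetrahedra by affine homeomorphisms identifying faces in pairs. $\mathcal T$ is of $1$-$3$ type if each tetrahedron has one vertex designated hyperideal and three designated ideal, the gluings respecting this; it is closed if every face is glued to another face (the gluing around each edge is cyclical). $E$ is the set of edges of $\mathcal T$. A (positive) angle structure assigns to each edge in each tetrahedron a number in $(0,\pi)$ such that the sum of the angles around each edge of $E$ is $2\pi$, in each tetrahedron the sum of the angles at the three edges from each ideal vertex is $\pi$, and at the three edges from the hyperideal vertex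 is less than $\pi$. A non-negative angle structure is defined in the same way with angles in $[0,\pi]$ and the sum at the hyperideal vertex $\le\pi$. The volume of a non-negative angle structure $\alpha$ is $vol(\alpha)=\sum_\sigma vol(\alpha_\sigma)$, where for the six angles $(\alpha_{12},\dots,\alpha_{34})$ of a tetrahedron (vertex 1 hyperideal) $$2\,vol(\alpha_{12},\dots,\alpha_{34})=\Lambda\Big(\tfrac{\pi-\alpha_{12}-\alpha_{13}-\alpha_{14}}2\Big)+\sum_{1\le i<j\le4}\Lambda(\alpha_{ij}),\qquad \Lambda(\theta)=-\int_0^\theta\ln|2\sin t|\,dt ;$$ this is the hyperbolic volume of the $1$-$3$ type tetrahedron with these dihedral angles when they are positive with hyperideal sum $<\pi$. Corresponding angles $\alpha(l)$ of $l:E\to\mathbb R$: for a tetrahedron $\sigma$ whose six numbers $(l_{12},\dots,l_{34})$ are the edge lengths of a decorated $1$-$3$ type hyperbolic tetrahedron, they are its dihedral angles. Otherwise, define $\theta_{jk}>0$ by $\cosh\theta_{jk}=1+2e^{l_{jk}-l_{1j}-l_{1k}}$ for $j\ne k$ in $\{2,3,4\}$; then there is exactly one $i$, with $\{i,j,k\}=\{2,3,4\}$, such that $\theta_{jk}\ge\theta_{ij}+\theta_{ik}$, and the angles at the opposite edges $e_{1i}$ and $e_{jk}$ are set to $\pi$ and the other four angles to $0$. *)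

(* Defs.v *)
From mathcomp Require Import all_boot all_order all_fingroup all_algebra.
From mathcomp Require Import all_classical all_reals all_analysis.

Set Implicit Arguments.
Unset Strict Implicit.
Unset Printing Implicit Defensive.

Import Order.TTheory GRing.Theory Num.Theory.
Import numFieldNormedType.Exports.
Local Open Scope set_scope.
Local Open Scope ring_scope.

(* The vertices of a tetrahedron are the elements of 'I_4; ord0 is the
   hyperideal vertex v_1 and the other three are the ideal vertices v_2, v_3,
   v_4.  An edge is the set of its two end points. *)
Definition tet_edge : Type := {e : {set 'I_4} | #|e| == 2%N}.

Lemma tet_edge0_subproof : #|[set (ord0 : 'I_4); ord_max]| == 2%N.
Proof. by rewrite cards2. Qed.

Definition tet_edge0 : tet_edge :=
  exist _ [set ord0; ord_max] tet_edge0_subproof.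

(* te i j is a default value when i = j; it is only used for i != j. *)
Definition te (i j : 'I_4) : tet_edge := insubd tet_edge0 [set i; j].

Lemma val_te (i j : 'I_4) : i != j -> val (te i j) = [set i; j].
Proof. by move=> ij; rewrite /te val_insubd cards2 ij. Qed.

(* The face f of a tetrahedron is the one opposite to the vertex f.  If
   glue t f = (t', p), the face f of t is glued to the face p f of t' by the
   affine map sending each vertex v != f of t to the vertex p v of t'; an affine
   homeomorphism between triangles that respects the cell structure is determined
   by the bijection of the vertices, and this bijection extends uniquely to a
   permutation of 'I_4.  As glue is total, every face is glued: the triangulation
   is closed. *)
Record closed_triangulation := ClosedTriangulation {
  tet : finType;
  glue : tet -> 'I_4 -> tet * {perm 'I_4};
  glueK : forall t f,
    glue (glue t f).1 ((glue t f).2 f) = (t, ((glue t f).2)^-1%g);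
  glue_neq : forall t f, ((glue t f).1, (glue t f).2 f) <> (t, f)
}.

Definition type13 (M : closed_triangulation) : Prop :=
  forall (t : tet M) (f v : 'I_4), v != f ->
    ((glue t f).2 v == ord0) = (v == ord0).

Section Edges.
Variable M : closed_triangulation.

Definition glued_edges : rel (tet M * tet_edge) := fun x y =>
  [exists f : 'I_4, [&& f \notin val x.2, (glue x.1 f).1 == y.1 &
                        val y.2 == (glue x.1 f).2 @: val x.2]].

(* glued_edges is symmetric because gluings are inverse to each other, so that
   connect glued_edges is the equivalence relation it generates. *)
Definition edge_class (x : tet M * tet_edge) : {set tet M * tet_edge} :=
  [set y | connect glued_edges x y].

Definition edge : Type :=
  {c : {set tet M * tet_edge} | [exists x, c == edge_class x]}.

Lemma edge_of_subproof (x : tet M * tet_edge) :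
  [exists y, edge_class x == edge_class y].
Proof. by apply/existsP; exists x. Qed.

Definition edge_of (t : tet M) (e : tet_edge) : edge :=
  exist _ (edge_class (t, e)) (edge_of_subproof (t, e)).

End Edges.

Section Volume.
Variable R : realType.

(* The second branch is the usual convention for an integral from 0 to x < 0. *)
Definition Lobachevsky (x : R) : R :=
  if 0 <= x then - \int[lebesgue_measure]_(t in `[0, x]) ln `|2 * sin t|
  else \int[lebesgue_measure]_(t in `[x, 0]) ln `|2 * sin t|.

Definition tet_vol (a : tet_edge -> R) : R :=
  2^-1 * (Lobachevsky ((pi - \sum_(e : tet_edge | ord0 \in val e) a e) / 2)
          + \sum_(e : tet_edge) Lobachevsky (a e)).

Variable M : closed_triangulation.
Implicit Type alpha : tet M -> tet_edge -> R.

Definition positive_angle_structure alpha : Prop :=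
  [/\ forall t e, 0 < alpha t e < pi,
      forall c : edge M, \sum_(x in val c) alpha x.1 x.2 = 2 * pi,
      forall t (i : 'I_4), i != ord0 ->
        \sum_(e : tet_edge | i \in val e) alpha t e = pi
    & forall t, \sum_(e : tet_edge | ord0 \in val e) alpha t e < pi].

Definition nonneg_angle_structure alpha : Prop :=
  [/\ forall t e, 0 <= alpha t e <= pi,
      forall c : edge M, \sum_(x in val c) alpha x.1 x.2 = 2 * pi,
      forall t (i : 'I_4), i != ord0 ->
        \sum_(e : tet_edge | i \in val e) alpha t e = pi
    & forall t, \sum_(e : tet_edge | ord0 \in val e) alpha t e <= pi].

Definition vol alpha : R := \sum_(t : tet M) tet_vol (alpha t).

Definition maximizes_volume alpha : Prop :=
  nonneg_angle_structure alpha /\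
  forall beta, nonneg_angle_structure beta -> vol beta <= vol alpha.

End Volume.

(* Points of RP^3 are given by homogeneous coordinates x : 'rV[R]_4, the affine
   chart containing the Klein ball being x_0 <> 0.  The open unit ball is then
   {x | lorentz x x < 0}, its boundary sphere is lorentz x x = 0, and the plane
   dual to v is lorentz v x = 0. *)
Section Hyperbolic.
Variable R : realType.
Implicit Types x y v n : 'rV[R]_4.

Definition lorentz x y : R :=
  \sum_(i < 3) x 0 (lift ord0 i) * y 0 (lift ord0 i) - x 0 0 * y 0 0.

Definition in_H3 x : Prop := lorentz x x < 0.

Definition arcosh (z : R) : R := ln (z + Num.sqrt (z ^+ 2 - 1)).

Lemma arcosh_ge0 (z : R) : 1 <= z -> 0 <= arcosh z.
Proof.
move=> z1; apply: ln_ge0; rewrite (le_trans z1)// lerDl; exact: sqrtr_ge0.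
Qed.

Lemma cosh_arcosh (z : R) : 1 <= z ->
  (expR (arcosh z) + expR (- arcosh z)) / 2 = z.
Proof.
move=> z1; have z0 : 0 < z := lt_le_trans ltr01 z1.
have w0 : 0 < z + Num.sqrt (z ^+ 2 - 1).
  by rewrite (lt_le_trans z0)// lerDl sqrtr_ge0.
rewrite expRN /arcosh lnK ?posrE//.
have -> : (z + Num.sqrt (z ^+ 2 - 1))^-1 = z - Num.sqrt (z ^+ 2 - 1).
  apply: (mulfI (lt0r_neq0 w0)); rewrite divff ?lt0r_neq0//.
  rewrite mulrC -subr_sqr sqr_sqrtr ?subr_ge0 ?exprn_ege1//.
  by rewrite opprB addrC subrK.
by rewrite addrACA subrr addr0 -mulr2n -[z *+ 2]mulr_natr mulfK// pnatr_eq0.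
Qed.

(* The hyperbolic distance of the Klein model between points of H^3. *)
Definition hdist x y : R :=
  arcosh (`|lorentz x y| / Num.sqrt (lorentz x x * lorentz y y)).

(* For v on the sphere at infinity, the horospheres centred at v are the
   horosphere v c with c > 0; for v = (1, u) and x = (1, p) the equation reads
   (1 - p.u)^2 = c * (1 - |p|^2). *)
Definition horosphere v (c : R) x : Prop :=
  in_H3 x /\ lorentz x v ^+ 2 = c * - lorentz x x.

Definition horoball v (c : R) x : Prop :=
  in_H3 x /\ lorentz x v ^+ 2 <= c * - lorentz x x.

Variable v : 'I_4 -> 'rV[R]_4.

(* The projective tetrahedron is the image in RP^3 of the convex cone spanned by
   the v i, and seg i j is its open edge between v i and v j. *)
Definition seg (i j : 'I_4) x : Prop :=
  exists a b : R, [/\ 0 < a, 0 < b & x = a *: v i + b *: v j].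

Definition hedge (i j : 'I_4) x : Prop := seg i j x /\ in_H3 x.

Definition tetrahedron13 : Prop :=
  [/\ row_free (\matrix_i v i),
      0 < lorentz (v ord0) (v ord0),
      forall i, i != ord0 -> lorentz (v i) (v i) = 0
    & forall i j, i != j -> exists x, hedge i j x].

(* n is a Lorentz normal vector to the face opposite to v i, pointing to the
   side of this face that does not contain the tetrahedron. *)
Definition outward_normal (i : 'I_4) n : Prop :=
  (forall j, j != i -> lorentz n (v j) = 0) /\ lorentz n (v i) < 0.

(* The faces meeting along e are those opposite to the two vertices not in e;
   their dihedral angle is pi minus the angle between the outward normals. *)
Definition dihedral_angle (e : tet_edge) (a : R) : Prop :=
  exists i j n m,
    [/\ i != j, val e = ~: [set i; j], outward_normal i n, outward_normal j m
      & a = pi - acos (lorentz n m /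
                       (Num.sqrt (lorentz n n) * Num.sqrt (lorentz m m)))].

Definition dihedral_angles (a : tet_edge -> R) : Prop :=
  forall e, dihedral_angle e (a e).

(* The decoration: c i is the parameter of the horosphere at v i, i != ord0. *)
Variable c : 'I_4 -> R.

Definition decorated_tetrahedron13 : Prop :=
  tetrahedron13 /\ forall i, i != ord0 -> 0 < c i.

Definition ideal_edge_length (i j : 'I_4) (l : R) : Prop :=
  exists x y,
    [/\ hedge i j x /\ horosphere (v i) (c i) x,
        hedge i j y /\ horosphere (v j) (c j) y,
        `|l| = hdist x y
      & 0 < l <->
        ~ exists z, horosphere (v i) (c i) z /\ horosphere (v j) (c j) z].

Definition hyperideal_edge_length (i : 'I_4) (l : R) : Prop :=
  exists x y,
    [/\ hedge ord0 i x /\ lorentz (v ord0) x = 0,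
        hedge ord0 i y /\ horosphere (v i) (c i) y,
        `|l| = hdist x y
      & 0 < l <-> ~ horoball (v i) (c i) x].

Definition edge_lengths (l : tet_edge -> R) : Prop :=
  (forall i j, i != ord0 -> j != ord0 -> i != j ->
     ideal_edge_length i j (l (te i j))) /\
  (forall i, i != ord0 -> hyperideal_edge_length i (l (te ord0 i))).

End Hyperbolic.

Section Corresponding.
Variable R : realType.
Implicit Types l a : tet_edge -> R.

Definition geometric l : Prop :=
  exists v c, decorated_tetrahedron13 v c /\ edge_lengths v c l.

Definition geometric_angles l a : Prop :=
  exists v c, [/\ decorated_tetrahedron13 v c, edge_lengths v c l
                & dihedral_angles v a].

Definition theta l (j k : 'I_4) : R :=
  arcosh (1 + 2 * expR (l (te j k) - l (te ord0 j) - l (te ord0 k))).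

Definition degenerate_angles l a : Prop :=
  exists i j k : 'I_4,
    [/\ uniq [:: ord0; i; j; k],
        theta l i j + theta l i k <= theta l j k
      & forall e, a e = if (e == te ord0 i) || (e == te j k) then pi else 0].

Definition tet_corresponding_angles l a : Prop :=
  (geometric l -> geometric_angles l a) /\
  (~ geometric l -> degenerate_angles l a).

Variable M : closed_triangulation.

Definition tet_lengths (l : edge M -> R) (t : tet M) : tet_edge -> R :=
  fun e => l (edge_of t e).

Definition corresponding_angles (l : edge M -> R)
    (alpha : tet M -> tet_edge -> R) : Prop :=
  forall t, tet_corresponding_angles (tet_lengths l t) (alpha t).

Definition cond1 (l : edge M -> R) (alpha : tet M -> tet_edge -> R)
    (t : tet M) : Prop :=
  (forall e, 0 < alpha t e) -> geometric_angles (tet_lengths l t) (alpha t).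

Definition cond2 (l : edge M -> R) (alpha : tet M -> tet_edge -> R)
    (t : tet M) : Prop :=
  (exists e, alpha t e = 0) ->
  perm_eq [seq alpha t e | e : tet_edge] [:: 0; 0; 0; 0; pi; pi] /\
  ~ geometric (tet_lengths l t).

End Corresponding.

(* Main.v *)
Require Import Defs.
From mathcomp Require Import all_boot all_order all_fingroup all_algebra.
From mathcomp Require Import all_classical all_reals all_analysis.
From mathcomp Require Import measurable_realfun zify ring lra.
Set Implicit Arguments.
Unset Strict Implicit.
Unset Printing Implicit Defensive.
Import Order.TTheory GRing.Theory Num.Theory.
Import numFieldNormedType.Exports.
Local Open Scope ring_scope.

(* Write the angles of a 1-3 tetrahedron at the hyperideal vertex as a, b, c and
   put 2 h = pi - a - b - c; the opposite angles are then a + h, b + h, c + h,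
   so that the non-negative angle assignments form a simplex.  On it
     2 vol = L(h) + L(a) + L(b) + L(c) + L(a + h) + L(b + h) + L(c + h)
   is the sum of the volumes of the ideal tetrahedra with angles
   (a, b + h, c + h), (b, c, a + 2 h), (h, a + h, b + c), hence concave; and
   vol + (1/2) sum l_e alpha_e is critical exactly where
     e^(l_jk - l_1j - l_1k) = sin h sin(a + h) / (sin b sin c)   (cyclically),
   i.e. where a, b, c are the angles of the hyperbolic triangle with sides
   theta_jk: there l gives the edge lengths of the tetrahedron with these
   angles.  As the derivative is infinite at the other boundary points, the
   maximum is otherwise at a vertex (pi, 0, 0, 0), and this happens exactly
   when the triangle inequality for the theta_jk fails.
   An edge sum condition contributes a constant to sum l_e alpha_e, so if every
   tetrahedron maximizes vol + (1/2) sum l_e alpha_e then alpha maximizes the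
   volume.  Conversely, since a positive angle structure is an interior feasible
   point, the lengths l are the Lagrange multipliers of the edge conditions. *)

(** Differentiability stops at the boundary of the simplex, yet the maximizer may lie there. So the
    convexity arguments all rest on one inequality, [objective_le]: the tangent plane at an interior
    point bounds the objective on the whole closed simplex. Applied at points that move towards a
    boundary point, it yields slope bounds at that point. At a vertex [(pi, 0, 0, 0)] the gradient
    has a limit along each ray, but the limit depends on the direction. For any [y] and [z] there is
    a direction with these two limits, and its third limit is the side of length
    [theta_y + theta_z]; this is how the triangle inequality enters. The [theta_jk] are the sides of
    the truncation triangle, so the dihedral angles at the hyperideal vertex obey the hyperbolic law
    of cosines. The maximizer [alpha] itself may be degenerate. The multipliers are therefore found
    on the open simplices by separation of slopes, and boundary points are reached by mixing with
    the positive angle structure. *)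

Section LobachevskyFunction.
Variable R : realType.
Implicit Types t u v x : R.
Local Notation mu := (@lebesgue_measure R).
Local Notation log2sin := (fun t : R => ln `|2 * sin t|).

Lemma ln2sinE t : 0 < t < pi -> ln `|2 * sin t| = ln (2 * sin t).
Proof. by move=> t0; rewrite gtr0_norm// mulr_gt0// sin_gt0_pi. Qed.

(** An upper bound makes [1 - ln |2 sin t|] non-negative, so that its integral can be estimated
    before integrability is known. The constant comes from [2 <= 1 + 1 <= e]; at a zero of the sine
    the default value [ln 0 = 0] applies. *)
Lemma ln2sin_le1 t : ln `|2 * sin t| <= 1.
Proof.
have [->|s0] := eqVneq (sin t) 0; first by rewrite mulr0 normr0 ln0.
have n0 : 0 < `|2 * sin t| by rewrite normr_gt0 mulf_neq0// pnatr_eq0.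
rewrite -ler_expR lnK ?posrE// (le_trans _ (expR_ge1Dx 1))//.
by rewrite normrM gtr0_norm// -[leRHS]mulr1 ler_pM2l// sin_max.
Qed.

Lemma measurable_ln2sin (A : set R) : measurable_fun A log2sin.
Proof.
apply: (@measurable_funS _ _ _ _ setT) => //.
apply: (measurableT_comp (@measurable_ln R)).
apply: (measurableT_comp (@normr_measurable R setT)).
apply: measurable_funM => //.
by apply: continuous_measurable_fun; exact: continuous_sin.
Qed.

Lemma is_derive_ln2sin x : 0 < x < pi ->
  is_derive x 1 log2sin (cos x / sin x).
Proof.
move=> x0; have s0 : 0 < sin x by rewrite sin_gt0_pi.
apply: (@near_eq_is_derive _ _ _ (fun t => ln (2 * sin t))) => //.
  near=> t; rewrite ln2sinE//; near: t.
  have : x \in `]0, pi[ by rewrite in_itv.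
  by move/near_in_itvoo; apply: filterS => t; rewrite in_itv.
have s1 : 0 < 2 * sin x by rewrite mulr_gt0.
have H := @is_derive1_comp R (@ln R) (fun t => 2 * sin t) x _ _
    (is_derive1_ln s1) _.
apply: is_derive_eq => //.
  rewrite /GRing.scale/=; field; rewrite gt_eqF//.
Unshelve. all: by end_near. 
Qed.

Lemma continuous_ln2sin x : 0 < x < pi -> {for x, continuous log2sin}.
Proof.
move=> /is_derive_ln2sin[d _]; apply: differentiable_continuous.
exact/derivable1_diffP.
Qed.
End LobachevskyFunction.

(** * Integrability of [ln |2 sin t|] on [[0, pi]] *)

Section Integrability.
Variable R : realType.
Implicit Types t u v x : R.
Local Notation mu := (@lebesgue_measure R).
Local Notation log2sin := (fun t : R => ln `|2 * sin t|).

(** The difference has derivative [t sin t]. It is used as [t cot t <= 1] in the integration by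
    parts, and as a lower bound for the sine near a vertex. *)
Lemma mul_cos_le_sin t : 0 <= t <= pi -> t * cos t <= sin t.
Proof.
move=> /andP[t0 tpi].
have D x : is_derive x 1 (fun t : R => sin t - t * cos t) (x * sin x).
  apply: is_derive_eq => //.
  by rewrite /GRing.scale/=; ring.
rewrite -subr_ge0.
have -> : 0 = (fun t : R => sin t - t * cos t) 0 by rewrite /= sin0 mul0r subr0.
apply: (@ger0_derive1_le_cc _ (fun t : R => sin t - t * cos t) 0 pi) => //.
- move=> x; rewrite in_itv/= => /andP[x0 xp].
  rewrite derive1E; have [_ ->] := D x.
  by rewrite mulr_ge0 ?ltW// sin_gt0_pi// x0.
- apply: continuous_subspaceT => x; apply: differentiable_continuous.
  by apply/derivable1_diffP; have [] := D x.
- by rewrite in_itv/= lexx pi_ge0.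
- by rewrite in_itv/= t0.
Qed.

(* Integration by parts with primitive [t - c] of [1] turns the logarithmic
   singularity into the bounded function [(t - c) * cot t], for [c = 0, pi]. *)
Lemma integral_ln2sin_le (c u v : R) : 0 < u -> u < v -> v < pi ->
  (forall t, u <= t <= v -> (t - c) * cos t <= sin t) ->
  (\int[mu]_(t in `[u, v]) (1 - ln `|2 * sin t|)%:E <=
  (2 * (v - u) - (v - c) * ln `|2 * sin v| + (u - c) * ln `|2 * sin u|)%:E)%E.
Proof.
move=> u0 uv vpi Hc.
have in0 t : t \in `[u, v] -> 0 < t < pi.
  rewrite in_itv/= => /andP[ut tv].
  by rewrite (lt_le_trans u0)// (le_lt_trans tv).
(* [P' = p] exceeds the integrand by [1 - (t - c) cot t], which the hypothesis makes
   non-negative. *)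
pose P t := 2 * t - (t - c) * ln `|2 * sin t|.
pose p t := 2 - ln `|2 * sin t| - (t - c) * (cos t / sin t).
have DP t : 0 < t < pi -> is_derive t 1 P (p t).
  move=> /is_derive_ln2sin D; apply: is_derive_eq => //.
  by rewrite /p /GRing.scale/=; ring.
have cln t : 0 < t < pi -> {for t, continuous log2sin}.
  exact: continuous_ln2sin.
have cp t : 0 < t < pi -> {for t, continuous p}.
  move=> t0; apply: cvgB; first by apply: cvgB; [exact: cvg_cst|exact: cln].
  apply: cvgM; first by apply: cvgB; [exact: cvg_id|exact: cvg_cst].
  apply: cvgM; first exact: continuous_cos.
  by apply: cvgV; [rewrite gt_eqF// sin_gt0_pi|exact: continuous_sin].
have cP t : 0 < t < pi -> {for t, continuous P}.
  move=> /DP[d _]; apply: differentiable_continuous; exact/derivable1_diffP.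
have I : (\int[mu]_(t in `[u, v]) (p t)%:E = (P v)%:E - (P u)%:E)%E.
  apply: continuous_FTC2 => //.
  - by apply: continuous_in_subspaceT => x /set_mem/in0/cp.
  - split.
    + move=> x xuv; apply: (@ex_derive _ _ _ _ _ _ _ (DP x _)).
      by apply: in0; apply: subset_itv_oo_cc xuv.
    + apply: cvg_at_right_filter; apply: cP; apply: in0.
      by rewrite in_itv/= lexx ltW.
    + apply: cvg_at_left_filter; apply: cP; apply: in0.
      by rewrite in_itv/= lexx ltW.
  - move=> x xuv; rewrite derive1E; apply: (@derive_val _ _ _ _ _ _ _ (DP x _)).
    by apply: in0; apply: subset_itv_oo_cc xuv.
have -> : (2 * (v - u) - (v - c) * ln `|2 * sin v| + (u - c) * ln `|2 * sin u|)
    = P v - P u by rewrite /P; ring.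
rewrite EFinB -I; apply: ge0_le_integral => //.
- move=> x /in0 x0; rewrite lee_fin subr_ge0; exact: ln2sin_le1.
- apply/measurable_EFinP; apply: measurable_funB => //.
  exact: measurable_ln2sin.
- apply/measurable_EFinP.
  apply: subspace_continuous_measurable_fun => //.
  by apply: continuous_in_subspaceT => x /set_mem/in0/cp.
- move=> x xuv; rewrite lee_fin /p.
  have s0 : 0 < sin x by rewrite sin_gt0_pi// in0.
  have : (x - c) * (cos x / sin x) <= 1.
    by rewrite mulrA ler_pdivrMr// mul1r Hc.
  by lra.
Qed.

(** Monotone convergence: the non-negative function [1 - ln |2 sin t|] has integrals over [[u, v]]
    with a common bound as [u -> 0] and [v -> pi]. The bound comes from cutting at [pi / 2] and
    taking [c = 0] on the left, [c = pi] on the right. *)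
Lemma integrable_ln2sin : mu.-integrable `[0, pi] (EFin \o log2sin).
Proof.
have pi2 : 2 <= pi :> R := pi_ge2 R.
have mg (A : set R) : measurable_fun A (fun t => (1 - ln `|2 * sin t|)%:E).
  apply/measurable_EFinP; apply: measurable_funB => //.
  exact: measurable_ln2sin.
have g0 t : (0 <= (1 - ln `|2 * sin t|)%:E)%E.
  by rewrite lee_fin subr_ge0 ln2sin_le1.
have sub (A B : set R) : measurable A -> measurable B -> (A `<=` B)%classic ->
    (\int[mu]_(t in A) (1 - ln `|2 * sin t|)%:E <=
     \int[mu]_(t in B) (1 - ln `|2 * sin t|)%:E)%E.
  by move=> mA mB AB; apply: ge0_subset_integral => //; exact: mg.
suff Hg : mu.-integrable `[0, pi] (fun t => (1 - ln `|2 * sin t|)%:E).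
  have -> : EFin \o log2sin =
      (fun t => 1%:E - (1 - ln `|2 * sin t|)%:E)%E.
    by apply/funext => t /=; rewrite -EFinB; congr EFin; ring.
  apply: integrableB => //.
  apply: (@continuous_compact_integrable _ (cst 1)).
    exact: segment_compact.
  by apply: continuous_subspaceT => x; exact: cvg_cst.
have [K HK] : exists K : R, forall u v, 0 < u -> u <= 1 -> v < pi -> pi - 1 <= v ->
   (\int[mu]_(t in `[u, v]) (1 - ln `|2 * sin t|)%:E <= K%:E)%E.
  exists (4 * pi + 4) => u v u0 u1 vpi v1.
  pose q : R := pi / 2.
  have p0 : 0 < q by rewrite divr_gt0// pi_gt0.
  have qE : pi = 2 * q by rewrite /q; field.
  clearbody q.
  have l2 : 0 <= ln 2 :> R by rewrite ln_ge0// ler1n.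
  have sp : ln `|2 * sin q| = ln 2 :> R.
    by rewrite -[q](_ : pi / 2 = _) ?sin_pihalf ?mulr1 ?gtr0_norm// qE; field.
  have := ln2sin_le1 u; have := ln2sin_le1 v => Lv Lu.
  have I1 : (\int[mu]_(t in `[u, q]) (1 - ln `|2 * sin t|)%:E <= (2 * pi + 2)%:E)%E.
    have [upi|] := ltP u q; last first.
      rewrite le_eqVlt => /predU1P[<-|pu].
        by rewrite set_itv1 integral_set1 lee_fin; lra.
      by rewrite set_itv_ge ?integral_set0 ?lee_fin ?bnd_simp -?ltNge//; lra.
    apply: le_trans; first apply: (@integral_ln2sin_le 0) => //; first by lra.
      by move=> t /andP[ut tp]; rewrite subr0 mul_cos_le_sin//; apply/andP; split; lra.
    rewrite lee_fin sp !subr0.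
    have : u * ln `|2 * sin u| <= u * 1 by rewrite ler_pM2l.
    have : 0 <= q * ln 2 :> R by rewrite mulr_ge0// ltW.
    by lra.
  have I2 : (\int[mu]_(t in `[q, v]) (1 - ln `|2 * sin t|)%:E <= (2 * pi + 2)%:E)%E.
    have [upi|] := ltP q v; last first.
      rewrite le_eqVlt => /predU1P[<-|pu].
        by rewrite set_itv1 integral_set1 lee_fin; lra.
      by rewrite set_itv_ge ?integral_set0 ?lee_fin ?bnd_simp -?ltNge//; lra.
    apply: le_trans; first apply: (@integral_ln2sin_le pi) => //.
      move=> t /andP[ut tp].
      (* The reflection [t -> pi - t] carries the bound at 0 to the one at pi. *)
      have := @mul_cos_le_sin (pi - t) _.
      rewrite sinB cosB sinpi cospi !mul0r !mulN1r addr0 sub0r opprK.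
      have -> : (pi - t) * - cos t = (t - pi) * cos t by ring.
      by apply; apply/andP; split; lra.
    rewrite lee_fin sp.
    have -> : (q - pi) * ln 2 = - (q * ln 2) by rewrite qE; ring.
    have : (pi - v) * ln `|2 * sin v| <= (pi - v) * 1 by rewrite ler_pM2l// subr_gt0.
    have : 0 <= q * ln 2 :> R by rewrite mulr_ge0// ltW.
    by lra.
  have -> : 4 * pi + 4 = (2 * pi + 2) + (2 * pi + 2) :> R by ring.
  rewrite EFinD; apply: le_trans (leeD I1 I2).
  apply: (@le_trans _ _ (\int[mu]_(t in `[u, q] `|` `]q, v]) (1 - ln `|2 * sin t|)%:E)%E).
    apply: sub; [exact: measurable_itv|apply: measurableU; exact: measurable_itv|].
    move=> t /=; rewrite !in_itv/= => /andP[-> ->].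
    by case: leP => ?; [left|right].
  rewrite ge0_integral_setU//; first last.
  - apply/disj_set2P; rewrite -subset0 => t [/=].
    by rewrite !in_itv/= => /andP[_ t1] /andP[t2 _]; move: (lt_le_trans t2 t1); rewrite ltxx.
  - exact: mg.
  rewrite leeD2l//; apply: sub; [exact: measurable_itv..|].
  by move=> t /=; rewrite !in_itv/= => /andP[/ltW -> ->].
apply/integrableP; split; first exact: mg.
under eq_integral do rewrite gee0_abs//.
(* The end points are dropped because the [F n] exhaust the open interval only. *)
rewrite -integral_itv_obnd_cbnd -?integral_itv_bndo_bndc; [|exact: mg..].
pose F (n : nat) : set R := `[(n%:R + 1)^-1, pi - (n%:R + 1)^-1]%classic.
have nV0 n : 0 < (n%:R + 1)^-1 :> R by rewrite invr_gt0 ltr_wpDl.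
have nV1 n : (n%:R + 1)^-1 <= 1 :> R by rewrite invf_le1 ?ltr_wpDl// lerDr.
have UF : (\bigcup_i F i)%classic = `]0, pi[%classic.
  apply/seteqP; split => t /=.
    move=> [n _]; rewrite /F/= !in_itv/= => /andP[t1 t2].
    by rewrite (lt_le_trans (nV0 n))//= (le_lt_trans t2)// ltrBlDr ltrDl.
  rewrite in_itv/= => /andP[t0 tp].
  have m0 : 0 < Num.min t (pi - t) by rewrite lt_min t0 subr_gt0.
  have [n _ Hn] := near_infty_natSinv_lt (PosNum m0).
  exists n => //; rewrite /F/= in_itv/=.
  have := Hn n (leqnn n); rewrite /= -addn1 natrD lt_min => /andP[/ltW -> /ltW].
  by rewrite lerBrDl lerBrDr addrC.
apply: (@le_lt_trans _ _ K%:E); last by rewrite ltry.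
have Hc : ((\int[mu]_(x in F i) (1 - ln `|2 * sin x|)%:E)%E @[i --> \oo] -->
   (\int[mu]_(x in `]0%R, pi[) (1 - ln `|2 * sin x|)%:E)%E)%classic.
  rewrite -UF; apply: ge0_nondecreasing_set_cvg_integral => //.
  - move=> m n mn; apply/subsetPset => t; rewrite /F/= !in_itv/= => /andP[t1 t2].
    have : (n%:R + 1)^-1 <= (m%:R + 1)^-1 :> R.
      by rewrite lef_pV2 ?posrE ?ltr_wpDl// lerD2r ler_nat.
    by move=> nm; apply/andP; split; lra.
  - by move=> i; exact: measurable_itv.
  - by move=> i; exact: mg.
apply: (cvge_to_le Hc); near=> n.
apply: HK => //.
  by rewrite ltrBlDr ltrDl.
have := nV1 n; lra.
Unshelve. all: by end_near.
Qed.
End Integrability.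

(** * The Lobachevsky function and the concave volume of ideal tetrahedra *)

Section Lobachevsky.
Variable R : realType.
Implicit Types t u v x y z w d : R.
Local Notation mu := (@lebesgue_measure R).
Local Notation Lob := (@Lobachevsky R).

Lemma LobachevskyE x : 0 <= x -> Lob x = - \int[mu]_(t in `[0, x]) ln `|2 * sin t|.
Proof. by rewrite /Lobachevsky => ->. Qed.

Lemma Lobachevsky0 : Lob 0 = 0.
Proof. by rewrite LobachevskyE// set_itv1 Rintegral_set1 oppr0. Qed.

Lemma Lobachevsky_within_continuous : {within `[0, pi], continuous Lob}%classic.
Proof.
have := @parameterized_integral_continuous R 0 pi _ (pi_ge0 R) (@integrable_ln2sin R).
move=> H; apply: (@subspace_eq_continuous _ _ _ (fun x => - \int[mu]_(t in `[0, x]) ln `|2 * sin t|)).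
  move=> x /set_mem/=; rewrite in_itv/= => /andP[x0 _].
  by rewrite -LobachevskyE.
by move=> x; apply: cvgN; exact: H.
Qed.

(** [Lob \o clamp] is continuous on the whole line and agrees with [Lob] on [[0, pi]], so that paths
    ending at an angle 0 or pi need no one-sided continuity. *)
Definition clamp x := Num.max 0 (Num.min pi x).

Lemma clamp_itv x : 0 <= clamp x <= pi.
Proof. by rewrite /clamp le_max lexx/= ge_max pi_ge0 ge_min lexx. Qed.

Lemma clampE x : 0 <= x <= pi -> clamp x = x.
Proof. by move=> /andP[x0 xp]; rewrite /clamp (min_idPr xp) (max_idPr x0). Qed.

Lemma Lobachevsky_clamp_continuous : continuous (Lob \o clamp).
Proof.
move=> x.
have cc : {for x, continuous clamp}.
  apply: (@continuous_max _ _ (fun=> 0) (Num.min pi)); first exact: cvg_cst.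
  by apply: (@continuous_min _ _ (fun=> pi) id); [exact: cvg_cst|exact: cvg_id].
have /subspace_continuousP H := Lobachevsky_within_continuous.
have xi : (`[0, pi]%classic : set R) (clamp x) by rewrite /= in_itv/= clamp_itv.
move=> U /(H _ xi) HU.
have HU' : nbhs (clamp x) [set z | `[0, pi]%classic z -> U (Lob z)]%classic := HU.
have HU2 : nbhs x (fun z => `[0, pi]%classic (clamp z) -> U (Lob (clamp z))) := cc _ HU'.
suff : nbhs x (fun z => U (Lob (clamp z))) by [].
move: HU2; apply: filterS => z; apply.
by rewrite /= in_itv/= clamp_itv.
Qed.

Lemma is_derive_Lobachevsky x : 0 < x < pi ->
  is_derive x 1 Lob (- ln (2 * sin x)).
Proof.
move=> x0; have /andP[x1 x2] := x0.
have [D1 D2] := continuous_FTC1_closed x2 (@integrable_ln2sin R) x1 (continuous_ln2sin x0).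
apply: (@near_eq_is_derive _ _ _ (fun x => - \int[mu]_(t in `[0, x]) ln `|2 * sin t|)) => //.
  near=> t; rewrite LobachevskyE// ltW//; near: t.
  exact: lt_nbhsr.
rewrite -ln2sinE// -D2 derive1E; apply: is_deriveN.
by split.
Unshelve. all: by end_near.
Qed.

(** Multiplied by [sin x sin y sin (x + y)], the difference of the two sides is [(sin y dx)^2 - 2
    cos (x + y) sin x sin y dx dy + (sin x dy)^2], a sum of two squares. *)
Lemma cotD_le (x y dx dy : R) : 0 < x -> 0 < y -> x + y < pi ->
  cos (x + y) / sin (x + y) * (dx + dy) ^+ 2 <=
  cos x / sin x * dx ^+ 2 + cos y / sin y * dy ^+ 2.
Proof.
move=> x0 y0 xy.
have sx : 0 < sin x by rewrite sin_gt0_pi// x0; lra.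
have sy : 0 < sin y by rewrite sin_gt0_pi// y0; lra.
have sxy : 0 < sin (x + y) by rewrite sin_gt0_pi//; apply/andP; split; lra.
have E1 : cos x * sin (x + y) - cos (x + y) * sin x = sin y.
  rewrite sinD cosD -[RHS]mul1r -(cos2Dsin2 x); ring.
have E2 : cos y * sin (x + y) - cos (x + y) * sin y = sin x.
  rewrite sinD cosD -[RHS]mul1r -(cos2Dsin2 y); ring.
have E3 := cos2Dsin2 (x + y).
move: (sin (x + y)) (cos (x + y)) sxy E1 E2 E3 => s c s0 E1 E2 E3.
rewrite -subr_ge0.
have -> : cos x / sin x * dx ^+ 2 + cos y / sin y * dy ^+ 2 - c / s * (dx + dy) ^+ 2
  = ((cos x * s - c * sin x) * sin y * dx ^+ 2
     + (cos y * s - c * sin y) * sin x * dy ^+ 2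
     - 2 * c * sin x * sin y * dx * dy) / (sin x * sin y * s).
  by field; rewrite !gt_eqF.
rewrite E1 E2; apply: divr_ge0; last by rewrite !mulr_ge0// ltW.
have -> : sin y * sin y * dx ^+ 2 + sin x * sin x * dy ^+ 2
    - 2 * c * sin x * sin y * dx * dy =
    (dx * sin y - c * dy * sin x) ^+ 2 + (dy * sin x * s) ^+ 2
    + (1 - (c ^+ 2 + s ^+ 2)) * (sin x * dy) ^+ 2 by ring.
by rewrite E3 subrr mul0r addr0 addr_ge0// sqr_ge0.
Qed.

(** As [Lob'' = - cot], the form is minus the Hessian of [Lob x + Lob y + Lob z] on
    [x + y + z = pi], the volume of an ideal tetrahedron. There [cot z = - cot (x + y)], so
    [cotD_le] applies. *)
Lemma cot_triangle_ge0 (x y z dx dy dz : R) : 0 < x -> 0 < y -> 0 < z ->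
  x + y + z = pi -> dx + dy + dz = 0 ->
  0 <= cos x / sin x * dx ^+ 2 + cos y / sin y * dy ^+ 2 + cos z / sin z * dz ^+ 2.
Proof.
move=> x0 y0 z0 xyz dxyz; have xy : x + y < pi by lra.
have := cotD_le dx dy x0 y0 xy.
have -> : x + y = - (z - pi) by lra.
have -> : dx + dy = - dz by lra.
rewrite cosN sinN cosB sinB sinpi cospi !mulr0 addr0 subr0 !mulrN1 opprK sqrrN mulNr mulNr.
by lra.
Qed.

Lemma is_derive_line (f : R -> R) x d t f' :
  is_derive (x + t * d) 1 f f' -> is_derive t 1 (fun s : R => f (x + s * d)) (d * f').
Proof.
move=> D; have H := @is_derive1_comp R f (fun s => x + s * d) t _ d D.
have -> : d * f' = f' * d by rewrite mulrC.
apply: H; apply: is_derive_eq => //.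
by rewrite add0r /GRing.scale/=; ring.
Qed.

(** A concave function lies below its tangent plane at the interior point [x], also at boundary
    points [y]. The gradient is [- ln (2 sin x_i)]; as both angle sums are pi, its [ln 2] adds the
    same constant to both sides. *)
Lemma Lobachevsky_triangle_max (x1 x2 x3 y1 y2 y3 : R) :
  0 < x1 -> 0 < x2 -> 0 < x3 -> x1 + x2 + x3 = pi ->
  0 <= y1 -> 0 <= y2 -> 0 <= y3 -> y1 + y2 + y3 = pi ->
  Lob y1 + Lob y2 + Lob y3
    + (y1 * ln (sin x1) + y2 * ln (sin x2) + y3 * ln (sin x3)) <=
  Lob x1 + Lob x2 + Lob x3
    + (x1 * ln (sin x1) + x2 * ln (sin x2) + x3 * ln (sin x3)).
Proof.
move=> x10 x20 x30 Sx y10 y20 y30 Sy.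
pose w x := ln (2 * sin x).
have lnE x : 0 < x -> x < pi -> ln (sin x) = w x - ln 2.
  by move=> ? ?; rewrite /w lnM ?posrE ?sin_gt0_pi//; lra.
rewrite !lnE; try lra.
pose d1 := y1 - x1; pose d2 := y2 - x2; pose d3 := y3 - x3.
have Sd : d1 + d2 + d3 = 0 by rewrite /d1 /d2 /d3; lra.
(* The linear term has the slope that makes the derivative of [g] vanish at [t = 0]; [clamp] keeps
   [g] continuous at [t = 1], where [y] may be on the boundary. *)
pose k x d t : R := Lob (clamp (x + t * d)) + (x + t * d) * w x.
pose g t := k x1 d1 t + k x2 d2 t + k x3 d3 t.
have in0 x y t : 0 < x -> x < pi -> 0 <= y -> y <= pi -> 0 <= t < 1 ->
    0 < x + t * (y - x) < pi.
  move=> x0 xp y0 yp /andP[t0 t1].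
  have -> : x + t * (y - x) = (1 - t) * x + t * y by ring.
  have t2 : 0 < 1 - t by lra.
  have := mulr_gt0 t2 x0; have := mulr_ge0 t0 y0.
  have : 0 < (1 - t) * (pi - x) by apply: mulr_gt0 => //; lra.
  have : 0 <= t * (pi - y) by apply: mulr_ge0 => //; lra.
  by move=> *; apply/andP; split; lra.
(* Minus the derivative of the volume along the segment. Concavity makes it increase, and
   [g' t = m 0 - m t]. *)
pose m t := d1 * ln `|2 * sin (x1 + t * d1)| + d2 * ln `|2 * sin (x2 + t * d2)|
          + d3 * ln `|2 * sin (x3 + t * d3)|.
have Dm t : 0 <= t < 1 -> is_derive t 1 m
    (d1 * (d1 * (cos (x1 + t * d1) / sin (x1 + t * d1))) +
     d2 * (d2 * (cos (x2 + t * d2) / sin (x2 + t * d2))) +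
     d3 * (d3 * (cos (x3 + t * d3) / sin (x3 + t * d3)))).
  move=> t01.
  have H x y : 0 < x -> x < pi -> 0 <= y -> y <= pi ->
      is_derive t 1 (fun t => (y - x) * ln `|2 * sin (x + t * (y - x))|)
      ((y - x) * ((y - x) * (cos (x + t * (y - x)) / sin (x + t * (y - x))))).
    move=> x0 xp y0 yp; apply: is_deriveZ.
    by apply: (@is_derive_line (fun t => ln `|2 * sin t|)); apply: is_derive_ln2sin; exact: in0.
  by apply: is_deriveD; [apply: is_deriveD|]; apply: H; lra.
have mle t : 0 <= t < 1 -> m 0 <= m t.
  move=> /andP[t0 t1].
  apply: (@ger0_derive1_le_cc _ m 0 t) => //.
  - move=> x; rewrite in_itv/= => /andP[? ?].
    by apply: (@ex_derive _ _ _ _ _ _ _ (Dm x _)); apply/andP; split; lra.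
  - move=> x; rewrite in_itv/= => /andP[? ?].
    have x01 : 0 <= x < 1 by apply/andP; split; lra.
    rewrite derive1E (@derive_val _ _ _ _ _ _ _ (Dm x x01)).
    have := @cot_triangle_ge0 (x1 + x * d1) (x2 + x * d2) (x3 + x * d3) d1 d2 d3.
    move=> /(_ _ _ _ _ Sd) H.
    rewrite !(mulrA _ _ (_ / _)) -!expr2 !(mulrC (_ ^+ 2)); apply: H.
    + by have /andP[] := @in0 x1 y1 x x10 ltac:(lra) y10 ltac:(lra) x01.
    + by have /andP[] := @in0 x2 y2 x x20 ltac:(lra) y20 ltac:(lra) x01.
    + by have /andP[] := @in0 x3 y3 x x30 ltac:(lra) y30 ltac:(lra) x01.
    + have : x * (d1 + d2 + d3) = 0 by rewrite Sd mulr0.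
      by rewrite !mulrDr; lra.
  - apply: continuous_in_subspaceT => x /set_mem/=; rewrite in_itv/= => /andP[? ?].
    apply: differentiable_continuous; apply/derivable1_diffP.
    by apply: (@ex_derive _ _ _ _ _ _ _ (Dm x _)); apply/andP; split; lra.
  - by rewrite in_itv/= lexx.
  - by rewrite in_itv/= t0 lexx.
have Dk x y t : 0 < x -> x < pi -> 0 <= y -> y <= pi -> 0 < t < 1 ->
   is_derive t 1 (k x (y - x)) ((y - x) * (- w (x + t * (y - x)) + w x)).
  move=> x0 xp y0 yp /andP[t0 t1]; rewrite mulrDr; apply: is_deriveD.
    have t01 : 0 <= t < 1 by rewrite ltW.
    apply: (@is_derive_line (Lob \o clamp)).
    apply: (@near_eq_is_derive _ _ _ Lob); last first.
      by apply: is_derive_Lobachevsky; apply: in0.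
    near=> z; rewrite /= clampE//.
    suff : z \in `]0, pi[ by rewrite in_itv/= => /andP[/ltW-> /ltW->].
    near: z; apply: near_in_itvoo; rewrite in_itv/=; exact: in0.
  apply: is_derive_eq => //.
  by rewrite add0r /GRing.scale/=; ring.
have Dg t : 0 < t < 1 -> is_derive t 1 g (m 0 - m t).
  move=> t01; have t01' : 0 <= t < 1 by case/andP: t01 => /ltW-> ->.
  have -> : m 0 - m t = d1 * (- w (x1 + t * d1) + w x1)
     + d2 * (- w (x2 + t * d2) + w x2) + d3 * (- w (x3 + t * d3) + w x3).
    rewrite /m !mul0r !addr0 !ln2sinE; try (by apply/andP; split; lra); try (by apply: in0; lra).
    by rewrite /w; ring.
  by apply: is_deriveD; [apply: is_deriveD|]; apply: Dk => //; lra.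
have : g 1 <= g 0.
  apply: (@ler0_derive1_le_cc _ g 0 1) => //.
  - move=> x; rewrite in_itv/= => x01; exact: (@ex_derive _ _ _ _ _ _ _ (Dg x _)).
  - move=> x; rewrite in_itv/= => /andP[? ?].
    rewrite derive1E (@derive_val _ _ _ _ _ _ _ (Dg x _)); last by apply/andP; split.
    by rewrite subr_le0 mle//; apply/andP; split; lra.
  - apply: continuous_subspaceT => t.
    have ck x d : {for t, continuous (k x d)}.
      have cl : {for t, continuous (fun t => x + t * d)}.
        apply: cvgD; first exact: cvg_cst.
        by apply: cvgM; [exact: cvg_id|exact: cvg_cst].
      apply: cvgD; last by apply: cvgM => //; exact: cvg_cst.
      apply: (@continuous_comp _ _ _ (fun t => x + t * d) (Lob \o clamp)) => //.
      exact: Lobachevsky_clamp_continuous.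
    by apply: cvgD; [apply: cvgD|]; exact: ck.
  - by rewrite in_itv/= lexx ler01.
  - by rewrite in_itv/= lexx ler01.
rewrite /g /k !mul0r !mul1r !addr0 /d1 /d2 /d3 !subrKC.
rewrite !clampE; try (by apply/andP; split; lra).
have -> : forall a b c : R, a * (w x1 - ln 2) + b * (w x2 - ln 2) + c * (w x3 - ln 2)
  = a * w x1 + b * w x2 + c * w x3 - (a + b + c) * ln 2 by move=> *; ring.
by rewrite (_ : x1 * _ + _ + _ = x1 * w x1 + x2 * w x2 + x3 * w x3 - (x1+x2+x3) * ln 2); [rewrite Sx Sy; lra|ring].
Unshelve. all: by end_near.
Qed.
End Lobachevsky.

(** * The volume on the simplex of angles and its tangent planes *)

Section Tetrahedron.
Variable R : realType.
Implicit Types a b c h x y z s : R.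
Local Notation Lob := (@Lobachevsky R).

Lemma sin_piB x : sin (pi - x) = sin x.
Proof. by rewrite sinB sinpi cospi mul0r sub0r mulN1r opprK. Qed.

(** The derivative of the left side vanishes by [sin (pi - x) = sin x]. This cancels the angles
    [b + c] and [pi - (b + c)] when the three ideal tetrahedra are added. *)
Lemma Lobachevsky_piB x : 0 <= x <= pi -> Lob (pi - x) + Lob x = Lob pi.
Proof.
move=> /andP[x0 xp].
pose g t : R := Lob (clamp (pi + t * -1)) + Lob (clamp (0 + t * 1)).
have Dl (u d t : R) : 0 < u + t * d < pi ->
    is_derive t 1 (fun t => Lob (clamp (u + t * d))) (d * - ln (2 * sin (u + t * d))).
  move=> ud; apply: (@is_derive_line _ (Lob \o @clamp R)).
  apply: (@near_eq_is_derive _ _ _ Lob); last exact: is_derive_Lobachevsky.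
  near=> w; rewrite /= clampE//.
  suff : w \in `]0, pi[ by rewrite in_itv/= => /andP[/ltW-> /ltW->].
  by near: w; apply: near_in_itvoo; rewrite in_itv.
have Dg t : t \in `]0, pi[ -> is_derive t 1 g 0.
  rewrite in_itv/= => /andP[t0 tp].
  have -> : 0 = -1 * - ln (2 * sin (pi + t * -1)) + 1 * - ln (2 * sin (0 + t * 1)).
    have -> : pi + t * -1 = pi - t by ring.
    have -> : 0 + t * 1 = t by ring.
    by rewrite sin_piB; ring.
  by apply: is_deriveD; apply: Dl; apply/andP; split; lra.
have cg : {within `[0, pi], continuous g}%classic.
  apply: continuous_subspaceT => t.
  have cl (u d : R) : {for t, continuous (fun t : R => Lob (clamp (u + t * d)))}.
    apply: (@continuous_comp _ _ _ (fun t : R => u + t * d) (Lob \o @clamp R)).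
      apply: cvgD; first exact: cvg_cst.
      by apply: cvgM; [exact: cvg_id|exact: cvg_cst].
    exact: Lobachevsky_clamp_continuous.
  by apply: cvgD; exact: cl.
have dg t : t \in `]0, pi[ -> derivable g t 1 by move=> /Dg[].
have dg0 t : t \in `]0, pi[ -> g^`()%classic t = 0.
  by move=> /Dg D; rewrite derive1E; apply: derive_val.
have gE : g x = g 0.
  apply/eqP; rewrite eq_le; apply/andP; split.
    apply: (@ler0_derive1_le_cc _ g 0 pi) => //.
    - by move=> t /dg0 ->.
    - by rewrite in_itv/= x0.
    - by rewrite in_itv/= lexx pi_ge0.
  apply: (@ger0_derive1_le_cc _ g 0 pi) => //.
  - by move=> t /dg0 ->.
  - by rewrite in_itv/= lexx pi_ge0.
  - by rewrite in_itv/= x0.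
move: gE; rewrite /g !mul0r !addr0 !add0r mulr1 mulrN1.
rewrite !clampE ?Lobachevsky0 ?addr0//; rewrite ?lexx ?pi_ge0//.
  by rewrite x0.
by apply/andP; split; lra.
Unshelve. all: by end_near.
Qed.

Definition volume2 a b c h : R :=
  Lob h + (Lob a + Lob b + Lob c) + (Lob (a + h) + Lob (b + h) + Lob (c + h)).

(** [x, y, z] stand for the numbers [l_jk - l_1j - l_1k]: the angle sums at the ideal vertices
    express [sum l_e alpha_e], up to a constant, through the angles [a + h, b + h, c + h] alone. *)
Definition objective x y z a b c h : R :=
  volume2 a b c h + (a + h) * x + (b + h) * y + (c + h) * z.

Definition angle_simplex a b c h : Prop :=
  [/\ 0 <= a, 0 <= b, 0 <= c, 0 <= h & a + b + c + 2 * h = pi].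

Definition angle_interior a b c h : Prop :=
  [/\ 0 < a, 0 < b, 0 < c, 0 < h & a + b + c + 2 * h = pi].

(** Minus the partial derivative of [volume2] along [a + h], when [a + h, b + h, c + h] are taken as
    free coordinates on the simplex. *)
Definition log_ratio a b c h : R :=
  ln (sin h) + ln (sin (a + h)) - ln (sin b) - ln (sin c).

Lemma objective_rot x y z a b c h : objective x y z a b c h = objective y z x b c a h.
Proof. by rewrite /objective /volume2; ring. Qed.

Lemma angle_simplex_rot a b c h : angle_simplex a b c h -> angle_simplex b c a h.
Proof. by move=> [? ? ? ? E]; split=> //; lra. Qed.

Lemma angle_interior_rot a b c h : angle_interior a b c h -> angle_interior b c a h.
Proof. by move=> [? ? ? ? E]; split=> //; lra. Qed.

Lemma angle_interiorW a b c h : angle_interior a b c h -> angle_simplex a b c h.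
Proof. by move=> [? ? ? ? ?]; split => //; exact: ltW. Qed.

(** The sum of three tangent plane inequalities for ideal tetrahedra. With the log ratios as weights
    the interior point is critical for the concave objective, hence a global maximum on the closed
    simplex. *)
Lemma objective_le a b c h a' b' c' h' :
  angle_interior a b c h -> angle_simplex a' b' c' h' ->
  objective (log_ratio a b c h) (log_ratio b c a h) (log_ratio c a b h) a' b' c' h' <=
  objective (log_ratio a b c h) (log_ratio b c a h) (log_ratio c a b h) a b c h.
Proof.
move=> [a0 b0 c0 h0 S] [a0' b0' c0' h0' S'].
have pos : [/\ 0 < b + h, 0 < c + h, 0 < pi - (b + c), 0 < a + h & 0 < b + c].
  by split; lra.
have pos' : [/\ 0 <= b' + h', 0 <= c' + h', 0 <= pi - (b' + c'), 0 <= a' + h' & 0 <= b' + c'].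
  by split; lra.
have [bh ch bc' ah bc] := pos; have [bh' ch' bc'' ah' bc'_] := pos'.
have S1 : a + (b + h) + (c + h) = pi by lra.
have S1' : a' + (b' + h') + (c' + h') = pi by lra.
have S2 : b + c + (pi - (b + c)) = pi by ring.
have S2' : b' + c' + (pi - (b' + c')) = pi by ring.
have S3 : h + (a + h) + (b + c) = pi by lra.
have S3' : h' + (a' + h') + (b' + c') = pi by lra.
have := @Lobachevsky_piB (b + c) ltac:(apply/andP; split; lra).
have := @Lobachevsky_piB (b' + c') ltac:(apply/andP; split; lra).
have aE : a = pi - b - c - 2 * h by lra.
have aE' : a' = pi - b' - c' - 2 * h' by lra.
have := Lobachevsky_triangle_max a0 bh ch S1 a0' bh' ch' S1'.
have := Lobachevsky_triangle_max b0 c0 bc' S2 b0' c0' bc'' S2'.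
have := Lobachevsky_triangle_max h0 ah bc S3 h0' ah' bc'_ S3'.
rewrite sin_piB.
rewrite /objective /volume2 /log_ratio.
move=> T1 T2 T3 P' P; move: T1 T2 T3.
have -> : Lob (pi - (b + c)) = Lob pi - Lob (b + c) by rewrite -P addrK.
have -> : Lob (pi - (b' + c')) = Lob pi - Lob (b' + c') by rewrite -P' addrK.
move=> T1 T2 T3; have := lerD (lerD T1 T2) T3.
move: (ln (sin h)) (ln (sin a)) (ln (sin b)) (ln (sin c)) (ln (sin (a + h)))
  (ln (sin (b + h))) (ln (sin (c + h))) (ln (sin (b + c))) => lh la lb lc lah lbh lch lbc.
(* By [u + v + w + 2 k = pi] the linear terms collect into the log ratios, plus a multiple of [pi]
   that is common to both points. *)
have El u v w k : u + v + w + 2 * k = pi ->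
  (k * lh + (u + k) * lah + (v + w) * lbc) + (v * lb + w * lc + (pi - (v + w)) * lbc)
   + (u * la + (v + k) * lbh + (w + k) * lch) =
  (u + k) * (lh + lah - lb - lc) + (v + k) * (lh + lbh - lc - la)
   + (w + k) * (lh + lch - la - lb) + pi * (lbc - lh + la + lb + lc).
  move=> E; have -> : u = pi - v - w - 2 * k by rewrite -E; ring.
  by ring.
have Ea (k l m n o p q r t l1 l2 l3 : R) :
  (k + l + m + l1) + (n + o + (p - m) + l2) + (q + r + t + l3) =
  (k + (q + n + o) + (l + r + t)) + (p + (l1 + l2 + l3)) by ring.
rewrite !{}Ea !{}El//.
move: (Lob h + _ + _) (Lob h' + _ + _) => V1 V2.
move: ((a + h) * _) ((b + h) * _) ((c + h) * _) ((a' + h') * _) ((b' + h') * _) ((c' + h') * _).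
move: (pi * _) (Lob pi) => K p x1 y1 z1 x2 y2 z2; clear; lra.
Qed.

Lemma objective_line x y z a b c h a' b' c' h' s :
  objective x y z (a + s * (a' - a)) (b + s * (b' - b)) (c + s * (c' - c))
    (h + s * (h' - h))
  = volume2 (a + s * (a' - a)) (b + s * (b' - b)) (c + s * (c' - c))
      (h + s * (h' - h))
    + (a + h) * x + (b + h) * y + (c + h) * z
    + s * ((a' + h' - a - h) * x + (b' + h' - b - h) * y
           + (c' + h' - c - h) * z).
Proof. by rewrite /objective; ring. Qed.

Lemma angle_interior_line a b c h a' b' c' h' s :
  angle_simplex a b c h -> angle_interior a' b' c' h' -> 0 < s <= 1 ->
  angle_interior (a + s * (a' - a)) (b + s * (b' - b)) (c + s * (c' - c)) (h + s * (h' - h)).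
Proof.
move=> [a0 b0 c0 h0 S] [a0' b0' c0' h0' S'] /andP[s0 s1].
have H u v : 0 <= u -> 0 < v -> 0 < u + s * (v - u).
  move=> u0 v0; have -> : u + s * (v - u) = (1 - s) * u + s * v by ring.
  by rewrite ltr_wpDl ?mulr_gt0// mulr_ge0// subr_ge0.
split; try exact: H.
have -> : a + s * (a' - a) + (b + s * (b' - b)) + (c + s * (c' - c)) + 2 * (h + s * (h' - h))
 = (a + b + c + 2 * h) + s * ((a' + b' + c' + 2 * h') - (a + b + c + 2 * h)) by ring.
by rewrite S S' subrr mulr0 addr0.
Qed.

Definition maximizer x y z a b c h := angle_simplex a b c h /\
  forall a' b' c' h', angle_simplex a' b' c' h' ->
    objective x y z a' b' c' h' <= objective x y z a b c h.

Lemma maximizer_rot x y z a b c h : maximizer x y z a b c h -> maximizer y z x b c a h.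
Proof.
move=> [S H]; split; first exact: angle_simplex_rot.
move=> a' b' c' h' S'; rewrite -!(objective_rot x).
by apply: H; do 2 apply: angle_simplex_rot.
Qed.

(* Monotonicity of the gradient of the concave volume along the segment from
   the maximizer to an interior point. *)
Lemma maximizer_slope x y z a b c h a' b' c' h' s :
  maximizer x y z a b c h -> angle_interior a' b' c' h' -> 0 < s <= 1 ->
  (a' + h' - a - h) * x + (b' + h' - b - h) * y + (c' + h' - c - h) * z <=
  (a' + h' - a - h) * log_ratio (a + s * (a' - a)) (b + s * (b' - b))
                                (c + s * (c' - c)) (h + s * (h' - h))
  + (b' + h' - b - h) * log_ratio (b + s * (b' - b)) (c + s * (c' - c))
                                  (a + s * (a' - a)) (h + s * (h' - h))
  + (c' + h' - c - h) * log_ratio (c + s * (c' - c)) (a + s * (a' - a))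
                                  (b + s * (b' - b)) (h + s * (h' - h)).
Proof.
move=> [S M] I s01.
have Is := angle_interior_line S I s01.
have M1 := M _ _ _ _ (angle_interiorW Is).
have M2 := objective_le Is S; move: M1 M2.
rewrite !objective_line /objective.
set X := log_ratio _ _ _ _; set Y := log_ratio _ _ _ _; set Z := log_ratio _ _ _ _.
rewrite -subr_ge0 => M1; rewrite -subr_ge0 => M2.
case/andP: s01 => s0 _.
(* The sum of the two inequalities no longer contains the volumes; what remains is [s] times the
   claim. *)
rewrite -(ler_pM2l s0) -subr_ge0; move: (addr_ge0 M1 M2); congr (0 <= _).
by ring.
Qed.

Lemma at_right_le (f : R -> R) (k l : R) : (f s @[s --> 0^'+] --> l)%classic ->
  (forall s, 0 < s <= 1 -> k <= f s) -> k <= l.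
Proof.
move=> fl kf; apply: (cvgr_to_ge fl); near=> s; apply: kf.
by apply/andP; split; near: s; [exact: nbhs_right_gt|apply: nbhs_right_le].
Unshelve. all: by end_near.
Qed.

Lemma cvg_ln_sin_line x y : 0 < x < pi ->
  (ln (sin (x + s * y)) @[s --> 0^'+] --> ln (sin x))%classic.
Proof.
move=> x0; apply: cvg_at_right_filter.
have : {for 0, continuous (fun s : R => ln (sin (x + s * y)))}.
  apply: (@continuous_comp _ _ _ (fun s : R => sin (x + s * y)) (@ln R)).
    apply: (@continuous_comp _ _ _ (fun s : R => x + s * y) (@sin R)).
      apply: cvgD; first exact: cvg_cst.
      by apply: cvgM; [exact: cvg_id|exact: cvg_cst].
    exact: continuous_sin.
  by apply: continuous_ln; rewrite mul0r addr0 sin_gt0_pi.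
by rewrite /prop_for /continuous_at mul0r addr0.
Qed.

Lemma cvg_log_ratio_line a b c h a' b' c' h' : angle_interior a b c h ->
  (log_ratio (a + s * a') (b + s * b') (c + s * c') (h + s * h')
     @[s --> 0^'+] --> log_ratio a b c h)%classic.
Proof.
move=> [a0 b0 c0 h0 S]; rewrite /log_ratio.
apply: cvgB; last by apply: cvg_ln_sin_line; apply/andP; split; lra.
apply: cvgB; last by apply: cvg_ln_sin_line; apply/andP; split; lra.
apply: cvgD; first by apply: cvg_ln_sin_line; apply/andP; split; lra.
have -> : (fun s => ln (sin (a + s * a' + (h + s * h')))) =
    (fun s => ln (sin ((a + h) + s * (a' + h')))).
  by apply/funext => s; congr (ln (sin _)); ring.
by apply: cvg_ln_sin_line; apply/andP; split; lra.
Qed.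

(** The direction [(0, -d, -d, d)] changes [a + h] alone and is feasible for both signs of a small
    [d]. In the limit [s -> 0] the two slope bounds are opposite inequalities for [x]. *)
Lemma maximizer_interior x y z a b c h :
  maximizer x y z a b c h -> angle_interior a b c h -> x = log_ratio a b c h.
Proof.
move=> M I; have [a0 b0 c0 h0 S] := I.
pose e := Num.min (Num.min b c) h / 2.
have e0 : 0 < e by rewrite divr_gt0// !lt_min b0 c0 h0.
have eb : e < b by apply: (@le_lt_trans _ _ (b / 2)); rewrite ?ler_pM2r// ?ge_min ?lexx //; lra.
have ec : e < c by apply: (@le_lt_trans _ _ (c / 2)); rewrite ?ler_pM2r// ?ge_min ?lexx ?orbT//; lra.
have eh : e < h by apply: (@le_lt_trans _ _ (h / 2)); rewrite ?ler_pM2r// ?ge_min ?lexx ?orbT//; lra.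
have H d : `|d| <= e -> d * x <= d * log_ratio a b c h.
  rewrite ler_norml => /andP[d1 d2].
  have I' : angle_interior a (b - d) (c - d) (h + d) by split; lra.
  have := maximizer_slope M I'; rewrite /=.
  have -> : a + (h + d) - a - h = d by ring.
  have -> : b - d + (h + d) - b - h = 0 by ring.
  have -> : c - d + (h + d) - c - h = 0 by ring.
  move=> K; apply: at_right_le; last first.
    by move=> s s01; have := K s s01; rewrite !mul0r !addr0; apply.
  by apply: cvgM; [exact: cvg_cst|exact: cvg_log_ratio_line].
have := H e; have := H (- e); rewrite normrN gtr0_norm// lexx !mulNr lerN2 => /(_ isT) H1 /(_ isT) H2.
by apply: (@mulfI _ e); [rewrite gt_eqF|apply/eqP; rewrite eq_le H2 H1].
Qed.
End Tetrahedron.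

(** * Infinite slopes at boundary points other than the vertices *)

Section Boundary.
Variable R : realType.
Implicit Types a b c h x y z s : R.
Local Notation Lob := (@Lobachevsky R).

(** If [x <= y], the factor is non-negative and the logarithm non-positive, even when [x = 0]; if
    [y < x], then [x] is an interior angle and the logarithm converges. *)
Lemma ln_sin_line_bounded x y : 0 <= x < pi -> 0 < y < pi ->
  exists m, (\forall s \near 0^'+, (y - x) * ln (sin (x + s * (y - x))) <= m)%classic.
Proof.
move=> /andP[x0 xp] /andP[y0 yp].
have [xy|yx] := leP x y.
  exists 0; near=> s.
  have s01 : 0 < s <= 1.
    by apply/andP; split; near: s; [exact: nbhs_right_gt|apply: nbhs_right_le].
  by rewrite mulr_ge0_le0 ?subr_ge0// ln_le0// sin_le1.
exists ((y - x) * (ln (sin x) - 1)).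
have x0' : 0 < x < pi by apply/andP; split; lra.
have /cvgrPdist_le H := cvg_ln_sin_line (y - x) x0'.
near=> s; rewrite ler_wnM2l; [by []|lra|].
have : `|ln (sin x) - ln (sin (x + s * (y - x)))| <= 1.
  by near: s; apply: H.
by rewrite ler_norml => /andP[_]; lra.
Unshelve. all: by end_near.
Qed.

Lemma sin_le_id x : 0 <= x -> sin x <= x.
Proof.
move=> x0.
have D (t : R) : is_derive t 1 (fun t : R => t - sin t) (1 - cos t) by apply: is_derive_eq.
rewrite -subr_ge0.
have -> : 0 = (fun t : R => t - sin t) 0 by rewrite /= sin0 subr0.
apply: (@ger0_derive1_le_cc _ (fun t : R => t - sin t) 0 x) => //.
- move=> t _; rewrite derive1E (@derive_val _ _ _ _ _ _ _ (D t)).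
  by rewrite subr_ge0 cos_le1.
- apply: continuous_subspaceT => t; apply: differentiable_continuous.
  by apply/derivable1_diffP; have [] := D t.
- by rewrite in_itv/= lexx.
- by rewrite in_itv/= x0 lexx.
Qed.

(** Here [sin (s y) <= s y] sends the logarithm to minus infinity. The unreduced [y - 0] and
    [0 + s * _] match the terms [L u q s] after the substitution of [u = 0]. *)
Lemma ln_sin_line_unbounded y k : 0 < y < pi ->
  (\forall s \near 0^'+, (y - 0) * ln (sin (0 + s * (y - 0))) <= k)%classic.
Proof.
move=> /andP[y0 yp]; near=> s.
have s0 : 0 < s by near: s; exact: nbhs_right_gt.
have s1 : s <= 1 by near: s; apply: nbhs_right_le.
rewrite !subr0 add0r mulrC -ler_pdivlMr//.
have sy0 : 0 < s * y by rewrite mulr_gt0.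
have syp : s * y < pi by rewrite (le_lt_trans _ yp)// ler_piMl// ltW.
have ssy : 0 < sin (s * y) by rewrite sin_gt0_pi// sy0.
rewrite -ler_expR lnK ?posrE//.
apply: (le_trans (sin_le_id (ltW sy0))).
rewrite -ler_pdivlMr//; near: s; apply: nbhs_right_le.
by rewrite divr_gt0// expR_gt0.
Unshelve. all: by end_near.
Qed.

(** On a segment to an interior point the right side of [maximizer_slope] is a sum of [(y_i - x_i)
    ln (sin (x_i + s (y_i - x_i)))] over the seven angles of [volume2]. A vanishing angle drives its
    term to minus infinity as [s -> 0]; only an angle pi could compensate, and the angles
    [a + h, b + h, c + h] reach pi at a vertex only. *)
Lemma maximizer_not_vertex x y z a b c h :
  maximizer x y z a b c h -> a < pi -> b < pi -> c < pi -> angle_interior a b c h.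
Proof.
move=> M ap bp cp; have [[a0 b0 c0 h0 S] _] := M.
have p0 := pi_gt0 R.
(* The interior point with four equal coordinates, as [3 q + 2 q = pi]. *)
pose q : R := pi / 5.
have qE : pi = 5 * q by rewrite /q; field.
have q0 : 0 < q by rewrite divr_gt0.
have I : angle_interior q q q q by split => //; lra.
have sl := maximizer_slope M I.
set k := _ + _ in sl.
(* The slope bound fails near the maximizer if one of its angles vanishes. *)
have ahp : a + h < pi by rewrite lt_neqAle; apply/andP; split; [apply/eqP => E|]; lra.
have bhp : b + h < pi by rewrite lt_neqAle; apply/andP; split; [apply/eqP => E|]; lra.
have chp : c + h < pi by rewrite lt_neqAle; apply/andP; split; [apply/eqP => E|]; lra.
have qq : 0 < q < pi by apply/andP; split; lra.
have q2 : 0 < q + q < pi by apply/andP; split; lra.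
have [ma Ha] := @ln_sin_line_bounded a q ltac:(by rewrite a0) qq.
have [mb Hb] := @ln_sin_line_bounded b q ltac:(by rewrite b0) qq.
have [mc Hc] := @ln_sin_line_bounded c q ltac:(by rewrite c0) qq.
have [mh Hh] := @ln_sin_line_bounded h q ltac:(apply/andP; split; lra) qq.
have [mah Hah] := @ln_sin_line_bounded (a + h) (q + q) ltac:(apply/andP; split; lra) q2.
have [mbh Hbh] := @ln_sin_line_bounded (b + h) (q + q) ltac:(apply/andP; split; lra) q2.
have [mch Hch] := @ln_sin_line_bounded (c + h) (q + q) ltac:(apply/andP; split; lra) q2.
(* If one of the terms is at most its bound plus [m], the seven terms add up to at most [k - 1],
   which contradicts the slope bound [k]. *)
pose m := k - 1 - (ma + mb + mc + mh + mah + mbh + mch).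
pose B := [/\ 0 < a, 0 < b, 0 < c & 0 < h].
have [[? ? ? ?]|NB] := pselect B; first by split.
exfalso.
pose L (u v s : R) := (v - u) * ln (sin (u + s * (v - u))).
have Hm : (\forall s \near 0^'+, L a q s <= ma + m \/ L b q s <= mb + m \/
     L c q s <= mc + m \/ L h q s <= mh + m)%classic.
  have [a0'|a0'] := ltP 0 a; last first.
    have -> : a = 0 by apply/eqP; rewrite eq_le a0 a0'.
    by near=> s; left; near: s; exact: ln_sin_line_unbounded.
  have [b0'|b0'] := ltP 0 b; last first.
    have -> : b = 0 by apply/eqP; rewrite eq_le b0 b0'.
    by near=> s; right; left; near: s; exact: ln_sin_line_unbounded.
  have [c0'|c0'] := ltP 0 c; last first.
    have -> : c = 0 by apply/eqP; rewrite eq_le c0 c0'.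
    by near=> s; right; right; left; near: s; exact: ln_sin_line_unbounded.
  have [h0'|h0'] := ltP 0 h; first by exfalso; apply: NB.
  have -> : h = 0 by apply/eqP; rewrite eq_le h0 h0'.
  by near=> s; right; right; right; near: s; exact: ln_sin_line_unbounded.
have [s [s01 [La Lb Lc Lh] [Lah Lbh Lch] Lm]] : exists s : R, [/\ 0 < s <= 1,
    [/\ L a q s <= ma, L b q s <= mb, L c q s <= mc & L h q s <= mh],
    [/\ L (a + h) (q + q) s <= mah, L (b + h) (q + q) s <= mbh &
       L (c + h) (q + q) s <= mch] &
    L a q s <= ma + m \/ L b q s <= mb + m \/
     L c q s <= mc + m \/ L h q s <= mh + m].
  apply: (@filter_ex _ ((0 : R)^'+)%classic).
  near=> s; split.
  - by apply/andP; split; near: s; [exact: nbhs_right_gt|apply: nbhs_right_le].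
  - by split; near: s.
  - by split; near: s.
  - by near: s.
have := sl s s01; rewrite leNgt => /negP; apply.
have -> : (q + q - a - h) * log_ratio (a + s * (q - a)) (b + s * (q - b)) (c + s * (q - c)) (h + s * (q - h))
  + (q + q - b - h) * log_ratio (b + s * (q - b)) (c + s * (q - c)) (a + s * (q - a)) (h + s * (q - h))
  + (q + q - c - h) * log_ratio (c + s * (q - c)) (a + s * (q - a)) (b + s * (q - b)) (h + s * (q - h))
  = L a q s + L b q s + L c q s + L h q s + L (a + h) (q + q) s + L (b + h) (q + q) s + L (c + h) (q + q) s.
  rewrite /log_ratio /L.
  have lE (u : R) : u + s * (q - u) + (h + s * (q - h)) = u + h + s * (q + q - (u + h)) by ring.
  rewrite !lE.
  have -> : a = 5 * q - b - c - 2 * h by rewrite -qE -S; ring.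
  by ring.
move: (L a q s) (L b q s) (L c q s) (L h q s) (L (a + h) _ s) (L (b + h) _ s) (L (c + h) _ s)
  La Lb Lc Lh Lah Lbh Lch Lm => l1 l2 l3 l4 l5 l6 l7.
by rewrite /m; clear; move=> ? ? ? ? ? ? ? [?|[?|[?|?]]]; lra.
Unshelve. all: by end_near.
Qed.
End Boundary.

(** * Directional limits of the gradient at a vertex, and vertices as maximizers *)

Section Vertex.
Variable R : realType.
Implicit Types a b c h x y z s p q r : R.
Local Notation Lob := (@Lobachevsky R).

Lemma cvg_line_at_right x y : (x + s * y @[s --> 0^'+] --> x)%classic.
Proof.
apply: cvg_at_right_filter.
have : {for 0, continuous (fun s : R => x + s * y)}.
  apply: cvgD; first exact: cvg_cst.
  by apply: cvgM; [exact: cvg_id|exact: cvg_cst].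
by rewrite /prop_for /continuous_at mul0r addr0.
Qed.

(** Squeezed by [s p cos (s p) <= sin (s p) <= s p]. A log ratio has two positive and two negative
    logarithms, so the divergent [ln s] cancels in it. *)
Lemma cvg_ln_sin_scale p : 0 < p ->
  (ln (sin (s * p)) - ln s @[s --> 0^'+] --> ln p)%classic.
Proof.
move=> p0.
apply: (@squeeze_cvgr _ _ _ _ (fun s => ln (cos (0 + s * p)) + ln p) (fun=> ln p)).
- near=> s.
  have s0 : 0 < s by near: s; exact: nbhs_right_gt.
  have sp : s * p < 1.
    by rewrite -ltr_pdivlMr//; near: s; apply: nbhs_right_lt; rewrite divr_gt0.
  have sp0 : 0 < s * p by rewrite mulr_gt0.
  have pi2 := pihalf_ge1 R.
  have ps : 0 < sin (s * p) by rewrite sin_gt0_pi//; apply/andP; split => //; lra.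
  have cs : 0 < cos (s * p) by rewrite cos_gt0_pihalf//; apply/andP; split; lra.
  rewrite add0r; apply/andP; split.
    rewrite lerBrDr -addrA -lnM ?posrE// -lnM ?posrE ?mulr_gt0//.
    rewrite ler_ln ?posrE ?mulr_gt0// (mulrC p) (mulrC (cos _)) mul_cos_le_sin//.
    by apply/andP; split; lra.
  rewrite lerBlDr -lnM ?posrE// ler_ln ?posrE ?mulr_gt0// (mulrC p).
  by apply: sin_le_id; rewrite ltW.
- rewrite -[X in (_ --> X)%classic]add0r; apply: cvgD; last exact: cvg_cst.
  have E : ln (cos 0) = 0 :> R by rewrite cos0 ln1.
  rewrite -[X in (_ --> X)%classic]E.
  apply: (@continuous_cvg _ _ _ _ _ (fun s : R => cos (0 + s * p)) (@ln R)).
    by apply: continuous_ln; rewrite cos0.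
  apply: (@continuous_cvg _ _ _ _ _ (fun s : R => 0 + s * p) (@cos R)).
    exact: continuous_cos.
  exact: cvg_line_at_right.
- exact: cvg_cst.
Unshelve. all: by end_near.
Qed.

(* The path [s |-> (pi - s * (q + r + 2 * p), s * q, s * r, s * p)] to the vertex. *)
Lemma log_ratio_vertex_cvg p q r : 0 < p -> 0 < q -> 0 < r ->
  let P s := pi + s * - (q + r + 2 * p) in
  [/\ (log_ratio (P s) (0 + s * q) (0 + s * r) (0 + s * p) @[s --> 0^'+]
        --> ln p + ln (q + r + p) - ln q - ln r)%classic,
      (log_ratio (0 + s * q) (0 + s * r) (P s) (0 + s * p) @[s --> 0^'+]
        --> ln p + ln (q + p) - ln r - ln (q + r + 2 * p))%classic &
      (log_ratio (0 + s * r) (P s) (0 + s * q) (0 + s * p) @[s --> 0^'+]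
        --> ln p + ln (r + p) - ln (q + r + 2 * p) - ln q)%classic].
Proof.
move=> p0 q0 r0 P.
have H (k l m n : R) : 0 < k -> 0 < l -> 0 < m -> 0 < n ->
  (ln (sin (s * k)) + ln (sin (s * l)) - ln (sin (s * m)) - ln (sin (s * n))
   @[s --> 0^'+] --> ln k + ln l - ln m - ln n)%classic.
  move=> k0 l0 m0 n0.
  have -> : (fun s => ln (sin (s * k)) + ln (sin (s * l)) - ln (sin (s * m)) - ln (sin (s * n)))
   = (fun s => (ln (sin (s * k)) - ln s) + (ln (sin (s * l)) - ln s)
        - (ln (sin (s * m)) - ln s) - (ln (sin (s * n)) - ln s)).
    by apply/funext => s; ring.
  by do 2 (apply: cvgB; last exact: cvg_ln_sin_scale); apply: cvgD; exact: cvg_ln_sin_scale.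
have PE s : sin (P s) = sin (s * (q + r + 2 * p)).
  by rewrite /P mulrN sin_piB.
have PhE s : sin (P s + s * p) = sin (s * (q + r + p)).
  by rewrite -sin_piB; congr sin; rewrite /P; ring.
rewrite /log_ratio; split.
- have -> : (fun s => ln (sin (0 + s * p)) + ln (sin (P s + (0 + s * p)))
      - ln (sin (0 + s * q)) - ln (sin (0 + s * r))) =
      (fun s => ln (sin (s * p)) + ln (sin (s * (q + r + p))) - ln (sin (s * q)) - ln (sin (s * r))).
    by apply/funext => s; rewrite !add0r PhE.
  by apply: H => //; lra.
- have -> : (fun s => ln (sin (0 + s * p)) + ln (sin (0 + s * q + (0 + s * p)))
      - ln (sin (0 + s * r)) - ln (sin (P s))) =
      (fun s => ln (sin (s * p)) + ln (sin (s * (q + p))) - ln (sin (s * r)) - ln (sin (s * (q + r + 2 * p)))).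
    by apply/funext => s; rewrite !add0r PE !mulrDr.
  by apply: H => //; lra.
- have -> : (fun s => ln (sin (0 + s * p)) + ln (sin (0 + s * r + (0 + s * p)))
      - ln (sin (P s)) - ln (sin (0 + s * q))) =
      (fun s => ln (sin (s * p)) + ln (sin (s * (r + p))) - ln (sin (s * (q + r + 2 * p))) - ln (sin (s * q))).
    by apply/funext => s; rewrite !add0r PE !mulrDr.
  by apply: H => //; lra.
Qed.

Lemma vertex_path_interior p q r : 0 < p -> 0 < q -> 0 < r -> q + r + 2 * p < pi ->
  angle_interior (pi - (q + r + 2 * p)) q r p.
Proof. by move=> p0 q0 r0 S0; split => //; [lra|ring]. Qed.

(** The weights [y] and [z] are the limits of their own log ratios in the chosen direction. They
    cancel in the limit of the slope bound and leave [x] against its limit, with the negative factor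
    [- (q + r + p)]. *)
Lemma vertex_maximizer_ge p q r x :
  0 < p -> 0 < q -> 0 < r -> q + r + 2 * p < pi ->
  maximizer x (ln p + ln (q + p) - ln r - ln (q + r + 2 * p))
    (ln p + ln (r + p) - ln (q + r + 2 * p) - ln q) pi 0 0 0 ->
  ln p + ln (q + r + p) - ln q - ln r <= x.
Proof.
move=> p0 q0 r0 S0 M.
have sl := maximizer_slope M (vertex_path_interior p0 q0 r0 S0).
have [c1 c2 c3] := log_ratio_vertex_cvg p0 q0 r0.
set y := (ln p + ln (q + p) - _ - _) in sl c2.
set z := (ln p + ln (r + p) - _ - _) in sl c3.
set x0 := ln p + _ - _ - _ in c1 *.
have T0 : 0 < q + r + p by lra.
have : - (q + r + p) * x + (q + p) * y + (r + p) * z <=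
    - (q + r + p) * x0 + (q + p) * y + (r + p) * z.
  apply: at_right_le; last first.
    move=> s s01; have := sl s s01; rewrite !subr0.
    have -> : pi - (q + r + 2 * p) + p - pi = - (q + r + p) by ring.
    have -> : pi - (q + r + 2 * p) - pi = - (q + r + 2 * p) by ring.
    by apply.
  by apply: cvgD; [apply: cvgD|]; (apply: cvgM; first exact: cvg_cst).
rewrite !lerD2r !mulNr lerN2 ler_pM2l//.
Qed.

Lemma cvg_Lobachevsky_line (u v : R) : 0 <= u <= pi ->
  (Lob (clamp (u + s * v)) @[s --> 0^'+] --> Lob u)%classic.
Proof.
move=> u0; rewrite -[X in (_ --> Lob X)%classic](clampE u0).
apply: (@continuous_cvg _ _ _ _ _ (fun s : R => u + s * v) (Lob \o @clamp R)).
  exact: Lobachevsky_clamp_continuous.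
exact: cvg_line_at_right.
Qed.

(** Letting [s -> 0] in [objective_le] at the points of the path makes the vertex a maximizer for
    the limiting weight [x0]. A larger [x] favours the vertex further, since [a + h] takes its
    largest value [pi] there. *)
Lemma vertex_maximizer p q r x :
  0 < p -> 0 < q -> 0 < r -> q + r + 2 * p < pi ->
  ln p + ln (q + r + p) - ln q - ln r <= x ->
  maximizer x (ln p + ln (q + p) - ln r - ln (q + r + 2 * p))
    (ln p + ln (r + p) - ln (q + r + 2 * p) - ln q) pi 0 0 0.
Proof.
move=> p0 q0 r0 S0; have I := vertex_path_interior p0 q0 r0 S0.
have [c1 c2 c3] := log_ratio_vertex_cvg p0 q0 r0.
set y := (ln p + ln (q + p) - _ - _) in c2 *.
set z := (ln p + ln (r + p) - _ - _) in c3 *.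
set x0 := ln p + _ - _ - _ in c1 * => x0x.
have pi0 := pi_gt0 R.
have SV : angle_simplex pi 0 0 (0 : R) by split; lra.
split => // a b c h S'.
suff H : objective x0 y z a b c h <= objective x0 y z pi 0 0 0.
  have [a0 b0 c0 h0 E] := S'.
  have : (a + h) * (x - x0) <= pi * (x - x0) by rewrite ler_wpM2r ?subr_ge0//; lra.
  move: H; rewrite /objective; move: (volume2 _ _ _ _) (volume2 _ _ _ _) => V1 V2; lra.
pose A s : R := pi + s * - (q + r + 2 * p).
pose X s := log_ratio (A s) (0 + s * q) (0 + s * r) (0 + s * p).
pose Y s := log_ratio (0 + s * q) (0 + s * r) (A s) (0 + s * p).
pose Z s := log_ratio (0 + s * r) (A s) (0 + s * q) (0 + s * p).
pose L (u v s : R) := Lob (clamp (u + s * v)).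
(* The objective on the path, with sums of angles merged and [Lob] clamped, so that its limit
   follows from continuity. *)
pose g s := L 0 p s + (L pi (- (q + r + 2 * p)) s + L 0 q s + L 0 r s)
  + (L pi (- (q + r + p)) s + L 0 (q + p) s + L 0 (r + p) s)
  + (pi + s * - (q + r + p)) * X s + (0 + s * (q + p)) * Y s + (0 + s * (r + p)) * Z s.
have cg : (g s @[s --> 0^'+] --> objective x0 y z pi 0 0 0)%classic.
  rewrite /objective /volume2 !addr0.
  have cL (u v : R) : 0 <= u <= pi -> (L u v s @[s --> 0^'+] --> Lob u)%classic.
    exact: cvg_Lobachevsky_line.
  have ii : 0 <= (0 : R) <= pi by rewrite lexx ltW.
  have jj : 0 <= (pi : R) <= pi by rewrite lexx ltW.
  apply: cvgD; last by apply: cvgM => //; exact: cvg_line_at_right.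
  apply: cvgD; last by apply: cvgM => //; exact: cvg_line_at_right.
  apply: cvgD; last by apply: cvgM => //; exact: cvg_line_at_right.
  apply: cvgD; last by apply: cvgD; [apply: cvgD|]; apply: cL.
  by apply: cvgD; [|apply: cvgD; [apply: cvgD|]]; apply: cL.
have cf : (objective (X s) (Y s) (Z s) a b c h @[s --> 0^'+] --> objective x0 y z a b c h)%classic.
  rewrite /objective; apply: cvgD; last by apply: cvgM => //; exact: cvg_cst.
  apply: cvgD; last by apply: cvgM => //; exact: cvg_cst.
  by apply: cvgD; [exact: cvg_cst|apply: cvgM => //; exact: cvg_cst].
rewrite -subr_ge0.
apply: (cvgr_to_ge (cvgB cg cf)); near=> s.
have s01 : 0 < s <= 1.
  by apply/andP; split; near: s; [exact: nbhs_right_gt|apply: nbhs_right_le].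
have := objective_le (angle_interior_line SV I s01) S'.
have -> : pi - (q + r + 2 * p) - pi = - (q + r + 2 * p) by ring.
rewrite !subr0 -/(A s) -/(X s) -/(Y s) -/(Z s) /= => H.
suff gE : g s = objective (X s) (Y s) (Z s) (A s) (0 + s * q) (0 + s * r) (0 + s * p).
  suff : 0 <= g s - objective (X s) (Y s) (Z s) a b c h by [].
  by rewrite gE subr_ge0.
have [s0 s1] := andP s01.
have AE : A s + (0 + s * p) = pi + s * - (q + r + p) by rewrite /A; ring.
have BE (u : R) : 0 + s * u + (0 + s * p) = 0 + s * (u + p) by ring.
rewrite /objective /volume2 AE !BE /g /L.
have K (u v : R) : 0 <= u -> 0 <= v -> 0 <= u + v <= pi -> 0 <= u + s * v <= pi.
  move=> u0 v0 /andP[uv1 uv2]; have : 0 <= s * v by rewrite mulr_ge0// ltW.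
  have : 0 <= (1 - s) * v by rewrite mulr_ge0// subr_ge0.
  by move=> *; apply/andP; split; lra.
have K' (v : R) : 0 <= v <= pi -> 0 <= pi + s * - v <= pi.
  move=> /andP[v0 vp]; have : 0 <= s * v by rewrite mulr_ge0// ltW.
  have : 0 <= (1 - s) * v by rewrite mulr_ge0// subr_ge0.
  by move=> *; apply/andP; split; lra.
rewrite !clampE//; try (by apply: K => //; try (apply/andP; split); lra);
  by apply: K'; apply/andP; split; lra.
Unshelve. all: by end_near.
Qed.

End Vertex.

(** * Hyperbolic triangles: sides from angles and angles from sides *)

Section HyperbolicTriangle.
Variable R : realType.
Implicit Types a b c h x y z : R.

(* The hyperbolic cosine of the side whose half has squared hyperbolic sine [expR x]. *)
Definition cosh_side x : R := 1 + 2 * expR x.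

(** The determinant of the symmetric matrix with unit diagonal and the three hyperbolic cosines off
    it. It is positive exactly when the sides satisfy the strict triangle inequalities. *)
Definition gram_disc x y z : R :=
  1 + 2 * (cosh_side x * cosh_side y * cosh_side z)
  - cosh_side x ^+ 2 - cosh_side y ^+ 2 - cosh_side z ^+ 2.

Lemma cosh_side_gt1 x : 1 < cosh_side x.
Proof. by rewrite /cosh_side ltrDl mulr_gt0// expR_gt0. Qed.

Lemma cosh_side_sqrB1_gt0 x : 0 < cosh_side x ^+ 2 - 1.
Proof. by rewrite subr_gt0 exprn_egt1// cosh_side_gt1. Qed.

Lemma gram_discE x y z : gram_disc x y z =
  (cosh_side y ^+ 2 - 1) * (cosh_side z ^+ 2 - 1)
  - (cosh_side y * cosh_side z - cosh_side x) ^+ 2.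
Proof. by rewrite /gram_disc; ring. Qed.

Lemma gram_disc_rot x y z : gram_disc x y z = gram_disc y z x.
Proof. by rewrite /gram_disc; ring. Qed.

(* With [u], [v] the hyperbolic tangents of the half sides, [S = u + v]. *)
Lemma vertex_path_exists y z : exists p q r : R,
  [/\ [/\ 0 < p, 0 < q, 0 < r & q + r + 2 * p < pi],
    y = ln p + ln (q + p) - ln r - ln (q + r + 2 * p),
    z = ln p + ln (r + p) - ln (q + r + 2 * p) - ln q &
    cosh_side (ln p + ln (q + r + p) - ln q - ln r) =
    cosh_side y * cosh_side z
    + Num.sqrt (cosh_side y ^+ 2 - 1) * Num.sqrt (cosh_side z ^+ 2 - 1)].
Proof.
have T w : exists t : R, [/\ 0 < t, t < 1 & expR w = t ^+ 2 / (1 - t ^+ 2)].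
  have w0 := expR_gt0 w; have w1 : 0 < 1 + expR w by lra.
  have q0 : 0 < expR w / (1 + expR w) by rewrite divr_gt0.
  exists (Num.sqrt (expR w / (1 + expR w))); rewrite sqr_sqrtr ?ltW// sqrtr_gt0; split => //.
    by rewrite -[ltRHS]sqrtr1 ltr_sqrt// ltr_pdivrMr//; lra.
  by field; rewrite gt_eqF//= -subr_eq0; apply/eqP => /eqP; lra.
have [u [u0 u1 uE]] := T y; have [v [v0 v1 vE]] := T z.
have uu : 0 < 1 - u ^+ 2 by rewrite subr_gt0 expr_lt1// ltW.
have vv : 0 < 1 - v ^+ 2 by rewrite subr_gt0 expr_lt1// ltW.
have uv : 0 < 1 + u * v by rewrite ltr_wpDr// mulr_ge0// ltW.
(* The right sides for [y] and [z] are homogeneous of degree 0 in [(p, q, r)], so the scale can be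
   fixed by [q + p = u]. Then [r + p = v], and [q + r + 2 p = u + v < 2] stays below pi. *)
pose p := u * v * (u + v) / (1 + u * v).
pose q := u * (1 - v ^+ 2) / (1 + u * v).
pose r := v * (1 - u ^+ 2) / (1 + u * v).
have uvn : 1 + u * v != 0 by rewrite gt_eqF.
have qp : q + p = u by rewrite /q /p; field.
have rp : r + p = v by rewrite /r /p; field.
have S : q + r + 2 * p = u + v by rewrite -qp -rp; ring.
(* The hyperbolic tangent of half the sum of the two sides, whence the addition formula in the last
   clause. *)
have T0 : q + r + p = (u + v) / (1 + u * v) by rewrite /q /r /p; field.
have uv0 : 0 < u + v by rewrite addr_gt0.
have p0 : 0 < p by rewrite /p divr_gt0// !mulr_gt0.
have q0 : 0 < q by rewrite /q divr_gt0// mulr_gt0.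
have r0 : 0 < r by rewrite /r divr_gt0// mulr_gt0.
have lnE (k l m n : R) : 0 < k -> 0 < l -> 0 < m -> 0 < n ->
    ln k + ln l - ln m - ln n = ln (k * l / (m * n)).
  by move=> k0 l0 m0 n0; rewrite ln_div ?posrE ?mulr_gt0// !lnM//; ring.
exists p, q, r; rewrite S qp rp T0.
have Sy w t : 0 < t -> t < 1 -> expR w = t ^+ 2 / (1 - t ^+ 2) ->
    cosh_side w = (1 + t ^+ 2) / (1 - t ^+ 2) /\
    Num.sqrt (cosh_side w ^+ 2 - 1) = 2 * t / (1 - t ^+ 2).
  move=> t0 t1 E; have tt : 0 < 1 - t ^+ 2 by rewrite subr_gt0 expr_lt1// ltW.
  have C : cosh_side w = (1 + t ^+ 2) / (1 - t ^+ 2).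
    by rewrite /cosh_side E; field; rewrite gt_eqF.
  split => //; rewrite C.
  have -> : ((1 + t ^+ 2) / (1 - t ^+ 2)) ^+ 2 - 1 = (2 * t / (1 - t ^+ 2)) ^+ 2.
    by field; rewrite gt_eqF.
  by rewrite sqrtr_sqr ger0_norm// ltW// divr_gt0// mulr_gt0.
have [Cy Sy'] := Sy _ _ u0 u1 uE; have [Cz Sz'] := Sy _ _ v0 v1 vE.
split.
- by split => //; have := pi_ge2 R; lra.
- rewrite lnE// -[LHS]expRK uE /p /r; congr ln; field.
  by rewrite !gt_eqF.
- rewrite lnE// -[LHS]expRK vE /p /q; congr ln; field.
  by rewrite !gt_eqF.
- have T1 : 0 < (u + v) / (1 + u * v) by rewrite divr_gt0.
  have T2 : 0 < p * ((u + v) / (1 + u * v)) / (q * r).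
    by apply: divr_gt0; exact: mulr_gt0.
  rewrite Sy' Sz' Cy Cz (lnE _ _ _ _ p0 T1 q0 r0) /cosh_side lnK ?posrE//.
  rewrite /p /q /r; field.
  by rewrite !gt_eqF.
Qed.

(** In the direction with limits [y] and [z], the lower bound for [x] says that the first side is at
    least the sum of the other two. *)
Lemma maximizer_vertex_disc x y z :
  maximizer x y z pi 0 0 0 -> gram_disc x y z <= 0.
Proof.
move=> M; have [p [q [r [[p0 q0 r0 S] yE zE E]]]] := vertex_path_exists y z.
rewrite yE zE in M; have := vertex_maximizer_ge p0 q0 r0 S M.
set x0 := ln p + _ - _ - _ in E * => x0x.
have : cosh_side x0 <= cosh_side x by rewrite lerD2l ler_pM2l// ler_expR.
rewrite E -lerBrDl => H; rewrite gram_discE subr_le0.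
rewrite -[leRHS]sqrrN opprB.
have P w : 0 <= cosh_side w ^+ 2 - 1 by rewrite ltW// cosh_side_sqrB1_gt0.
rewrite -(sqr_sqrtr (P y)) -(sqr_sqrtr (P z)) -exprMn.
have K : 0 <= Num.sqrt (cosh_side y ^+ 2 - 1) * Num.sqrt (cosh_side z ^+ 2 - 1).
  by rewrite mulr_ge0 ?sqrtr_ge0.
by apply: lerXn2r => //; rewrite nnegrE (le_trans K).
Qed.

(** By the addition formula and the monotonicity of the hyperbolic cosine, both proved with
    exponentials, the hypothesis says that [x] is at least the directional limit [x0]. *)
Lemma arcosh_triangle_maximizer x y z :
  arcosh (cosh_side y) + arcosh (cosh_side z) <= arcosh (cosh_side x) ->
  maximizer x y z pi 0 0 0.
Proof.
move=> H; have [p [q [r [[p0 q0 r0 S] yE zE E]]]] := vertex_path_exists y z.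
rewrite yE zE; apply: vertex_maximizer => //.
set x0 := ln p + _ - _ - _ in E *.
rewrite -ler_expR -(ler_pM2l (ltr0Sn R 1)) -(lerD2l 1) -/(cosh_side _) -/(cosh_side _) E.
have ch w := cosh_arcosh (ltW (cosh_side_gt1 w)).
have P w : 0 <= cosh_side w ^+ 2 - 1 by rewrite ltW// cosh_side_sqrB1_gt0.
have sh w : Num.sqrt (cosh_side w ^+ 2 - 1) =
    (expR (arcosh (cosh_side w)) - expR (- arcosh (cosh_side w))) / 2.
  have w0 : 0 < cosh_side w by rewrite (lt_trans _ (cosh_side_gt1 w)).
  have e1 : expR (arcosh (cosh_side w)) = cosh_side w + Num.sqrt (cosh_side w ^+ 2 - 1).
    by rewrite /arcosh lnK// posrE ltr_wpDr// sqrtr_ge0.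
  have := ch w; rewrite e1; move: (expR (- _)) => k; lra.
have ge0 w : 0 <= arcosh (cosh_side w) by apply: arcosh_ge0; rewrite ltW// cosh_side_gt1.
rewrite !sh -(ch x) -{1}(ch y) -{1}(ch z).
move: (arcosh (cosh_side x)) (arcosh (cosh_side y)) (arcosh (cosh_side z)) H (ge0 x) (ge0 y) (ge0 z).
move=> A B C ABC A0 B0 C0.
set k := expR B; set l := expR C.
have -> : (k + expR (- B)) / 2 * ((l + expR (- C)) / 2) +
   (k - expR (- B)) / 2 * ((l - expR (- C)) / 2) = (expR (B + C) + expR (- (B + C))) / 2.
  by rewrite opprD !expRD -/k -/l; field.
rewrite ler_pM2r ?invr_gt0//.
set u := expR (B + C); have u1 : 1 <= u by rewrite -expR0 ler_expR addr_ge0.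
rewrite !expRN -/u; set v := expR A; have uv : u <= v by rewrite ler_expR.
have u0 : 0 < u by lra.
have v0 : 0 < v by lra.
rewrite -subr_ge0.
have -> : v + v^-1 - (u + u^-1) = (v - u) * (u * v - 1) / (u * v).
  by field; rewrite !gt_eqF.
apply: divr_ge0; last by rewrite mulr_ge0// ltW.
have v1 : 1 <= v by rewrite (le_trans u1).
by rewrite mulr_ge0 ?subr_ge0// -[1]mulr1 ler_pM.
Qed.

Lemma sin_sin_mul a b : 2 * (sin a * sin b) = cos (a - b) - cos (a + b).
Proof. by rewrite cosB cosD; ring. Qed.

Lemma cos_cos_mul a b : 2 * (cos a * cos b) = cos (a - b) + cos (a + b).
Proof. by rewrite cosB cosD; ring. Qed.

Lemma cos_piB a : cos (pi - a) = - cos a.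
Proof. by rewrite cosB sinpi cospi mul0r addr0 mulN1r. Qed.

Lemma expR_log_ratio a b c h : angle_interior a b c h ->
  expR (log_ratio a b c h) = sin h * sin (a + h) / (sin b * sin c).
Proof.
move=> [a0 b0 c0 h0 S]; rewrite /log_ratio.
have s u : 0 < u -> u < pi -> 0 < sin u by move=> u0 u1; rewrite sin_gt0_pi// u0.
have sh : 0 < sin h by apply: s; lra.
have sah : 0 < sin (a + h) by apply: s; lra.
have sb : 0 < sin b by apply: s; lra.
have sc : 0 < sin c by apply: s; lra.
by rewrite !expRD !expRN !lnK ?posrE//; field; rewrite !gt_eqF.
Qed.

(** For [X = e^(log_ratio a b c h)] this gives [X + 1], so [(1 + 2 X)^2 - 1 = 4 X (X + 1)] is a
    quotient of products of sines, and the square roots in the law of cosines become explicit. *)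
Lemma angle_sin_mul a b c h : a + b + c + 2 * h = pi ->
  sin h * sin (a + h) + sin b * sin c = sin (b + h) * sin (c + h).
Proof.
move=> S; apply: (@mulfI _ 2); rewrite ?pnatr_eq0// mulrDr !sin_sin_mul.
have -> : h - (a + h) = - a by ring.
have -> : h + (a + h) = pi - (b + c) by rewrite -S; ring.
have -> : b + h - (c + h) = b - c by ring.
have -> : b + h + (c + h) = pi - a by rewrite -S; ring.
by rewrite cosN !cos_piB; ring.
Qed.

(** Up to the factor [- sin h / (sin a sin b sin c)] taken with the opposite sign, the left side is
    [Y + Z - X], which occurs in the numerators of both cosine formulas below. *)
Lemma angle_sin_cos_mul a b c h : a + b + c + 2 * h = pi ->
  sin (b + h) * sin b + sin (c + h) * sin c - sin (a + h) * sin a =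
  2 * (sin (b + h) * sin (c + h)) * cos (a + h).
Proof.
move=> S; apply: (@mulfI _ 2); rewrite ?pnatr_eq0// mulrBr mulrDr !sin_sin_mul.
have e u : u + h - u = h by ring.
have -> : b + h - (c + h) = b - c by ring.
have -> : b + h + (c + h) = pi - a by rewrite -S; ring.
rewrite !e cos_piB opprK mulrA mulrAC mulrDr.
have -> : 2 * cos (a + h) * cos (b - c) = - cos (b + h + b) - cos (c + h + c).
  rewrite -mulrA cos_cos_mul -!cos_piB; congr (cos _ + cos _); rewrite -S; ring.
by rewrite -[2 * _ * cos a]mulrA cos_cos_mul e; ring.
Qed.

Section Interior.
Variables (a b c h : R).
Hypothesis I : angle_interior a b c h.
Let X := expR (log_ratio a b c h).
Let Y := expR (log_ratio b c a h).
Let Z := expR (log_ratio c a b h).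

Lemma interior_sin_gt0 : [/\ 0 < sin a, 0 < sin b, 0 < sin c & 0 < sin h] /\
  [/\ 0 < sin (a + h), 0 < sin (b + h) & 0 < sin (c + h)].
Proof.
have [a0 b0 c0 h0 S] := I.
have s (u : R) : 0 < u -> u < pi -> 0 < sin u by move=> u0 u1; rewrite sin_gt0_pi// u0.
by split; split; apply: s; lra.
Qed.

Lemma interior_sides :
  [/\ X = sin h * sin (a + h) / (sin b * sin c),
      Y = sin h * sin (b + h) / (sin c * sin a),
      Z = sin h * sin (c + h) / (sin a * sin b) &
   [/\ X + 1 = sin (b + h) * sin (c + h) / (sin b * sin c),
      Y + 1 = sin (c + h) * sin (a + h) / (sin c * sin a) &
      Z + 1 = sin (a + h) * sin (b + h) / (sin a * sin b)]].
Proof.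
have I1 := angle_interior_rot I; have I2 := angle_interior_rot I1.
have XE := expR_log_ratio I; have YE := expR_log_ratio I1; have ZE := expR_log_ratio I2.
have [[sa sb sc sh] [sah sbh sch]] := interior_sin_gt0.
have [_ _ _ _ S] := I; have [_ _ _ _ S1] := I1; have [_ _ _ _ S2] := I2.
split => //; split; rewrite ?/X ?/Y ?/Z ?XE ?YE ?ZE -(angle_sin_mul S, angle_sin_mul S1, angle_sin_mul S2);
  by field; rewrite !gt_eqF.
Qed.

(** The hyperbolic law of cosines without denominators: the left side is [cosh y cosh z - cosh x]
    for the three sides, and by [interior_disc] the factor of [cos a] is the product of two
    hyperbolic sines. *)
Lemma interior_cos_rel :
  2 * (Y + Z - X) + 4 * (Y * Z) =
  cos a * (4 * (sin h * sin (a + h) * sin (b + h) * sin (c + h) / (sin a ^+ 2 * sin b * sin c))).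
Proof.
have [XE YE ZE _] := interior_sides; rewrite XE YE ZE.
have [[sa sb sc sh] [sah sbh sch]] := interior_sin_gt0.
have [_ _ _ _ S] := I.
have E := angle_sin_cos_mul S.
have E2 : sin h = sin (a + h) * cos a - cos (a + h) * sin a.
  by rewrite -sinB; congr sin; ring.
have -> : 2 * (sin h * sin (b + h) / (sin c * sin a) + sin h * sin (c + h) / (sin a * sin b)
     - sin h * sin (a + h) / (sin b * sin c))
   + 4 * (sin h * sin (b + h) / (sin c * sin a) * (sin h * sin (c + h) / (sin a * sin b)))
  = 2 * sin h * (sin a * (sin (b + h) * sin b + sin (c + h) * sin c - sin (a + h) * sin a)
     + 2 * sin h * (sin (b + h) * sin (c + h))) / (sin a ^+ 2 * sin b * sin c).
  by field; rewrite !gt_eqF.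
rewrite E [in 2 * sin h * (_ * _)]E2.
by field; rewrite !gt_eqF.
Qed.

Lemma interior_disc :
  (cosh_side (log_ratio b c a h) ^+ 2 - 1) * (cosh_side (log_ratio c a b h) ^+ 2 - 1) =
  (4 * (sin h * sin (a + h) * sin (b + h) * sin (c + h) / (sin a ^+ 2 * sin b * sin c))) ^+ 2.
Proof.
have [_ YE ZE [_ YE1 ZE1]] := interior_sides.
have [[sa sb sc sh] [sah sbh sch]] := interior_sin_gt0.
rewrite /cosh_side -/Y -/Z.
have -> : ((1 + 2 * Y) ^+ 2 - 1) * ((1 + 2 * Z) ^+ 2 - 1) =
   16 * (Y * (Y + 1)) * (Z * (Z + 1)) by ring.
rewrite YE1 ZE1 YE ZE.
by field; rewrite !gt_eqF.
Qed.

Lemma interior_cos :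
  cos a = (cosh_side (log_ratio b c a h) * cosh_side (log_ratio c a b h)
           - cosh_side (log_ratio a b c h)) /
          Num.sqrt ((cosh_side (log_ratio b c a h) ^+ 2 - 1)
                    * (cosh_side (log_ratio c a b h) ^+ 2 - 1)).
Proof.
have [[sa sb sc sh] [sah sbh sch]] := interior_sin_gt0.
rewrite interior_disc sqrtr_sqr.
set k := 4 * _; have k0 : 0 < k by rewrite /k !mulr_gt0 ?invr_gt0 ?mulr_gt0 ?exprn_gt0.
rewrite gtr0_norm//.
have -> : cosh_side (log_ratio b c a h) * cosh_side (log_ratio c a b h)
    - cosh_side (log_ratio a b c h) = 2 * (Y + Z - X) + 4 * (Y * Z).
  by rewrite /cosh_side -/X -/Y -/Z; ring.
by rewrite interior_cos_rel -/k mulfK// gt_eqF.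
Qed.

Lemma interior_gram_disc_gt0 :
  0 < gram_disc (log_ratio a b c h) (log_ratio b c a h) (log_ratio c a b h).
Proof.
have [[sa sb sc sh] [sah sbh sch]] := interior_sin_gt0.
rewrite gram_discE interior_disc.
set k := 4 * _; have k0 : 0 < k by rewrite /k !mulr_gt0 ?invr_gt0 ?mulr_gt0 ?exprn_gt0.
have -> : cosh_side (log_ratio b c a h) * cosh_side (log_ratio c a b h)
    - cosh_side (log_ratio a b c h) = cos a * k.
  by rewrite -interior_cos_rel /cosh_side -/X -/Y -/Z; ring.
have -> : k ^+ 2 - (cos a * k) ^+ 2 = (1 - cos a ^+ 2) * k ^+ 2 by ring.
by rewrite -sin2cos2 mulr_gt0// exprn_gt0.
Qed.

(** The right side is the form in which the normals of the two faces at the edge opposite to [e_1i]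
    will give the cosine. The product under the root is the square of [8 X k]. *)
Lemma interior_cos_opp :
  cos (a + h) = 4 * X * (Y + Z - X) / Num.sqrt (16 * (X * Y * Z) * (4 * X * (X + 1))).
Proof.
have [XE YE ZE [XE1 _ _]] := interior_sides.
have [[sa sb sc sh] [sah sbh sch]] := interior_sin_gt0.
have [_ _ _ _ S] := I.
have E := angle_sin_cos_mul S.
pose k := sin h * sin (b + h) * sin (c + h) / (sin a * sin b * sin c).
have X0 : 0 < X := expR_gt0 _.
have k0 : 0 < k by rewrite divr_gt0// !mulr_gt0.
have -> : 16 * (X * Y * Z) * (4 * X * (X + 1)) = (8 * X * k) ^+ 2.
  by rewrite XE1 YE ZE /k; field; rewrite !gt_eqF.
rewrite sqrtr_sqr gtr0_norm; last by rewrite mulr_gt0// mulr_gt0.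
have -> : Y + Z - X = 2 * k * cos (a + h).
  rewrite XE YE ZE /k.
  have -> : 2 * (sin h * sin (b + h) * sin (c + h) / (sin a * sin b * sin c)) * cos (a + h)
   = sin h * (2 * (sin (b + h) * sin (c + h)) * cos (a + h)) / (sin a * sin b * sin c).
    by field; rewrite !gt_eqF.
  by rewrite -E; field; rewrite !gt_eqF.
have Xn : X != 0 by rewrite gt_eqF.
have kn : k != 0 by rewrite gt_eqF.
clearbody k X; field; by rewrite kn Xn.
Qed.
End Interior.

(* The dual law of cosines recovers the sides from the angles. *)
Lemma triangle_log_ratio x y z a b c :
  0 < gram_disc x y z -> 0 <= a <= pi -> 0 <= b <= pi -> 0 <= c <= pi ->
  cos a = (cosh_side y * cosh_side z - cosh_side x) /
          Num.sqrt ((cosh_side y ^+ 2 - 1) * (cosh_side z ^+ 2 - 1)) ->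
  cos b = (cosh_side z * cosh_side x - cosh_side y) /
          Num.sqrt ((cosh_side z ^+ 2 - 1) * (cosh_side x ^+ 2 - 1)) ->
  cos c = (cosh_side x * cosh_side y - cosh_side z) /
          Num.sqrt ((cosh_side x ^+ 2 - 1) * (cosh_side y ^+ 2 - 1)) ->
  a + b + c <= pi ->
  angle_interior a b c ((pi - a - b - c) / 2) /\
  x = log_ratio a b c ((pi - a - b - c) / 2).
Proof.
move=> D0 ai bi ci ca cb cc S.
have P w := cosh_side_sqrB1_gt0 w.
pose sh w := Num.sqrt (cosh_side w ^+ 2 - 1).
have sh0 w : 0 < sh w by rewrite sqrtr_gt0.
have shE w : sh w ^+ 2 = cosh_side w ^+ 2 - 1 by rewrite sqr_sqrtr// ltW.
rewrite !sqrtrM ?ltW// -!/(sh _) in ca cb cc.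
pose D := gram_disc x y z.
have sinE u v w t : 0 <= t <= pi -> gram_disc u v w = D ->
    cos t = (cosh_side v * cosh_side w - cosh_side u) / (sh v * sh w) ->
    sin t = Num.sqrt D / (sh v * sh w) /\ 0 < t < pi.
  move=> ti DE ct.
  have sE : sin t = Num.sqrt D / (sh v * sh w).
    have -> : Num.sqrt D / (sh v * sh w) = Num.sqrt ((sin t) ^+ 2).
      rewrite sin2cos2 ct -DE gram_discE -!shE.
      have -> : 1 - ((cosh_side v * cosh_side w - cosh_side u) / (sh v * sh w)) ^+ 2 =
         (sh v ^+ 2 * sh w ^+ 2 - (cosh_side v * cosh_side w - cosh_side u) ^+ 2)
          / (sh v * sh w) ^+ 2.
        by field; rewrite !gt_eqF.
      rewrite [in RHS]sqrtrM ?[in RHS]sqrtrV ?sqr_ge0// ?sqrtr_sqr ?gtr0_norm ?mulr_gt0//.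
      by rewrite !shE -gram_discE DE ltW.
    by rewrite sqrtr_sqr ger0_norm// sin_ge0_pi.
  split => //; have s0 : 0 < sin t by rewrite sE divr_gt0 ?sqrtr_gt0 ?mulr_gt0.
  have /andP[t0 tp] := ti; rewrite !lt_neqAle t0 tp !andbT; apply/andP; split.
    by apply/eqP => E; move: s0; rewrite -E sin0 ltxx.
  by apply/eqP => E; move: s0; rewrite E sinpi ltxx.
have [sa ai'] := sinE x y z a ai erefl ca.
have [sb bi'] := sinE y z x b bi (esym (gram_disc_rot _ _ _)) cb.
have [sc ci'] := sinE z x y c ci (gram_disc_rot _ _ _) cc.
have D1 : Num.sqrt D ^+ 2 = D by rewrite sqr_sqrtr// ltW.
have dual : cosh_side x * (sin b * sin c) = cos a + cos b * cos c.
  rewrite sb sc ca cb cc.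
  have D0' : D != 0 by rewrite gt_eqF.
  have -> : cosh_side x * (Num.sqrt D / (sh z * sh x) * (Num.sqrt D / (sh x * sh y))) =
    cosh_side x * Num.sqrt D ^+ 2 / (sh x ^+ 2 * sh y * sh z).
    by field; rewrite !gt_eqF.
  have -> : (cosh_side y * cosh_side z - cosh_side x) / (sh y * sh z)
    + (cosh_side z * cosh_side x - cosh_side y) / (sh z * sh x)
     * ((cosh_side x * cosh_side y - cosh_side z) / (sh x * sh y)) =
    ((cosh_side y * cosh_side z - cosh_side x) * sh x ^+ 2 +
     (cosh_side z * cosh_side x - cosh_side y) * (cosh_side x * cosh_side y - cosh_side z))
     / (sh x ^+ 2 * sh y * sh z).
    by field; rewrite !gt_eqF.
  by congr (_ / _); rewrite D1 shE /D /gram_disc; ring.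
set h := (pi - a - b - c) / 2.
have hE : a + b + c + 2 * h = pi by rewrite /h; field.
have sb0 : 0 < sin b by rewrite sin_gt0_pi.
have sc0 : 0 < sin c by rewrite sin_gt0_pi.
(* [2 sin h sin (a + h) = cos a + cos (b + c)], which the dual law of cosines turns into
   [2 e^x sin b sin c]. *)
have prod : sin h * sin (a + h) = expR x * (sin b * sin c).
  apply: (@mulfI _ 2); rewrite ?pnatr_eq0// sin_sin_mul.
  have -> : h - (a + h) = - a by ring.
  have -> : h + (a + h) = pi - (b + c) by rewrite -hE; ring.
  rewrite cosN cos_piB cosD opprK.
  have -> : cos a = cosh_side x * (sin b * sin c) - cos b * cos c by rewrite dual addrK.
  by rewrite /cosh_side; ring.
(* The angle sum gives [0 <= h], and [h = 0] would annihilate the positive product in [prod]. *)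
have h0 : 0 < h.
  rewrite lt_neqAle; apply/andP; split; last by rewrite /h divr_ge0//; lra.
  apply/eqP => E; move/eqP: prod; rewrite -E sin0 mul0r eq_sym mulf_eq0 gt_eqF ?expR_gt0//=.
  by rewrite gt_eqF// mulr_gt0.
have I : angle_interior a b c h.
  by case/andP: ai' => ? _; case/andP: bi' => ? _; case/andP: ci' => ? _; split.
split => //; apply: expR_inj; rewrite expR_log_ratio// prod.
by rewrite mulfK// gt_eqF// mulr_gt0.
Qed.
End HyperbolicTriangle.

Local Notation o1 := (lift ord0 ord0 : 'I_4).
Local Notation o2 := (lift ord0 (lift ord0 ord0) : 'I_4).
Local Notation o3 := (lift ord0 (lift ord0 (lift ord0 ord0)) : 'I_4).

(** * Lorentz products and the edge lengths they determine *)

Section Lorentz.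
Variable R : realType.
Implicit Types x y z n p t : 'rV[R]_4.

Lemma lorentzC x y : lorentz x y = lorentz y x.
Proof. by rewrite /lorentz mulrC; congr (_ - _); apply: eq_bigr => i _; rewrite mulrC. Qed.

Lemma lorentzDl x y z : lorentz (x + y) z = lorentz x z + lorentz y z.
Proof.
rewrite /lorentz mxE mulrDl opprD addrACA -big_split/=; congr (_ + _).
by apply: eq_bigr => i _; rewrite mxE mulrDl.
Qed.

Lemma lorentzZl (a : R) x y : lorentz (a *: x) y = a * lorentz x y.
Proof.
rewrite /lorentz mxE mulrBr mulr_sumr mulrA; congr (_ - _).
by apply: eq_bigr => i _; rewrite mxE mulrA.
Qed.

Lemma lorentzDr x y z : lorentz x (y + z) = lorentz x y + lorentz x z.
Proof. by rewrite lorentzC lorentzDl !(lorentzC x). Qed.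

Lemma lorentzZr (a : R) x y : lorentz x (a *: y) = a * lorentz x y.
Proof. by rewrite lorentzC lorentzZl lorentzC. Qed.

Lemma lorentz0l x : lorentz 0 x = 0.
Proof. by rewrite -(scale0r 0) lorentzZl mul0r. Qed.

Definition lorentzE := (lorentzDl, lorentzDr, lorentzZl, lorentzZr).

Lemma lorentz_coord x y : lorentz x y =
  x 0 o1 * y 0 o1 + x 0 o2 * y 0 o2 + x 0 o3 * y 0 o3 - x 0 0 * y 0 0.
Proof. by rewrite /lorentz !big_ord_recl big_ord0 addr0 addrA. Qed.

Lemma row4_eq0 x : x 0 0 = 0 -> x 0 o1 = 0 -> x 0 o2 = 0 -> x 0 o3 = 0 -> x = 0.
Proof.
move=> h0 h1 h2 h3; apply/rowP => i; rewrite mxE.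
case: i => -[|[|[|[|//]]]] im; [move: h0|move: h1|move: h2|move: h3] => <-;
  congr (x _ _); exact: val_inj.
Qed.

(** Cauchy-Schwarz for the space parts: [n_0 t_0] is their scalar product, so its square is at most
    [|n|^2 |t|^2], while [|t|^2 < t_0^2]. *)
Lemma timelike_orthogonal_gt0 t n : lorentz t t < 0 -> lorentz n t = 0 -> n != 0 ->
  0 < lorentz n n.
Proof.
move=> tt nt n0.
have K : (n 0 0 * t 0 0) ^+ 2 <= (n 0 o1 ^+ 2 + n 0 o2 ^+ 2 + n 0 o3 ^+ 2) *
    (t 0 o1 ^+ 2 + t 0 o2 ^+ 2 + t 0 o3 ^+ 2).
  have -> : n 0 0 * t 0 0 = n 0 o1 * t 0 o1 + n 0 o2 * t 0 o2 + n 0 o3 * t 0 o3.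
    by apply/eqP; rewrite eq_sym -subr_eq0 -lorentz_coord nt.
  rewrite -subr_ge0.
  set u := (X in 0 <= X).
  have -> : u = (n 0 o1 * t 0 o2 - n 0 o2 * t 0 o1) ^+ 2
   + (n 0 o1 * t 0 o3 - n 0 o3 * t 0 o1) ^+ 2 + (n 0 o2 * t 0 o3 - n 0 o3 * t 0 o2) ^+ 2.
    by rewrite /u; ring.
  by rewrite !addr_ge0// sqr_ge0.
pose N := n 0 o1 ^+ 2 + n 0 o2 ^+ 2 + n 0 o3 ^+ 2.
pose T := t 0 o1 ^+ 2 + t 0 o2 ^+ 2 + t 0 o3 ^+ 2.
have N0 : 0 <= N by rewrite !addr_ge0// sqr_ge0.
have T0 : 0 <= T by rewrite !addr_ge0// sqr_ge0.
have tE : lorentz t t = T - t 0 0 ^+ 2 by rewrite lorentz_coord /T !expr2.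
have nE : lorentz n n = N - n 0 0 ^+ 2 by rewrite lorentz_coord /N !expr2.
rewrite nE subr_gt0; rewrite tE subr_lt0 in tt.
have t0 : 0 < t 0 0 ^+ 2 by rewrite (le_lt_trans T0).
have Npos : 0 < N.
  rewrite lt_neqAle N0 andbT; apply/eqP => E; move/eqP: n0; apply.
  have := E; rewrite /N => /esym/eqP; rewrite !paddr_eq0 ?addr_ge0 ?sqr_ge0// !sqrf_eq0.
  move=> /andP[/andP[/eqP n1 /eqP n2] /eqP n3]; apply: row4_eq0 => //.
  move: K; rewrite -/N -E mul0r => K.
  have : (n 0 0 * t 0 0) ^+ 2 == 0 by rewrite eq_le K sqr_ge0.
  by rewrite sqrf_eq0 mulf_eq0 -(sqrf_eq0 (t 0 0)) (gt_eqF t0) orbF => /eqP.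
rewrite -(ltr_pM2r t0) -exprMn (le_lt_trans K)//.
by rewrite ltr_pM2l.
Qed.

Lemma timelike_orthogonal_ge0 t n : lorentz t t < 0 -> lorentz n t = 0 -> 0 <= lorentz n n.
Proof.
move=> tt nt; have [->|n0] := eqVneq n 0; first by rewrite lorentz0l.
by rewrite ltW// (timelike_orthogonal_gt0 tt).
Qed.

(** Changing the sign of coordinate 0 turns the four Lorentz products into one product with the
    invertible matrix of the [v k]. *)
Lemma row_free_orthogonal (v : 'I_4 -> 'rV[R]_4) x :
  row_free (\matrix_i v i) -> (forall k, lorentz x (v k) = 0) -> x = 0.
Proof.
move=> V xv.
pose y : 'cV[R]_4 := \col_j (if j == 0 then - x 0 0 else x 0 j).
have Vy : (\matrix_i v i) *m y = 0.
  apply/colP => k; rewrite !mxE big_ord_recl !mxE/=.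
  transitivity (lorentz x (v k)); last exact: xv.
  rewrite /lorentz addrC mulrN mulrC; congr (_ - _).
  by apply: eq_bigr => j _; rewrite !mxE/= mulrC.
have y0 : y = 0.
  have Vu : (\matrix_i v i) \in unitmx by rewrite -row_free_unit.
  by rewrite -(mulKmx Vu y) Vy mulmx0.
have yE j : y j 0 = 0 by rewrite y0 mxE.
apply/rowP => j; rewrite mxE; have := yE j; rewrite mxE.
by case: eqP => [-> /eqP|_//]; rewrite oppr_eq0 => /eqP.
Qed.

Lemma arcosh_cosh (l : R) : arcosh ((expR l + expR (- l)) / 2) = `|l|.
Proof.
wlog l0 : l / 0 <= l.
  move=> H; have [/H//|l0] := leP 0 l.
  by rewrite -normrN -H ?oppr_ge0 ?ltW// opprK addrC.
rewrite ger0_norm// /arcosh.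
have -> : ((expR l + expR (- l)) / 2) ^+ 2 - 1 = ((expR l - expR (- l)) / 2) ^+ 2.
  have E : expR l * expR (- l) = 1 by rewrite -expRD subrr expR0.
  by rewrite -[X in _ - X = _]E; field.
rewrite sqrtr_sqr ger0_norm; last first.
  by rewrite divr_ge0// subr_ge0 ler_expR; lra.
by rewrite -[RHS]expRK; congr ln; field.
Qed.

(** An edge length is defined by its absolute value, a hyperbolic distance, together with a
    geometric criterion [P] for its sign. *)
Lemma eq_signed_norm (l m : R) (P : Prop) : `|l| = `|m| -> (0 < l <-> P) -> (0 < m <-> P) -> l = m.
Proof.
move=> lm lP mP; move/eqP: lm; rewrite eqr_norm2 => /orP[/eqP//|/eqP lE].
have [l0|l0] := ltP 0 l.
  by have := (mP.2 (lP.1 l0)) => m0; rewrite lE in l0; lra.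
have [m0|m0] := ltP 0 m; last by lra.
by have := (lP.2 (mP.1 m0)) => l1; lra.
Qed.

Section IdealEdge.
Variables (v : 'I_4 -> 'rV[R]_4) (c : 'I_4 -> R) (i j : 'I_4).
Hypotheses (ni : lorentz (v i) (v i) = 0) (nj : lorentz (v j) (v j) = 0).
Hypotheses (ci : 0 < c i) (cj : 0 < c j).
Hypothesis w0 : lorentz (v i) (v j) < 0.
Hypothesis perp : exists p, [/\ lorentz p (v i) = 0, lorentz p (v j) = 0 & 0 < lorentz p p].
Let w := lorentz (v i) (v j).
(** The number [e^(-l)] for the length [l] of the edge. *)
Let m := 2 * Num.sqrt (c i * c j) / - w.

Let wn : w != 0. Proof. by rewrite /w lt_eqF. Qed.

Let m0 : 0 < m.
Proof. by rewrite /m divr_gt0 ?mulr_gt0 ?sqrtr_gt0 ?mulr_gt0// oppr_gt0. Qed.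

Let mE : m ^+ 2 = (2 * c i / - w) * (2 * c j / - w).
Proof.
rewrite /m expr_div_n exprMn sqr_sqrtr ?mulr_ge0// ?ltW//.
by field.
Qed.

Let segE (a b : R) : [/\ lorentz (a *: v i + b *: v j) (v i) = b * w,
  lorentz (a *: v i + b *: v j) (v j) = a * w &
  lorentz (a *: v i + b *: v j) (a *: v i + b *: v j) = 2 * (a * b) * w].
Proof. by rewrite !lorentzE ni nj (lorentzC (v j) (v i)) -/w; split; ring. Qed.

Let horo_i (a b : R) : 0 < a -> 0 < b -> horosphere (v i) (c i) (a *: v i + b *: v j) ->
  b = a * (2 * c i / - w).
Proof.
move=> a0 b0 [_]; have [-> _ ->] := segE a b => E.
apply: (@mulfI _ (b * w ^+ 2)); first by rewrite mulf_neq0 ?expf_neq0// gt_eqF.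
transitivity ((b * w) ^+ 2); first by ring.
by rewrite E; field.
Qed.

Let horo_j (a b : R) : 0 < a -> 0 < b -> horosphere (v j) (c j) (a *: v i + b *: v j) ->
  a = b * (2 * c j / - w).
Proof.
move=> a0 b0 [_]; have [_ -> ->] := segE a b => E.
apply: (@mulfI _ (a * w ^+ 2)); first by rewrite mulf_neq0 ?expf_neq0// gt_eqF.
transitivity ((a * w) ^+ 2); first by ring.
by rewrite E; field.
Qed.

Let hdistE (a b a' b' : R) : 0 < a -> 0 < b -> 0 < a' -> 0 < b' ->
  b = a * (2 * c i / - w) -> a' = b' * (2 * c j / - w) ->
  hdist (a *: v i + b *: v j) (a' *: v i + b' *: v j) = `|- ln m|.
Proof.
move=> a0 b0 a'0 b'0 bE aE.
rewrite /hdist; have [_ _ ->] := segE a b; have [_ _ ->] := segE a' b'.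
rewrite !lorentzE ni nj (lorentzC (v j) (v i)) -/w.
have -> : a * (a' * 0 + b' * w) + b * (a' * w + b' * 0) = - (a * b' * (1 + m ^+ 2) * - w).
  by rewrite mE bE aE; ring.
have -> : 2 * (a * b) * w * (2 * (a' * b') * w) = (2 * (a * b' * m) * - w) ^+ 2.
  have -> : (2 * (a * b' * m) * - w) ^+ 2 = 4 * a ^+ 2 * b' ^+ 2 * m ^+ 2 * w ^+ 2 by ring.
  by rewrite mE bE aE; ring.
have nw : 0 < - w by rewrite oppr_gt0.
rewrite -(arcosh_cosh (- ln m)) opprK lnK ?posrE// expRN lnK ?posrE//; congr arcosh.
have m2 : 0 < 1 + m ^+ 2 by rewrite addr_gt0// exprn_gt0.
have K1 : 0 < a * b' * (1 + m ^+ 2) * - w by do !apply: mulr_gt0 => //.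
have K2 : 0 < 2 * (a * b' * m) * - w by do !apply: mulr_gt0 => //.
rewrite sqrtr_sqr normrN !gtr0_norm//.
by field; rewrite wn !gt_eqF.
Qed.

(** Removing from a common point [z] its part in the span of [v i] and [v j] leaves a vector
    orthogonal to the timelike [v i + v j]; its non-negative square yields [N <= m N] for
    [N = - (z, z) > 0]. For [m >= 1] a common point is built with the spacelike vector of [perp]. *)
Let commonE : 0 < - ln m <->
  ~ exists z, horosphere (v i) (c i) z /\ horosphere (v j) (c j) z.
Proof.
have nw : 0 < - w by rewrite oppr_gt0.
have -> : (0 < - ln m) = (m < 1) by rewrite oppr_gt0 -ln1 ltr_ln ?posrE.
split => [m1 [z [[hz Hi] [_ Hj]]]|H].
  pose zi := lorentz z (v i); pose zj := lorentz z (v j).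
  pose p := z + (- (zj / w)) *: v i + (- (zi / w)) *: v j.
  have pv : lorentz p (v i + v j) = 0.
    rewrite /p !lorentzE ni nj (lorentzC (v j) (v i)) -/w -/zi -/zj.
    by field.
  have tt : lorentz (v i + v j) (v i + v j) < 0.
    by rewrite !lorentzE ni nj (lorentzC (v j) (v i)) -/w; lra.
  have := timelike_orthogonal_ge0 tt pv.
  have -> : lorentz p p = lorentz z z - 2 * (zi * zj) / w.
    rewrite /p !lorentzE ni nj (lorentzC (v j) (v i)) !(lorentzC _ z) -/w -/zi -/zj.
    by field.
  rewrite -/zi -/zj in Hi Hj.
  set N := - lorentz z z in Hi Hj.
  have N0 : 0 < N by rewrite oppr_gt0.
  have -> : lorentz z z = - N by rewrite opprK.
  have zz : `|zi * zj| = Num.sqrt (c i * c j) * N.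
    rewrite -sqrtr_sqr exprMn Hi Hj.
    have -> : c i * N * (c j * N) = c i * c j * N ^+ 2 by ring.
    by rewrite sqrtrM ?mulr_ge0 ?ltW// sqrtr_sqr gtr0_norm.
  have : 2 * (zi * zj) / - w <= m * N.
    have -> : m * N = 2 * (Num.sqrt (c i * c j) * N) / - w by rewrite /m; field.
    by rewrite ler_pM2r ?invr_gt0// ler_pM2l// -zz ler_norm.
  have : m * N < 1 * N by rewrite ltr_pM2r.
  by rewrite mul1r invrN mulrN; lra.
rewrite ltNge; apply/negP => m1; apply: H.
have [p [pi_ pj p0]] := perp.
(* These coefficients give the products [- sqrt (c i)] and [- sqrt (c j)] with [v i] and [v j]. The
   part in their span then has square [- m], which [k] raises to [-1]. *)
pose a := Num.sqrt (c j) / - w; pose b := Num.sqrt (c i) / - w.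
pose k := Num.sqrt ((m - 1) / lorentz p p).
exists (a *: v i + b *: v j + k *: p).
have zz : lorentz (a *: v i + b *: v j + k *: p) (a *: v i + b *: v j + k *: p) = - 1.
  have [E1 E2 E3] := segE a b.
  rewrite lorentzDl 2!(lorentzDr _ _ (k *: p)) E3 !lorentzZl !lorentzZr.
  rewrite !lorentzE (lorentzC (v i) p) (lorentzC (v j) p) pi_ pj.
  have -> : k * (k * lorentz p p) = m - 1.
    rewrite mulrA -expr2 sqr_sqrtr ?divfK ?gt_eqF//.
    by apply: divr_ge0; [rewrite subr_ge0|exact: ltW].
  have -> : 2 * (a * b) * w = - m.
    rewrite /m /a /b sqrtrM; last exact: ltW.
    by field.
  by ring.
split; split; rewrite /in_H3 ?zz ?ltrN10//.
  have -> : lorentz (a *: v i + b *: v j + k *: p) (v i) = - Num.sqrt (c i).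
    by rewrite !lorentzE ni (lorentzC (v j) (v i)) pi_ -/w /b; field.
  by rewrite sqrrN sqr_sqrtr ?ltW// opprK mulr1.
have -> : lorentz (a *: v i + b *: v j + k *: p) (v j) = - Num.sqrt (c j).
  by rewrite !lorentzE nj pj -/w /a; field.
by rewrite sqrrN sqr_sqrtr ?ltW// opprK mulr1.
Qed.

(** Penner's relation between Lorentz products and distances of horospheres. Each horosphere meets
    the edge in a single point, given by an explicit ratio of coefficients, and [hdist] ignores the
    scale that is left. *)
Lemma ideal_edge_lengthP (l : R) : ideal_edge_length v c i j l <->
  lorentz (v i) (v j) = - 2 * Num.sqrt (c i * c j) * expR l.
Proof.
have nw : 0 < - w by rewrite oppr_gt0.
have lE : (l = - ln m) <-> w = - 2 * Num.sqrt (c i * c j) * expR l.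
  have q0 : 0 < Num.sqrt (c i * c j) by rewrite sqrtr_gt0 mulr_gt0.
  split => [->|wE].
    by rewrite expRN lnK ?posrE// /m; field; rewrite wn gt_eqF.
  rewrite /m wE -[l in LHS]expRK -lnV ?posrE; last first.
    by rewrite divr_gt0 ?mulr_gt0// mulNr mulNr opprK !mulr_gt0// expR_gt0.
  by congr ln; field; rewrite !gt_eqF// expR_gt0.
rewrite -/w -lE; split => [[x [y]]|lm].
  case=> -[[[a [b [a0 b0 ->]]] _] hx] [[[a' [b' [a'0 b'0 ->]]] _] hy] nl ls.
  apply: (eq_signed_norm _ ls commonE).
  by rewrite nl; apply: hdistE => //; [exact: horo_i|exact: horo_j].
pose k1 := 2 * c i / - w; pose k2 := 2 * c j / - w.
have k10 : 0 < k1 by rewrite divr_gt0 ?mulr_gt0.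
have k20 : 0 < k2 by rewrite divr_gt0 ?mulr_gt0.
have H3 (a b : R) : 0 < a -> 0 < b -> in_H3 (a *: v i + b *: v j).
  move=> a0 b0; rewrite /in_H3; have [_ _ ->] := segE a b.
  by rewrite pmulr_rlt0// !mulr_gt0.
have [x1 _ x3] := segE 1 k1; have [_ y2 y3] := segE k2 1.
exists (1 *: v i + k1 *: v j), (k2 *: v i + 1 *: v j); split.
- split; first by split; [exists 1, k1; split|exact: H3].
  by split; [exact: H3|rewrite x1 x3 /k1; field].
- split; first by split; [exists k2, 1; split|exact: H3].
  by split; [exact: H3|rewrite y2 y3 /k2; field].
- by rewrite hdistE// ?lm ?mul1r.
- by rewrite lm; exact: commonE.
Qed.
End IdealEdge.

Section HyperidealEdge.
Variables (v : 'I_4 -> 'rV[R]_4) (c : 'I_4 -> R) (i : 'I_4).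
Hypotheses (n0 : 0 < lorentz (v ord0) (v ord0)) (ni : lorentz (v i) (v i) = 0).
Hypotheses (ci : 0 < c i) (u0 : lorentz (v ord0) (v i) < 0).
Let n := lorentz (v ord0) (v ord0).
Let u := lorentz (v ord0) (v i).
(** The number [e^l] for the length [l] of the edge. *)
Let m := - u / Num.sqrt (n * c i).

Let q0 : 0 < Num.sqrt (n * c i).
Proof. by rewrite sqrtr_gt0 mulr_gt0. Qed.

Let nu : 0 < - u.
Proof. by rewrite oppr_gt0. Qed.

Let m0 : 0 < m.
Proof. by rewrite divr_gt0. Qed.

Let nn : n != 0. Proof. by rewrite gt_eqF. Qed.
Let un : u != 0. Proof. by rewrite lt_eqF. Qed.

Let segE (a b : R) : [/\ lorentz (a *: v ord0 + b *: v i) (v ord0) = a * n + b * u,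
  lorentz (a *: v ord0 + b *: v i) (v i) = a * u &
  lorentz (a *: v ord0 + b *: v i) (a *: v ord0 + b *: v i) = a * (a * n + 2 * b * u)].
Proof. by rewrite !lorentzE ni (lorentzC (v i)) -/u -/n; split; ring. Qed.

Let planeE (b : R) : 0 < b ->
  let x := (b * (- u / n)) *: v ord0 + b *: v i in
  [/\ lorentz x x = - (b * u) ^+ 2 / n, lorentz x (v ord0) = 0 &
      lorentz x (v i) = - b * u ^+ 2 / n].
Proof.
move=> b0 x; rewrite /x; have [-> -> ->] := segE (b * (- u / n)) b.
by split; field.
Qed.

Let horoE (a b : R) : 0 < a -> 0 < b -> horosphere (v i) (c i) (a *: v ord0 + b *: v i) ->
  a * (u ^+ 2 + c i * n) = 2 * c i * b * - u.
Proof.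
move=> a0 b0 [_]; have [_ -> ->] := segE a b => E.
apply: (@mulfI _ a); first by rewrite gt_eqF.
have -> : a * (a * (u ^+ 2 + c i * n)) = (a * u) ^+ 2 + c i * a ^+ 2 * n by ring.
by rewrite E; ring.
Qed.

Let hdistE (b a' b' : R) : 0 < b -> 0 < a' -> 0 < b' ->
  horosphere (v i) (c i) (a' *: v ord0 + b' *: v i) ->
  hdist ((b * (- u / n)) *: v ord0 + b *: v i) (a' *: v ord0 + b' *: v i) = `|ln m|.
Proof.
move=> b0 a'0 b'0 hy; have aE := horoE a'0 b'0 hy.
have [_ hy2] := hy.
have cn : c i != 0 by rewrite gt_eqF.
have yy : lorentz (a' *: v ord0 + b' *: v i) (a' *: v ord0 + b' *: v i) = - (a' * u) ^+ 2 / c i.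
  have [_ yi _] := segE a' b'; rewrite yi in hy2; rewrite hy2; by field.
rewrite /hdist yy.
have [-> x0 xi] := planeE b0.
rewrite lorentzDr !lorentzZr x0 xi mulr0 add0r.
have -> : - (b * u) ^+ 2 / n * (- (a' * u) ^+ 2 / c i) = ((b * u * (a' * u)) / Num.sqrt (n * c i)) ^+ 2.
  by rewrite expr_div_n sqr_sqrtr ?mulr_ge0 ?ltW//; field; rewrite nn cn.
rewrite sqrtr_sqr.
have -> : b' * (- b * u ^+ 2 / n) = - (b * b' * (- u * - u) / n) by field.
have -> : b * u * (a' * u) = b * a' * (- u * - u) by ring.
rewrite -(arcosh_cosh (ln m)) expRN lnK ?posrE//; congr arcosh.
rewrite normrN !gtr0_norm ?divr_gt0 ?mulr_gt0//.
have qq : Num.sqrt (n * c i) ^+ 2 = n * c i by rewrite sqr_sqrtr ?mulr_ge0 ?ltW.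
have qn : Num.sqrt (n * c i) != 0 by rewrite gt_eqF.
have a'n : a' != 0 by rewrite gt_eqF.
have b'E : b' = a' * (u ^+ 2 + c i * n) / (2 * c i * - u).
  by rewrite aE; field; rewrite un cn.
rewrite b'E /m.
have -> : (- u / Num.sqrt (n * c i) + (- u / Num.sqrt (n * c i))^-1) / 2
  = (u ^+ 2 + Num.sqrt (n * c i) ^+ 2) / (2 * Num.sqrt (n * c i) * - u).
  by field; rewrite un qn.
have -> : b * (a' * (u ^+ 2 + c i * n) / (2 * c i * - u)) * (- u * - u) / n /
  (b * a' * (- u * - u) / Num.sqrt (n * c i)) =
  (u ^+ 2 + c i * n) * Num.sqrt (n * c i) ^+ 2 / (2 * (n * c i) * - u * Num.sqrt (n * c i)).
  by field; rewrite un cn nn qn a'n gt_eqF.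
by rewrite qq; field; rewrite un cn nn qn.
Qed.

Let outsideE (b : R) : 0 < b ->
  0 < ln m <-> ~ horoball (v i) (c i) ((b * (- u / n)) *: v ord0 + b *: v i).
Proof.
move=> b0; have [xx x0 xi] := planeE b0.
have H3 : in_H3 ((b * (- u / n)) *: v ord0 + b *: v i).
  by rewrite /in_H3 xx mulNr oppr_lt0 divr_gt0// exprn_even_gt0//= mulf_neq0// gt_eqF.
rewrite /horoball xx xi.
have -> : (0 < ln m) = (1 < m) by rewrite -ln1 ltr_ln ?posrE.
have -> : ((- b * u ^+ 2 / n) ^+ 2 <= c i * - (- (b * u) ^+ 2 / n)) = (m <= 1).
  have -> : (- b * u ^+ 2 / n) ^+ 2 = (b * u) ^+ 2 / n ^+ 2 * (- u) ^+ 2 by field.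
  have -> : c i * - (- (b * u) ^+ 2 / n) = (b * u) ^+ 2 / n ^+ 2 * (n * c i) by field.
  rewrite ler_pM2l; last first.
    by apply: divr_gt0; [rewrite exprn_even_gt0//= mulf_neq0// gt_eqF|exact: exprn_gt0].
  have nc : 0 <= n * c i by rewrite mulr_ge0// ltW.
  rewrite ler_pdivrMr// mul1r -{1}(sqr_sqrtr nc).
  by rewrite ler_sqr// nnegrE ltW.
rewrite ltNge; split => [/negP H [_ H']|H]; first exact: H.
by apply/negP => H'; apply: H.
Qed.

(** On the edge both the point of the dual plane and the point of the horosphere are unique up to
    scale; their distance is [|ln m|], and the former is outside the horoball exactly when
    [m > 1]. *)
Lemma hyperideal_edge_lengthP (l : R) : hyperideal_edge_length v c i l <->
  lorentz (v ord0) (v i) = - Num.sqrt (lorentz (v ord0) (v ord0) * c i) * expR l.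
Proof.
rewrite -/n -/u.
have lE : (l = ln m) <-> u = - Num.sqrt (n * c i) * expR l.
  split => [->|uE].
    by rewrite lnK ?posrE// /m; field; rewrite gt_eqF.
  rewrite -[l in LHS]expRK; congr ln.
  by rewrite /m uE; field; rewrite gt_eqF.
rewrite -lE; split => [[x [y]]|lm].
  case=> -[[[a [b [a0 b0 ->]]] _] hx] [[[a' [b' [a'0 b'0 ->]]] _] hy] nl ls.
  have aE : a = b * (- u / n).
    have [hx' _ _] := segE a b; rewrite lorentzC hx' in hx.
    apply: (@mulIf _ n) => //; move/eqP: hx; rewrite addr_eq0 => /eqP ->.
    by field.
  rewrite aE in nl ls.
  by apply: (eq_signed_norm _ ls (outsideE b0)); rewrite nl hdistE.
pose x := (1 * (- u / n)) *: v ord0 + 1 *: v i.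
pose a' := 2 * c i * - u; pose b' := u ^+ 2 + c i * n.
have a'0 : 0 < a' by rewrite !mulr_gt0.
have b'0 : 0 < b' by rewrite ltr_wpDl ?sqr_ge0// mulr_gt0.
have [_ y2 y3] := segE a' b'.
have hyE : lorentz (a' *: v ord0 + b' *: v i) (v i) ^+ 2 =
    c i * - lorentz (a' *: v ord0 + b' *: v i) (a' *: v ord0 + b' *: v i).
  by rewrite y2 y3 /a' /b'; ring.
have H3y : in_H3 (a' *: v ord0 + b' *: v i).
  rewrite /in_H3 -oppr_gt0 -(pmulr_rgt0 _ ci) -hyE y2 exprn_even_gt0//=.
  by rewrite mulf_neq0// gt_eqF.
have hy : horosphere (v i) (c i) (a' *: v ord0 + b' *: v i) by split.
have [xx x0 xi] := planeE ltr01.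
exists x, (a' *: v ord0 + b' *: v i); split.
- split; last by rewrite lorentzC.
  split; first by exists (1 * (- u / n)), 1; split; [rewrite mul1r divr_gt0|exact: ltr01|].
  by rewrite /in_H3 xx mulNr oppr_lt0 divr_gt0// exprn_even_gt0//= mulf_neq0// oner_neq0.
- by split => //; split => //; exists a', b'; split.
- by rewrite lm hdistE.
- by rewrite lm; exact: outsideE.
Qed.
End HyperidealEdge.
End Lorentz.

Section Edges4.

Lemma ord4_ind (P : 'I_4 -> Prop) :
  P ord0 -> P o1 -> P o2 -> P o3 -> forall i, P i.
Proof.
move=> P0 P1 P2 P3 [[|[|[|[|//]]]] im];
  [move: P0|move: P1|move: P2|move: P3]; congr (P _); exact: val_inj.
Qed.

Lemma teC (i j : 'I_4) : te i j = te j i.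
Proof. by rewrite /te finset.setUC. Qed.

Lemma te_eq (e : tet_edge) (i j : 'I_4) : i != j -> val e = [set i; j] -> e = te i j.
Proof. by move=> ij E; apply: val_inj; rewrite E val_te. Qed.

Lemma ord4_cover (i j k x : 'I_4) : uniq [:: ord0; i; j; k] -> x \in [:: ord0; i; j; k].
Proof.
by elim/ord4_ind: i; elim/ord4_ind: j => //; elim/ord4_ind: k => //;
  elim/ord4_ind: x.
Qed.

Lemma te_compl (i j k : 'I_4) : uniq [:: ord0; i; j; k] ->
  val (te ord0 i) = ~: [set j; k] /\ val (te j k) = ~: [set ord0; i].
Proof.
move=> u; have := u; rewrite /= !inE !negb_or => /and4P[/and3P[i0 j0 k0] /andP[ij ik] jk _].
rewrite !val_te//; split; apply/setP => x; have := ord4_cover x u; rewrite !inE.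
  by case/or4P => /eqP->; rewrite ?eqxx ?orbT ?(negPf ij) ?(negPf ik) ?(negPf j0) ?(negPf k0)
    ?(eq_sym k) ?(eq_sym j) ?(negPf jk) ?(eq_sym _ ord0) ?(negPf i0) ?(negPf j0) ?(negPf k0)
    ?(negPf ij) ?(negPf ik).
by case/or4P => /eqP->; rewrite ?eqxx ?orbT ?(negPf i0) ?(negPf j0) ?(negPf k0) ?(negPf ij) ?(negPf ik)
    ?(eq_sym _ ord0) ?(eq_sym _ i) ?(negPf i0) ?(negPf j0) ?(negPf k0) ?(negPf ij) ?(negPf ik).
Qed.

Lemma setU2_eq (T : finType) (i j k l : T) : i != j -> [set i; j] = [set k; l] ->
  (i = k /\ j = l) \/ (i = l /\ j = k).
Proof.
move=> ij E; have := set21 i j; have := set22 i j; rewrite E !inE.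
by move=> /orP[]/eqP jE /orP[]/eqP iE; subst; rewrite ?eqxx in ij; auto.
Qed.
End Edges4.

(** * Face normals of a tetrahedron with normalized Gram matrix *)

Section Configuration.
Variable R : realType.
Implicit Types u n : 'rV[R]_4.

(** The Gram matrix that remains after rescaling the vertices. Each [u_i + u0] is orthogonal to [u0]
    and has square [-1]: these are the vertices of the truncation triangle, whose sides have
    hyperbolic cosines [1 + 2 X], [1 + 2 Y], [1 + 2 Z], opposite to the vertices 1, 2, 3. *)
Definition gram_config (X Y Z : R) u0 u1 u2 u3 : Prop :=
  [/\ lorentz u0 u0 = 1,
      [/\ lorentz u0 u1 = -1, lorentz u0 u2 = -1 & lorentz u0 u3 = -1],
      [/\ lorentz u1 u1 = 0, lorentz u2 u2 = 0 & lorentz u3 u3 = 0] &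
      [/\ lorentz u1 u2 = - 2 * Z, lorentz u1 u3 = - 2 * Y & lorentz u2 u3 = - 2 * X]].

(** Minus the determinant of the Gram matrix of [gram_config]; for positive [X, Y, Z] it is
    [gram_disc] at their logarithms. *)
Definition config_disc (X Y Z : R) : R :=
  1 + 2 * ((1 + 2 * X) * (1 + 2 * Y) * (1 + 2 * Z))
  - (1 + 2 * X) ^+ 2 - (1 + 2 * Y) ^+ 2 - (1 + 2 * Z) ^+ 2.

(* The rows of the adjugate of the Gram matrix. *)
Definition normal1 (X Y Z : R) u0 u1 u2 u3 :=
  (4 * X * (Y + Z - X)) *: u0 + (1 - (1 + 2 * X) ^+ 2) *: u1
  + ((1 + 2 * X) * (1 + 2 * Y) - (1 + 2 * Z)) *: u2
  + ((1 + 2 * X) * (1 + 2 * Z) - (1 + 2 * Y)) *: u3.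

Definition normal0 (X Y Z : R) u0 u1 u2 u3 :=
  (- (16 * (X * Y * Z))) *: u0 + (4 * X * (Y + Z - X)) *: u1
  + (4 * Y * (Z + X - Y)) *: u2 + (4 * Z * (X + Y - Z)) *: u3.

Lemma gram_config_rot (X Y Z : R) u0 u1 u2 u3 :
  gram_config X Y Z u0 u1 u2 u3 -> gram_config Y Z X u0 u2 u3 u1.
Proof.
move=> [h0 [h1 h2 h3] [k1 k2 k3] [l3 l2 l1]].
by split => //; split => //; rewrite lorentzC.
Qed.

Lemma config_disc_rot (X Y Z : R) : config_disc X Y Z = config_disc Y Z X.
Proof. by rewrite /config_disc; ring. Qed.

Lemma normal1P (X Y Z : R) u0 u1 u2 u3 : gram_config X Y Z u0 u1 u2 u3 ->
  let N := normal1 X Y Z u0 u1 u2 u3 in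
  [/\ lorentz N u0 = 0, lorentz N u1 = - config_disc X Y Z, lorentz N u2 = 0 &
      lorentz N u3 = 0].
Proof.
move=> [h0 [h1 h2 h3] [k1 k2 k3] [l3 l2 l1]] N; rewrite /N /normal1 /config_disc.
rewrite !lorentzE (lorentzC u1 u0) (lorentzC u2 u0) (lorentzC u3 u0) (lorentzC u2 u1)
  (lorentzC u3 u1) (lorentzC u3 u2) h0 h1 h2 h3 k1 k2 k3 l1 l2 l3.
by split; ring.
Qed.

Lemma normal0P (X Y Z : R) u0 u1 u2 u3 : gram_config X Y Z u0 u1 u2 u3 ->
  let N := normal0 X Y Z u0 u1 u2 u3 in
  [/\ lorentz N u0 = - config_disc X Y Z, lorentz N u1 = 0, lorentz N u2 = 0 &
      lorentz N u3 = 0].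
Proof.
move=> [h0 [h1 h2 h3] [k1 k2 k3] [l3 l2 l1]] N; rewrite /N /normal0 /config_disc.
rewrite !lorentzE (lorentzC u1 u0) (lorentzC u2 u0) (lorentzC u3 u0) (lorentzC u2 u1)
  (lorentzC u3 u1) (lorentzC u3 u2) h0 h1 h2 h3 k1 k2 k3 l1 l2 l3.
by split; ring.
Qed.

(** A normal is orthogonal to three of the vectors and has product [- D] with the fourth. Hence the
    product of two normals is [- D] times a single coefficient of the second one. *)
Lemma normal_products (X Y Z : R) u0 u1 u2 u3 : gram_config X Y Z u0 u1 u2 u3 ->
  let D := config_disc X Y Z in
  let N0 := normal0 X Y Z u0 u1 u2 u3 in
  let N1 := normal1 X Y Z u0 u1 u2 u3 in
  let N2 := normal1 Y Z X u0 u2 u3 u1 in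
  let N3 := normal1 Z X Y u0 u3 u1 u2 in
  [/\ lorentz N0 N0 = D * (16 * (X * Y * Z)),
      lorentz N1 N1 = D * ((1 + 2 * X) ^+ 2 - 1),
      lorentz N0 N1 = - D * (4 * X * (Y + Z - X)) &
      lorentz N2 N3 = - D * ((1 + 2 * Y) * (1 + 2 * Z) - (1 + 2 * X))].
Proof.
move=> G D N0 N1 N2 N3.
have [a0 a1 a2 a3] := normal1P G.
have [b0 b1 b2 b3] := normal0P G.
have G2 := gram_config_rot G; have [c0 c1 c2 c3] := normal1P G2.
rewrite -config_disc_rot in c1.
rewrite -/D -/N0 -/N1 -/N2 in a0 a1 a2 a3 b0 b1 b2 b3 c0 c1 c2 c3 *.
split.
- by rewrite {2}/N0 /normal0 !(lorentzDr, lorentzZr) b0 b1 b2 b3; ring.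
- by rewrite {2}/N1 /normal1 !(lorentzDr, lorentzZr) a0 a1 a2 a3; ring.
- by rewrite /N1 /normal1 !(lorentzDr, lorentzZr) b0 b1 b2 b3; ring.
- by rewrite /N3 /normal1 !(lorentzDr, lorentzZr) c0 c1 c2 c3; ring.
Qed.

(** A triangle with the prescribed sides is placed in the hyperbolic plane dual to the unit vector
    [u0], and [u0] is subtracted from its vertices to make them lightlike. The entry [q] is forced
    by the product of the last two vectors, [sqrt D / s] by the square of the last one. *)
Lemma gram_config_exists (X Y Z : R) : 0 < X -> 0 < Y -> 0 < Z ->
  0 < config_disc X Y Z -> exists u0 u1 u2 u3, gram_config X Y Z u0 u1 u2 u3.
Proof.
move=> X0 Y0 Z0 D0.
pose D := config_disc X Y Z; pose s := Num.sqrt ((1 + 2 * Z) ^+ 2 - 1).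
have s2 : 0 < (1 + 2 * Z) ^+ 2 - 1.
  have -> : (1 + 2 * Z) ^+ 2 - 1 = 4 * Z * (Z + 1) by ring.
  by rewrite mulr_gt0 ?addr_gt0// mulr_gt0.
have s0 : s != 0 by rewrite gt_eqF// sqrtr_gt0.
have sE : s ^+ 2 = (1 + 2 * Z) ^+ 2 - 1 by rewrite sqr_sqrtr// ltW.
have dE : Num.sqrt D ^+ 2 = D by rewrite sqr_sqrtr// ltW.
pose row (a b c d : R) : 'rV[R]_4 := \row_j nth 0 [:: a; b; c; d] j.
have rowE a b c d a' b' c' d' : lorentz (row a b c d) (row a' b' c' d') =
    b * b' + c * c' + d * d' - a * a'.
  by rewrite lorentz_coord !mxE.
pose q := ((1 + 2 * Y) * (1 + 2 * Z) - (1 + 2 * X)) / s.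
exists (row 0 0 0 1), (row 1 0 0 (-1)), (row (1 + 2 * Z) s 0 (-1)),
  (row (1 + 2 * Y) q (Num.sqrt D / s) (-1)).
split; rewrite !rowE; [by ring|by split; ring|split|split]; try by ring.
- by rewrite -expr2 sE; ring.
- rewrite /q -!expr2 !expr_div_n dE.
  transitivity ((((1 + 2 * Y) * (1 + 2 * Z) - (1 + 2 * X)) ^+ 2 + D) / s ^+ 2
     + (-1) ^+ 2 - (1 + 2 * Y) ^+ 2); first by field.
  have -> : ((1 + 2 * Y) * (1 + 2 * Z) - (1 + 2 * X)) ^+ 2 + D =
     ((1 + 2 * Y) ^+ 2 - 1) * s ^+ 2 by rewrite sE /D /config_disc; ring.
  by rewrite mulfK ?expf_neq0//; ring.
- have -> : s * q = (1 + 2 * Y) * (1 + 2 * Z) - (1 + 2 * X) by rewrite /q mulrC divfK.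
  by ring.
Qed.

Lemma outward_normal_unique (v : 'I_4 -> 'rV[R]_4) i n N :
  row_free (\matrix_i v i) -> outward_normal v i n -> outward_normal v i N ->
  exists2 k, 0 < k & n = k *: N.
Proof.
move=> V [n0 ni] [N0 Ni].
exists (lorentz n (v i) / lorentz N (v i)).
  by rewrite nmulr_rgt0// invr_lt0.
apply/eqP; rewrite -subr_eq0; apply/eqP; apply: (row_free_orthogonal V) => j.
rewrite -scaleNr lorentzDl lorentzZl; have [->|ji] := eqVneq j i.
  by field; rewrite lt_eqF.
by rewrite (n0 j)// (N0 j)// mulr0 addr0.
Qed.

(** The normals form a dual basis of the [v i] up to negative factors. *)
Lemma outward_normal_row_free (v : 'I_4 -> 'rV[R]_4) :
  (forall i, exists N, outward_normal v i N) -> row_free (\matrix_i v i).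
Proof.
move=> H; apply: inj_row_free => x xV.
have xE : \sum_k x 0 k *: v k = 0.
  transitivity (x *m (\matrix_i v i)); last exact: xV.
  rewrite mulmx_sum_row; apply: eq_bigr => k _; congr (_ *: _).
  by apply/rowP => j; rewrite !mxE.
apply/rowP => i; rewrite mxE; have [N [N0 Ni]] := H i.
have S (f : 'I_4 -> R) : lorentz N (\sum_k f k *: v k) = \sum_k f k * lorentz N (v k).
  elim/big_rec2: _ => [|k y z _ <-]; first by rewrite lorentzC lorentz0l.
  by rewrite lorentzDr lorentzZr.
have : lorentz N (\sum_k x 0 k *: v k) = x 0 i * lorentz N (v i).
  rewrite S (bigD1 i)//= big1 ?addr0// => k ki; by rewrite N0// mulr0.
rewrite xE lorentzC lorentz0l => /esym/eqP; rewrite mulf_eq0 => /orP[/eqP//|].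
by rewrite lt_eqF.
Qed.

Lemma normal_cosine_scale (k l : R) n m : 0 < k -> 0 < l ->
  lorentz (k *: n) (l *: m) /
    (Num.sqrt (lorentz (k *: n) (k *: n)) * Num.sqrt (lorentz (l *: m) (l *: m)))
  = lorentz n m / (Num.sqrt (lorentz n n) * Num.sqrt (lorentz m m)).
Proof.
move=> k0 l0; rewrite !lorentzE !mulrA -!expr2.
rewrite (sqrtrM _ (sqr_ge0 k)) (sqrtrM _ (sqr_ge0 l)) !sqrtr_sqr !gtr0_norm//.
have [->|n0] := eqVneq (Num.sqrt (lorentz n n)) 0; first by rewrite !(mulr0, mul0r) invr0 !mulr0.
have [->|m0] := eqVneq (Num.sqrt (lorentz m m)) 0; first by rewrite !(mulr0, mul0r) invr0 !mulr0.
by field; rewrite n0 m0 !gt_eqF.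
Qed.
End Configuration.

(** * Dihedral angles in terms of the normalized Gram matrix *)

Section ScaledConfiguration.
Variable R : realType.
Variables (v : 'I_4 -> 'rV[R]_4) (s : 'I_4 -> R).
Hypothesis s_gt0 : forall t, 0 < s t.
Let u t := (s t)^-1 *: v t.

Let uE n t : lorentz n (v t) = s t * lorentz n (u t).
Proof. by rewrite /u lorentzZr mulVKf// gt_eqF. Qed.

Definition scaled_config (X Y Z : R) (i j k : 'I_4) : Prop :=
  [/\ uniq [:: ord0; i; j; k], [/\ 0 < X, 0 < Y & 0 < Z] &
   gram_config X Y Z (u ord0) (u i) (u j) (u k)].

Lemma scaled_config_rot X Y Z i j k :
  scaled_config X Y Z i j k -> scaled_config Y Z X j k i.
Proof.
move=> [U [X0 Y0 Z0] G]; split => //; last exact: gram_config_rot.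
have -> : uniq [:: ord0; j; k; i] = uniq [:: ord0; i; j; k]; last by [].
by apply: perm_uniq; rewrite perm_cons perm_sym -[[:: i; j; k]]/([:: i] ++ [:: j; k]) perm_catC.
Qed.

Lemma scaled_outward1 X Y Z i j k : scaled_config X Y Z i j k ->
  0 < config_disc X Y Z ->
  outward_normal v i (normal1 X Y Z (u ord0) (u i) (u j) (u k)).
Proof.
move=> [U _ G] D0; have [n0 ni nj nk] := normal1P G.
split => [t ti|]; rewrite uE.
  have := ord4_cover t U; rewrite !inE => /or4P[] /eqP tE; rewrite tE ?n0 ?nj ?nk ?mulr0//.
  by rewrite tE eqxx in ti.
by rewrite ni mulrN oppr_lt0 mulr_gt0.
Qed.

Lemma scaled_outward0 X Y Z i j k : scaled_config X Y Z i j k ->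
  0 < config_disc X Y Z ->
  outward_normal v ord0 (normal0 X Y Z (u ord0) (u i) (u j) (u k)).
Proof.
move=> [U _ G] D0; have [n0 ni nj nk] := normal0P G.
split => [t ti|]; rewrite uE.
  have := ord4_cover t U; rewrite !inE => /or4P[] /eqP tE; rewrite tE ?ni ?nj ?nk ?mulr0//.
  by rewrite tE eqxx in ti.
by rewrite n0 mulrN oppr_lt0 mulr_gt0.
Qed.

Lemma scaled_row_free X Y Z i j k : scaled_config X Y Z i j k ->
  0 < config_disc X Y Z -> row_free (\matrix_t v t).
Proof.
move=> C D0; apply: outward_normal_row_free => t.
have C1 := scaled_config_rot C; have C2 := scaled_config_rot C1.
have D1 := D0; rewrite config_disc_rot in D1.
have D2 := D1; rewrite config_disc_rot in D2.
have [U _ _] := C; have := ord4_cover t U; rewrite !inE => /or4P[] /eqP->.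
- by eexists; exact: scaled_outward0 C D0.
- by eexists; exact: scaled_outward1 C D0.
- by eexists; exact: scaled_outward1 C1 D1.
- by eexists; exact: scaled_outward1 C2 D2.
Qed.

(* The normal to the face opposite to [v i] is orthogonal to the timelike
   vector [v j + v k], hence spacelike. *)
Lemma scaled_disc_gt0 X Y Z i j k : scaled_config X Y Z i j k ->
  row_free (\matrix_t v t) -> 0 < config_disc X Y Z.
Proof.
move=> C V; have [U [X0 Y0 Z0] G] := C.
have [n0 ni nj nk] := normal1P G; have [_ nn _ _] := normal_products G.
set N := normal1 _ _ _ _ _ _ _ in n0 ni nj nk nn.
have K0 : 0 < (1 + 2 * X) ^+ 2 - 1.
  have -> : (1 + 2 * X) ^+ 2 - 1 = 4 * X * (X + 1) by ring.
  by rewrite mulr_gt0 ?addr_gt0// mulr_gt0.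
have N0 : N != 0.
  apply/eqP => NE.
  (* [N = 0] would be a linear relation between the vertices, although its coefficient
     [1 - (1 + 2 X)^2] at [u i] is not zero. *)
  pose f t : R := if t == ord0 then 4 * X * (Y + Z - X) else
    if t == i then 1 - (1 + 2 * X) ^+ 2 else
    if t == j then (1 + 2 * X) * (1 + 2 * Y) - (1 + 2 * Z) else
    (1 + 2 * X) * (1 + 2 * Z) - (1 + 2 * Y).
  pose x : 'rV[R]_4 := \row_t (f t * (s t)^-1).
  have xV : x *m (\matrix_t v t) = 0.
    rewrite -[RHS]NE; apply/rowP => l; rewrite !mxE.
    have U0 := U; move: U0; rewrite /= !inE !negb_or => /and4P[/and3P[i0 j0 k0] /andP[ij ik] jk _].
    rewrite (bigD1 ord0)//= (bigD1 i)/=; last by rewrite eq_sym.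
    rewrite (bigD1 j)/=; last by rewrite eq_sym j0 eq_sym.
    rewrite (bigD1 k)/=; last by rewrite eq_sym k0 eq_sym ik eq_sym.
    rewrite big1 ?addr0; last first.
      move=> t /andP[/andP[/andP[t0 ti] tj] tk].
      have := ord4_cover t U.
      by rewrite !inE (negPf t0) (negPf ti) (negPf tj) (negPf tk).
    rewrite !mxE /f eqxx (eq_sym i) (negPf i0) eqxx (eq_sym j ord0) (negPf j0).
    rewrite (eq_sym j i) (negPf ij) eqxx (eq_sym k ord0) (negPf k0) (eq_sym k i) (negPf ik).
    by rewrite (eq_sym k j) (negPf jk) !addrA !mulrA.
  have x0 : x = 0.
    have Vu : (\matrix_t v t) \in unitmx by rewrite -row_free_unit.
    by rewrite -(mulmxK Vu x) xV mul0mx.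
  have : x 0 i == 0 by rewrite x0 mxE.
  rewrite mxE /f eqxx; have -> : i == ord0 = false.
    by move: U; rewrite /= !inE !negb_or => /and4P[/and3P[i0 _ _] _ _ _]; rewrite eq_sym (negPf i0).
  rewrite mulf_eq0 invr_eq0 (gt_eqF (s_gt0 i)) orbF -oppr_eq0 opprB => /eqP E.
  by rewrite E ltxx in K0.
have [h0 [h1 h2 h3] [k1 k2 k3] [l3 l2 l1]] := G.
have tt : lorentz (u j + u k) (u j + u k) < 0.
  by rewrite !(lorentzDl, lorentzDr) k2 k3 (lorentzC (u k)) l1; lra.
have nt : lorentz N (u j + u k) = 0 by rewrite lorentzDr nj nk addr0.
have := timelike_orthogonal_gt0 tt nt N0.
by rewrite nn pmulr_lgt0.
Qed.

(** The law of cosines in the truncation triangle, whose angle on [e_1i] is the dihedral angle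
    because its plane is orthogonal to that edge. *)
Definition top_cosine (X Y Z : R) : R :=
  ((1 + 2 * Y) * (1 + 2 * Z) - (1 + 2 * X)) /
  Num.sqrt (((1 + 2 * Y) ^+ 2 - 1) * ((1 + 2 * Z) ^+ 2 - 1)).

(** Minus the normalized product of the normals of the faces opposite to [ord0] and [i], which meet
    in the edge opposite to [e_1i]. *)
Definition opp_cosine (X Y Z : R) : R :=
  4 * X * (Y + Z - X) / Num.sqrt (16 * (X * Y * Z) * (4 * X * (X + 1))).

Let K_gt0 (X : R) : 0 < X -> 0 < (1 + 2 * X) ^+ 2 - 1.
Proof.
move=> X0; have -> : (1 + 2 * X) ^+ 2 - 1 = 4 * X * (X + 1) by ring.
by rewrite mulr_gt0 ?addr_gt0// mulr_gt0.
Qed.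

Lemma scaled_top_ratio X Y Z i j k : scaled_config X Y Z i j k ->
  0 < config_disc X Y Z ->
  let N2 := normal1 Y Z X (u ord0) (u j) (u k) (u i) in
  let N3 := normal1 Z X Y (u ord0) (u k) (u i) (u j) in
  lorentz N2 N3 / (Num.sqrt (lorentz N2 N2) * Num.sqrt (lorentz N3 N3)) = - top_cosine X Y Z.
Proof.
move=> [U [X0 Y0 Z0] G] D0 N2 N3.
have [_ _ _ E23] := normal_products G.
have G2 := gram_config_rot G; have [_ E22 _ _] := normal_products G2.
have G3 := gram_config_rot G2; have [_ E33 _ _] := normal_products G3.
rewrite -/N2 -/N3 in E23 E22 E33; rewrite -config_disc_rot in E22.
rewrite (config_disc_rot Z X Y) in E33.
have D0' := D0; rewrite E23 E22 E33 /top_cosine.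
have y0 := K_gt0 Y0; have z0 := K_gt0 Z0.
rewrite (sqrtrM _ (ltW D0)) (sqrtrM _ (ltW D0)) (sqrtrM _ (ltW y0)).
have DD : config_disc X Y Z = Num.sqrt (config_disc X Y Z) ^+ 2 by rewrite sqr_sqrtr// ltW.
rewrite {1}DD.
by field; rewrite !gt_eqF// sqrtr_gt0.
Qed.

Lemma scaled_opp_ratio X Y Z i j k : scaled_config X Y Z i j k ->
  0 < config_disc X Y Z ->
  let N0 := normal0 X Y Z (u ord0) (u i) (u j) (u k) in
  let N1 := normal1 X Y Z (u ord0) (u i) (u j) (u k) in
  lorentz N0 N1 / (Num.sqrt (lorentz N0 N0) * Num.sqrt (lorentz N1 N1)) = - opp_cosine X Y Z.
Proof.
move=> [U [X0 Y0 Z0] G] D0 N0 N1.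
have [E00 E11 E01 _] := normal_products G.
rewrite -/N0 -/N1 in E00 E11 E01; rewrite E00 E11 E01 /opp_cosine.
have -> : 4 * X * (X + 1) = (1 + 2 * X) ^+ 2 - 1 by ring.
have x0 := K_gt0 X0; have w0 : 0 < 16 * (X * Y * Z) by rewrite !mulr_gt0.
rewrite (sqrtrM _ (ltW D0)) (sqrtrM _ (ltW D0)) (sqrtrM _ (ltW w0)).
have DD : config_disc X Y Z = Num.sqrt (config_disc X Y Z) ^+ 2 by rewrite sqr_sqrtr// ltW.
rewrite {1}DD.
by field; rewrite !gt_eqF// sqrtr_gt0.
Qed.

Lemma top_cosine_itv X Y Z : 0 < X -> 0 < Y -> 0 < Z -> 0 < config_disc X Y Z ->
  -1 <= top_cosine X Y Z <= 1.
Proof.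
move=> X0 Y0 Z0 D0; have y0 := K_gt0 Y0; have z0 := K_gt0 Z0.
rewrite -ler_norml -(@ler_pXn2r _ 2)// ?nnegrE// expr1n -normrX ger0_norm ?sqr_ge0//.
have yz := mulr_gt0 y0 z0.
rewrite /top_cosine expr_div_n (sqr_sqrtr (ltW yz)).
rewrite ler_pdivrMr// mul1r -subr_ge0; apply: ltW.
by move: D0; congr (0 < _); rewrite /config_disc; ring.
Qed.

Lemma scaled_top_angle X Y Z i j k a : scaled_config X Y Z i j k ->
  row_free (\matrix_t v t) -> dihedral_angle v (te ord0 i) a ->
  0 <= a <= pi /\ cos a = top_cosine X Y Z.
Proof.
move=> C V; have D0 := scaled_disc_gt0 C V.
have C1 := scaled_config_rot C; have C2 := scaled_config_rot C1.
have D1 := D0; rewrite config_disc_rot in D1.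
have D2 := D1; rewrite config_disc_rot in D2.
have O2 := scaled_outward1 C1 D1; have O3 := scaled_outward1 C2 D2.
have [U [X0 Y0 Z0] _] := C.
have Ti := top_cosine_itv X0 Y0 Z0 D0.
move=> [i' [j' [n [m [ij' vE On Om ->]]]]].
have := te_compl U => -[vE' _].
have E : [set i'; j'] = [set j; k].
  by apply: (can_inj (@finset.setCK _)); rewrite -vE -vE'.
suff -> : lorentz n m / (Num.sqrt (lorentz n n) * Num.sqrt (lorentz m m)) = - top_cosine X Y Z.
  have Ti' : -1 <= - top_cosine X Y Z <= 1 by case/andP: Ti => *; apply/andP; split; lra.
  have := acos_ge0 Ti'; have := acos_lepi Ti' => A1 A2.
  split; first by apply/andP; split; lra.
  by rewrite cos_piB acosK// opprK.
rewrite -(scaled_top_ratio C D0).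
(* [dihedral_angle] leaves the order of the two faces open. *)
case: (setU2_eq ij' E) => -[iE jE]; subst i' j'.
  have [p p0 ->] := outward_normal_unique V On O2.
  have [q q0 ->] := outward_normal_unique V Om O3.
  exact: normal_cosine_scale.
have [p p0 ->] := outward_normal_unique V On O3.
have [q q0 ->] := outward_normal_unique V Om O2.
by rewrite normal_cosine_scale// lorentzC [X in _ / X]mulrC.
Qed.

Lemma scaled_top_angle_exists X Y Z i j k a : scaled_config X Y Z i j k ->
  0 < config_disc X Y Z -> 0 <= a <= pi -> cos a = top_cosine X Y Z ->
  dihedral_angle v (te ord0 i) a.
Proof.
move=> C D0 ai ca.
have C1 := scaled_config_rot C; have C2 := scaled_config_rot C1.
have D1 := D0; rewrite config_disc_rot in D1.
have D2 := D1; rewrite config_disc_rot in D2.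
have O2 := scaled_outward1 C1 D1; have O3 := scaled_outward1 C2 D2.
have [U _ _] := C; have [vE _] := te_compl U.
do 4 eexists; split; [|exact: vE|exact: O2|exact: O3|].
  by move: U; rewrite /= !inE !negb_or => /and4P[_ _ jk _].
rewrite (scaled_top_ratio C D0) -ca -cos_piB cosK ?in_itv/=; first by ring.
by case/andP: ai => ? ?; apply/andP; split; lra.
Qed.

Lemma scaled_opp_angle_exists X Y Z i j k a : scaled_config X Y Z i j k ->
  0 < config_disc X Y Z -> 0 <= a <= pi -> cos a = opp_cosine X Y Z ->
  dihedral_angle v (te j k) a.
Proof.
move=> C D0 ai ca.
have O0 := scaled_outward0 C D0; have O1 := scaled_outward1 C D0.
have [U _ _] := C; have [_ vE] := te_compl U.
do 4 eexists; split; [|exact: vE|exact: O0|exact: O1|].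
  by move: U; rewrite /= !inE !negb_or => /and4P[/and3P[i0 _ _] _ _ _].
rewrite (scaled_opp_ratio C D0) -ca -cos_piB cosK ?in_itv/=; first by ring.
by case/andP: ai => ? ?; apply/andP; split; lra.
Qed.
End ScaledConfiguration.

Lemma tet_edge_ind (P : tet_edge -> Prop) :
  P (te ord0 o1) -> P (te ord0 o2) -> P (te ord0 o3) ->
  P (te o2 o3) -> P (te o3 o1) -> P (te o1 o2) -> forall e, P e.
Proof.
move=> p1 p2 p3 q1 q2 q3 e.
have /cards2P[i [j [ij eE]]] := valP e.
rewrite (te_eq ij eE); move: ij; clear eE.
by elim/ord4_ind: i; elim/ord4_ind: j => //= _; rewrite teC.
Qed.

(** * Decorated tetrahedra with given lengths and angles *)

Section Geometry.
Variable R : realType.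
Implicit Types (v : 'I_4 -> 'rV[R]_4) (c : 'I_4 -> R) (l alpha : tet_edge -> R).

Definition side_log l (j k : 'I_4) : R := l (te j k) - l (te ord0 j) - l (te ord0 k).

Lemma side_logC l j k : side_log l j k = side_log l k j.
Proof. by rewrite /side_log teC addrAC. Qed.

Definition products_lt0 v : Prop :=
  (forall i, i != ord0 -> lorentz (v ord0) (v i) < 0) /\
  (forall i j, i != ord0 -> j != ord0 -> i != j -> lorentz (v i) (v j) < 0).

(** The vertices have non-negative squares, so a positive combination of two of them is timelike
    only if their mixed product is negative. *)
Lemma tetrahedron13_products v : tetrahedron13 v -> products_lt0 v.
Proof.
move=> [_ n0 ni H]; split => [i i0|i j i0 j0 ij].
  have i0' : ord0 != i by rewrite eq_sym.
  have [x [[a [b [a0 b0 ->]]]]] := H _ _ i0'.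
  rewrite /in_H3 !lorentzE (ni i i0) (lorentzC (v i)) => E.
  have : 2 * (a * b) * lorentz (v ord0) (v i) < 0.
    by have := mulr_ge0 (sqr_ge0 a) (ltW n0); lra.
  by rewrite pmulr_rlt0// mulr_gt0// mulr_gt0.
have [x [[a [b [a0 b0 ->]]]]] := H _ _ ij.
rewrite /in_H3 !lorentzE (ni i i0) (ni j j0) (lorentzC (v j)) => E.
have : 2 * (a * b) * lorentz (v i) (v j) < 0 by lra.
by rewrite pmulr_rlt0// mulr_gt0// mulr_gt0.
Qed.

Lemma edge_lengthsP v c l :
  0 < lorentz (v ord0) (v ord0) -> (forall i, i != ord0 -> lorentz (v i) (v i) = 0) ->
  products_lt0 v -> (forall i, i != ord0 -> 0 < c i) ->
  edge_lengths v c l <->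
  (forall i j, i != ord0 -> j != ord0 -> i != j ->
     lorentz (v i) (v j) = - 2 * Num.sqrt (c i * c j) * expR (l (te i j))) /\
  (forall i, i != ord0 -> lorentz (v ord0) (v i) =
     - Num.sqrt (lorentz (v ord0) (v ord0) * c i) * expR (l (te ord0 i))).
Proof.
move=> n0 ni [u0 w0] c0.
have perp i j : i != ord0 -> j != ord0 -> i != j ->
    exists p, [/\ lorentz p (v i) = 0, lorentz p (v j) = 0 & 0 < lorentz p p].
  move=> i0 j0 ij.
  have w := w0 _ _ i0 j0 ij; have ui := u0 _ i0; have uj := u0 _ j0.
  (* The component of [v ord0] orthogonal to [v i] and [v j]; its square is [n] plus a positive
     term. *)
  exists (v ord0 + (- (lorentz (v ord0) (v j) / lorentz (v i) (v j))) *: v i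
    + (- (lorentz (v ord0) (v i) / lorentz (v i) (v j))) *: v j).
  rewrite !lorentzE (ni i i0) (ni j j0) (lorentzC (v j) (v i)) (lorentzC (v i) (v ord0)) (lorentzC (v j) (v ord0)).
  have wn : lorentz (v i) (v j) != 0 by rewrite lt_eqF.
  split; [by field|by field|].
  set n := lorentz (v ord0) (v ord0) in n0 *.
  move: (lorentz (v ord0) (v i)) (lorentz (v ord0) (v j)) (lorentz (v i) (v j)) w wn ui uj.
  move=> a b w w0' wn a0 b0.
  have K : 0 < a * b / - w by rewrite divr_gt0 ?oppr_gt0// nmulr_rgt0.
  set k := (X in 0 < X); have -> : k = n + 2 * (a * b / - w) by rewrite /k; field.
  by rewrite addr_gt0// mulr_gt0.
split=> [[H1 H2]|[H1 H2]]; split=> *.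
- apply/(ideal_edge_lengthP (ni _ _) (ni _ _) (c0 _ _) (c0 _ _) (w0 _ _ _ _ _) (perp _ _ _ _ _)) => //.
  exact: H1.
- by apply/(hyperideal_edge_lengthP n0 (ni _ _) (c0 _ _) (u0 _ _)) => //; exact: H2.
- apply/(ideal_edge_lengthP (ni _ _) (ni _ _) (c0 _ _) (c0 _ _) (w0 _ _ _ _ _) (perp _ _ _ _ _)) => //.
  exact: H1.
- by apply/(hyperideal_edge_lengthP n0 (ni _ _) (c0 _ _) (u0 _ _)) => //; exact: H2.
Qed.

(** Division of [v t] by [sqrt (c t) e^(l_1t)] makes its product with the normalized [v ord0] equal
    to [-1]. The decoration then cancels from the products of ideal vertices, which only retain
    [side_log]. *)
Lemma decorated_scaled_config v c l i j k :
  decorated_tetrahedron13 v c -> edge_lengths v c l -> uniq [:: ord0; i; j; k] ->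
  exists2 s : 'I_4 -> R, forall t, 0 < s t &
    scaled_config v s (expR (side_log l j k)) (expR (side_log l k i)) (expR (side_log l i j)) i j k.
Proof.
move=> [T c0] L U; have P := tetrahedron13_products T; have [_ n0 ni _] := T.
have [H1 H2] := (edge_lengthsP l n0 ni P c0).1 L.
pose n := lorentz (v ord0) (v ord0).
pose s t := if t == ord0 then Num.sqrt n else Num.sqrt (c t) * expR (l (te ord0 t)).
exists s.
  move=> t; rewrite /s; case: eqP => [_|/eqP t0]; first by rewrite sqrtr_gt0.
  by rewrite mulr_gt0 ?expR_gt0// sqrtr_gt0 c0.
split => //; first by rewrite !expR_gt0.
have [i0 j0 k0 [ij ik jk]] : [/\ i != ord0, j != ord0, k != ord0 & [/\ i != j, i != k & j != k]].
  move: U; rewrite /= !inE !negb_or => /and4P[/and3P[i0 j0 k0] /andP[ij ik] jk _].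
  by split; [rewrite eq_sym..|split].
have ss t : t != ord0 -> s t = Num.sqrt (c t) * expR (l (te ord0 t)).
  by rewrite /s => /negPf ->.
have s0 : s ord0 = Num.sqrt n by rewrite /s eqxx.
have sn : Num.sqrt n != 0 by rewrite gt_eqF// sqrtr_gt0.
have en (x : R) : expR x != 0 by rewrite gt_eqF// expR_gt0.
have cn t : t != ord0 -> Num.sqrt (c t) != 0 by move=> t0; rewrite gt_eqF// sqrtr_gt0 c0.
have E1 t : t != ord0 ->
    lorentz ((s ord0)^-1 *: v ord0) ((s t)^-1 *: v t) = -1.
  move=> t0; rewrite !lorentzE (H2 t t0) (ss t t0) s0 -/n sqrtrM ?ltW//.
  by field; rewrite sn en cn.
have E2 t : t != ord0 -> lorentz ((s t)^-1 *: v t) ((s t)^-1 *: v t) = 0.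
  by move=> t0; rewrite !lorentzE (ni t t0) !mulr0.
have E3 t r : t != ord0 -> r != ord0 -> t != r ->
    lorentz ((s t)^-1 *: v t) ((s r)^-1 *: v r) = - 2 * expR (side_log l t r).
  move=> t0 r0 tr; rewrite !lorentzE (H1 t r t0 r0 tr) (ss t t0) (ss r r0) sqrtrM ?ltW ?c0//.
  rewrite /side_log !expRD !expRN.
  by field; rewrite !en !cn.
split; [|by split; exact: E1|by split; exact: E2|].
  by rewrite !lorentzE s0 -/n -[X in _ * (_ * X)](sqr_sqrtr (ltW n0)) -/n; field.
by split; [exact: E3|rewrite side_logC; exact: E3|exact: E3].
Qed.

Lemma geometric_disc_gt0 l i j k : Defs.geometric l -> uniq [:: ord0; i; j; k] ->
  0 < gram_disc (side_log l j k) (side_log l k i) (side_log l i j).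
Proof.
move=> [v [c [T L]]] U; have [s s0 C] := decorated_scaled_config T L U.
by apply: (scaled_disc_gt0 s0 C); have [[]] := T.
Qed.

Lemma geometric_edge_angle l alpha i j k : geometric_angles l alpha ->
  uniq [:: ord0; i; j; k] ->
  0 <= alpha (te ord0 i) <= pi /\ cos (alpha (te ord0 i)) =
    (cosh_side (side_log l k i) * cosh_side (side_log l i j) - cosh_side (side_log l j k)) /
    Num.sqrt ((cosh_side (side_log l k i) ^+ 2 - 1) * (cosh_side (side_log l i j) ^+ 2 - 1)).
Proof.
move=> [v [c [T L A]]] U; have [s s0 C] := decorated_scaled_config T L U.
have [[V _ _ _] _] := T.
exact: (scaled_top_angle s0 C V (A _)).
Qed.

(** The three [side_log] fix a Gram matrix and so a tetrahedron; scaling its ideal vertices by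
    [e^(l_1t)], with every [c t] equal to 1, gives each edge its own length. *)
Lemma realize_angles l alpha (a b c h : R) : angle_interior a b c h ->
  side_log l o2 o3 = log_ratio a b c h ->
  side_log l o3 o1 = log_ratio b c a h ->
  side_log l o1 o2 = log_ratio c a b h ->
  [/\ alpha (te ord0 o1) = a, alpha (te ord0 o2) = b & alpha (te ord0 o3) = c] ->
  [/\ alpha (te o2 o3) = a + h, alpha (te o3 o1) = b + h & alpha (te o1 o2) = c + h] ->
  geometric_angles l alpha.
Proof.
move=> I xE yE zE [aE bE cE] [aE' bE' cE'].
have I1 := angle_interior_rot I; have I2 := angle_interior_rot I1.
pose X := expR (log_ratio a b c h); pose Y := expR (log_ratio b c a h).
pose Z := expR (log_ratio c a b h).
have D0 : 0 < config_disc X Y Z := interior_gram_disc_gt0 I.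
have D1 := D0; rewrite config_disc_rot in D1.
have D2 := D1; rewrite config_disc_rot in D2.
have [u0 [u1 [u2 [u3 G]]]] := gram_config_exists (expR_gt0 _) (expR_gt0 _) (expR_gt0 _) D0.
pose u (t : 'I_4) : 'rV[R]_4 := nth 0 [:: u0; u1; u2; u3] (nat_of_ord t).
pose s (t : 'I_4) : R := if t == ord0 then 1 else expR (l (te ord0 t)).
pose v (t : 'I_4) : 'rV[R]_4 := s t *: u t.
have s0 t : 0 < s t by rewrite /s; case: ifP => // _; exact: expR_gt0.
have vK t : (s t)^-1 *: v t = u t by rewrite /v scalerA mulVf ?scale1r// gt_eqF.
have C : scaled_config v s X Y Z o1 o2 o3.
  by split => //; [rewrite !expR_gt0|rewrite !vK].
have C1 := scaled_config_rot C; have C2 := scaled_config_rot C1.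
have [h0 [h1 h2 h3] [k1 k2 k3] [l3 l2 l1]] := G.
have n1 : lorentz (v ord0) (v ord0) = 1 by rewrite /v /s eqxx scale1r.
have ni i : i != ord0 -> lorentz (v i) (v i) = 0.
  elim/ord4_ind: i => // _; rewrite /v !lorentzE /u /= ?k1 ?k2 ?k3; ring.
have ui i : i != ord0 -> lorentz (v ord0) (v i) = - expR (l (te ord0 i)).
  elim/ord4_ind: i => // _; rewrite /v !lorentzE /s /u /= ?h1 ?h2 ?h3; ring.
have wij i j : i != ord0 -> j != ord0 -> i != j ->
    lorentz (v i) (v j) = - 2 * expR (l (te i j)).
  have S (i' j' : 'I_4) (p : 'rV[R]_4) q : lorentz p q = - 2 * expR (side_log l i' j') ->
      lorentz (expR (l (te ord0 i')) *: p) (expR (l (te ord0 j')) *: q) = - 2 * expR (l (te i' j')).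
    move=> E; rewrite !lorentzE E /side_log !expRD !expRN.
    by field; rewrite !gt_eqF ?expR_gt0.
  elim/ord4_ind: i => //; elim/ord4_ind: j => //= _ _ _; rewrite /v /s /u /=; apply: S.
  - by rewrite l3 zE.
  - by rewrite l2 side_logC yE.
  - by rewrite lorentzC l3 side_logC zE.
  - by rewrite l1 xE.
  - by rewrite lorentzC l2 yE.
  - by rewrite lorentzC l1 side_logC xE.
clearbody v.
have P : products_lt0 v.
  split=> *; rewrite ?ui ?wij// ?mulNr oppr_lt0 ?mulr_gt0 ?expR_gt0//.
have T : tetrahedron13 v.
  split => //; [exact: scaled_row_free C D0|by rewrite n1|].
  (* [x] is the point of the edge on the plane dual to [v ord0]. *)
  have H i : i != ord0 -> let x := (- lorentz (v ord0) (v i)) *: v ord0 + 1 *: v i in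
      in_H3 x /\ 0 < - lorentz (v ord0) (v i).
    move=> i0 x; have w := P.1 i i0; split; last by rewrite oppr_gt0.
    rewrite /in_H3 /x !lorentzE n1 (ni i i0) (lorentzC (v i)).
    move: (lorentz _ _) w => w w0.
    set k := (X in X < 0); have -> : k = - (w ^+ 2) by rewrite /k; ring.
    by rewrite oppr_lt0 exprn_even_gt0//= lt_eqF.
  move=> i j ij; have [iE|i0] := eqVneq i ord0.
    have j0 : j != ord0 by rewrite -iE eq_sym.
    have [Hx w] := H j j0; rewrite iE; eexists; split; last exact: Hx.
    by exists (- lorentz (v ord0) (v j)), 1.
  have [jE|j0] := eqVneq j ord0.
    have [Hx w] := H i i0; rewrite jE; eexists; split; last exact: Hx.
    by exists 1, (- lorentz (v ord0) (v i)); rewrite addrC.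
  exists (1 *: v i + 1 *: v j); split; first by exists 1, 1.
  have w := P.2 i j i0 j0 ij.
  by rewrite /in_H3 !lorentzE (ni i i0) (ni j j0) (lorentzC (v j)); lra.
exists v, (fun=> 1); split.
- by split.
- apply/(edge_lengthsP l _ ni P) => //; first by rewrite n1.
  split=> [i j i0 j0 ij|i i0]; first by rewrite wij// mulr1 sqrtr1 mulr1.
  by rewrite ui// n1 mulr1 sqrtr1 mulN1r.
- have [a0 b0 c0 h0' S] := I.
  elim/tet_edge_ind.
  + by apply: (scaled_top_angle_exists s0 C D0); rewrite aE; [apply/andP; split; lra|exact: interior_cos I].
  + by apply: (scaled_top_angle_exists s0 C1 D1); rewrite bE; [apply/andP; split; lra|exact: interior_cos I1].
  + by apply: (scaled_top_angle_exists s0 C2 D2); rewrite cE; [apply/andP; split; lra|exact: interior_cos I2].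
  + by apply: (scaled_opp_angle_exists s0 C D0); rewrite aE'; [apply/andP; split; lra|exact: interior_cos_opp I].
  + by apply: (scaled_opp_angle_exists s0 C1 D1); rewrite bE'; [apply/andP; split; lra|exact: interior_cos_opp I1].
  + by apply: (scaled_opp_angle_exists s0 C2 D2); rewrite cE'; [apply/andP; split; lra|exact: interior_cos_opp I2].
Qed.
End Geometry.

Definition tet_edges : seq tet_edge :=
  [:: te ord0 o1; te ord0 o2; te ord0 o3; te o2 o3; te o3 o1; te o1 o2].

Lemma tet_edges_uniq : uniq tet_edges.
Proof.
apply: (@map_uniq _ _ (fun e : tet_edge => [:: o1 \in val e; o2 \in val e; o3 \in val e])).
by rewrite /= !val_te// !inE.
Qed.

Lemma mem_tet_edges e : e \in tet_edges.
Proof. by elim/tet_edge_ind: e; rewrite !inE eqxx ?orbT. Qed.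

Lemma perm_tet_edges : perm_eq (index_enum tet_edge) tet_edges.
Proof.
apply: uniq_perm; [exact: index_enum_uniq|exact: tet_edges_uniq|].
by move=> e; rewrite mem_index_enum mem_tet_edges.
Qed.

(** * The energy of a single tetrahedron and its concavity *)

Section TetrahedronEnergy.
Variable R : realType.
Implicit Types (l alpha beta : tet_edge -> R) (a b c h : R).

Lemma sum_tet_edge (F : tet_edge -> R) : \sum_e F e =
  F (te ord0 o1) + F (te ord0 o2) + F (te ord0 o3)
  + F (te o2 o3) + F (te o3 o1) + F (te o1 o2).
Proof. by rewrite (perm_big _ perm_tet_edges) !big_cons big_nil/=; ring. Qed.

Lemma sum_tet_vertex (F : tet_edge -> R) :
  [/\ \sum_(e : tet_edge | ord0 \in val e) F e = F (te ord0 o1) + F (te ord0 o2) + F (te ord0 o3),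
      \sum_(e : tet_edge | o1 \in val e) F e = F (te ord0 o1) + F (te o3 o1) + F (te o1 o2),
      \sum_(e : tet_edge | o2 \in val e) F e = F (te ord0 o2) + F (te o2 o3) + F (te o1 o2) &
      \sum_(e : tet_edge | o3 \in val e) F e = F (te ord0 o3) + F (te o2 o3) + F (te o3 o1)].
Proof.
by split; rewrite big_mkcond sum_tet_edge !val_te// !inE/=; ring.
Qed.

Definition tet_polytope alpha : Prop :=
  [/\ forall e, 0 <= alpha e <= pi,
      forall i : 'I_4, i != ord0 -> \sum_(e : tet_edge | i \in val e) alpha e = pi
    & \sum_(e : tet_edge | ord0 \in val e) alpha e <= pi].

Definition tet_interior alpha : Prop :=
  [/\ forall e, 0 < alpha e,
      forall i : 'I_4, i != ord0 -> \sum_(e : tet_edge | i \in val e) alpha e = pi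
    & \sum_(e : tet_edge | ord0 \in val e) alpha e < pi].

(** The parameter [h] of the simplex. *)
Definition defect alpha : R :=
  (pi - alpha (te ord0 o1) - alpha (te ord0 o2) - alpha (te ord0 o3)) / 2.

Lemma opposite_angles alpha :
  (forall i : 'I_4, i != ord0 -> \sum_(e : tet_edge | i \in val e) alpha e = pi) ->
  [/\ alpha (te o2 o3) = alpha (te ord0 o1) + defect alpha,
      alpha (te o3 o1) = alpha (te ord0 o2) + defect alpha &
      alpha (te o1 o2) = alpha (te ord0 o3) + defect alpha].
Proof.
move=> H; have [_ S1 S2 S3] := sum_tet_vertex alpha.
have := H o1 isT; have := H o2 isT; have := H o3 isT; rewrite S1 S2 S3 /defect => E3 E2 E1.
by split; lra.
Qed.

Lemma tet_polytope_simplex alpha : tet_polytope alpha ->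
  angle_simplex (alpha (te ord0 o1)) (alpha (te ord0 o2)) (alpha (te ord0 o3)) (defect alpha).
Proof.
move=> [H _ S]; have [S0 _ _ _] := sum_tet_vertex alpha.
rewrite S0 in S.
have /andP[a0 _] := H (te ord0 o1); have /andP[b0 _] := H (te ord0 o2).
have /andP[c0 _] := H (te ord0 o3).
by rewrite /defect; split => //; [rewrite divr_ge0//; lra|field].
Qed.

Lemma tet_interior_interior alpha : tet_interior alpha ->
  angle_interior (alpha (te ord0 o1)) (alpha (te ord0 o2)) (alpha (te ord0 o3)) (defect alpha).
Proof.
move=> [H _ S]; have [S0 _ _ _] := sum_tet_vertex alpha.
rewrite S0 in S.
by rewrite /defect; split => //; [rewrite divr_gt0//; lra|field].
Qed.

Lemma tet_interiorW alpha : tet_interior alpha -> tet_polytope alpha.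
Proof.
move=> I; have [a0 b0 c0 h0 S] := tet_interior_interior I; have [H V S0] := I.
have [E1 E2 E3] := opposite_angles V.
split => // [e|]; last exact: ltW.
by rewrite ltW//=; elim/tet_edge_ind: e; rewrite ?E1 ?E2 ?E3; lra.
Qed.

Definition angles_of a b c h : tet_edge -> R := fun e =>
  nth 0 [:: a; b; c; a + h; b + h; c + h] (index e tet_edges).

Lemma angles_ofE a b c h :
  [/\ angles_of a b c h (te ord0 o1) = a, angles_of a b c h (te ord0 o2) = b &
      angles_of a b c h (te ord0 o3) = c] /\
  [/\ angles_of a b c h (te o2 o3) = a + h, angles_of a b c h (te o3 o1) = b + h &
      angles_of a b c h (te o1 o2) = c + h].
Proof.
have I n : (n < 6)%N -> index (nth (te ord0 o1) tet_edges n) tet_edges = n.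
  by move=> n6; rewrite index_uniq// tet_edges_uniq.
by split; split; rewrite /angles_of; [rewrite (I 0%N)|rewrite (I 1%N)|rewrite (I 2%N)|
  rewrite (I 3%N)|rewrite (I 4%N)|rewrite (I 5%N)].
Qed.

Lemma angles_of_polytope a b c h : angle_simplex a b c h -> tet_polytope (angles_of a b c h).
Proof.
move=> [a0 b0 c0 h0 S].
have B : [/\ 0 <= a <= pi, 0 <= b <= pi & 0 <= c <= pi].
  by split; apply/andP; split; lra.
have B' : [/\ 0 <= a + h <= pi, 0 <= b + h <= pi & 0 <= c + h <= pi].
  by split; apply/andP; split; lra.
have V : [/\ a + (b + h) + (c + h) = pi, b + (a + h) + (c + h) = pi &
    c + (a + h) + (b + h) = pi] by split; lra.
have T : a + b + c <= pi by lra.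
have [b1 b2 b3] := B; have [b4 b5 b6] := B'; have [v1 v2 v3] := V.
have [[e1 e2 e3] [f1 f2 f3]] := angles_ofE a b c h.
have [S0 S1 S2 S3] := sum_tet_vertex (angles_of a b c h).
split.
- by elim/tet_edge_ind; rewrite ?e1 ?e2 ?e3 ?f1 ?f2 ?f3.
- by elim/ord4_ind => // _; rewrite ?S1 ?S2 ?S3 ?e1 ?e2 ?e3 ?f1 ?f2 ?f3.
- by rewrite S0 e1 e2 e3.
Qed.

(** The Lagrangian of one tetrahedron. Summed over all tetrahedra, its linear part is the same for
    all assignments whose edge sums are [2 pi]. *)
Definition tet_energy l alpha : R := tet_vol alpha + 2^-1 * \sum_e l e * alpha e.

Lemma tet_energyE l alpha : tet_polytope alpha -> tet_energy l alpha =
  2^-1 * (objective (side_log l o2 o3) (side_log l o3 o1) (side_log l o1 o2)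
     (alpha (te ord0 o1)) (alpha (te ord0 o2)) (alpha (te ord0 o3)) (defect alpha)
     + pi * (l (te ord0 o1) + l (te ord0 o2) + l (te ord0 o3))).
Proof.
move=> [_ V _]; have [E1 E2 E3] := opposite_angles V.
rewrite /tet_energy /tet_vol !sum_tet_edge; have [-> _ _ _] := sum_tet_vertex alpha.
have -> : (pi - (alpha (te ord0 o1) + alpha (te ord0 o2) + alpha (te ord0 o3))) / 2 = defect alpha.
  by rewrite /defect !opprD !addrA.
rewrite /objective /volume2 /side_log E1 E2 E3.
have S : pi = alpha (te ord0 o1) + alpha (te ord0 o2) + alpha (te ord0 o3) + 2 * defect alpha.
  by rewrite /defect; field.
rewrite S -mulrDr; congr (_ * _).
by ring.
Qed.

Definition tet_maximizer l alpha : Prop := tet_polytope alpha /\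
  forall beta, tet_polytope beta -> tet_energy l beta <= tet_energy l alpha.

Lemma tet_maximizerP l alpha : tet_polytope alpha -> tet_maximizer l alpha <->
  maximizer (side_log l o2 o3) (side_log l o3 o1) (side_log l o1 o2)
    (alpha (te ord0 o1)) (alpha (te ord0 o2)) (alpha (te ord0 o3)) (defect alpha).
Proof.
move=> P; split => [[_ H]|[_ H]]; split => //; first exact: tet_polytope_simplex.
  move=> a b c h S; have := H _ (angles_of_polytope S).
  rewrite !tet_energyE//; last exact: angles_of_polytope.
  rewrite ler_pM2l ?invr_gt0// lerD2r.
  have [[e1 e2 e3] _] := angles_ofE a b c h.
  have -> : defect (angles_of a b c h) = h.
    by case: S => _ _ _ _ S; rewrite /defect e1 e2 e3 -S; field.
  by rewrite e1 e2 e3.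
move=> beta Q; rewrite !tet_energyE// ler_pM2l ?invr_gt0// lerD2r.
exact/H/tet_polytope_simplex.
Qed.

(** Both tangent plane inequalities are taken at the intermediate point; its being interior provides
    the gradient, and the linear terms cancel in the weighted sum. *)
Lemma volume2_concave a b c h a' b' c' h' s :
  angle_simplex a b c h -> angle_simplex a' b' c' h' -> 0 <= s <= 1 ->
  angle_interior ((1 - s) * a + s * a') ((1 - s) * b + s * b')
    ((1 - s) * c + s * c') ((1 - s) * h + s * h') ->
  (1 - s) * volume2 a b c h + s * volume2 a' b' c' h' <=
  volume2 ((1 - s) * a + s * a') ((1 - s) * b + s * b')
    ((1 - s) * c + s * c') ((1 - s) * h + s * h').
Proof.
move=> S S' /andP[s0 s1] I.
have s1' : 0 <= 1 - s by rewrite subr_ge0.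
have := lerD (ler_wpM2l s1' (objective_le I S)) (ler_wpM2l s0 (objective_le I S')).
rewrite /objective.
set X := log_ratio _ _ _ _; set Y := log_ratio _ _ _ _; set Z := log_ratio _ _ _ _.
rewrite -subr_ge0 => H; rewrite -subr_ge0; move: H; congr (0 <= _).
by ring.
Qed.

Lemma tet_energy_concave l alpha beta s :
  tet_polytope alpha -> tet_polytope beta -> 0 <= s <= 1 ->
  tet_interior (fun e => (1 - s) * alpha e + s * beta e) ->
  (1 - s) * tet_energy l alpha + s * tet_energy l beta <=
  tet_energy l (fun e => (1 - s) * alpha e + s * beta e).
Proof.
move=> P Q s01 I; rewrite (tet_energyE _ P) (tet_energyE _ Q) (tet_energyE _ (tet_interiorW I)).
have dE : defect (fun e => (1 - s) * alpha e + s * beta e) = (1 - s) * defect alpha + s * defect beta.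
  by rewrite /defect; field.
have I' := tet_interior_interior I; rewrite dE in I'.
have := volume2_concave (tet_polytope_simplex P) (tet_polytope_simplex Q) s01 I'.
rewrite dE /objective.
set v1 := volume2 _ _ _ _; set v2 := volume2 _ _ _ _; set v3 := volume2 _ _ _ _ => H.
rewrite -(ler_pM2l (ltr0Sn R 1)) -subr_ge0; move: H; rewrite -subr_ge0; congr (0 <= _).
by field.
Qed.

Lemma perm_tet_angles alpha :
  perm_eq [seq alpha e | e : tet_edge] [seq alpha e | e <- tet_edges].
Proof.
apply: perm_map; apply: uniq_perm; [exact: enum_uniq|exact: tet_edges_uniq|].
by move=> e; rewrite mem_enum mem_tet_edges.
Qed.

End TetrahedronEnergy.

Lemma ord4_perms (i j k : 'I_4) : uniq [:: ord0; i; j; k] ->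
  (i, j, k) \in [:: (o1, o2, o3); (o1, o3, o2); (o2, o1, o3); (o2, o3, o1);
                  (o3, o1, o2); (o3, o2, o1)].
Proof. by elim/ord4_ind: i; elim/ord4_ind: j => //; elim/ord4_ind: k. Qed.

(** * Maximizers of the energy of a single tetrahedron *)

Section TetrahedronMaximizer.
Variable R : realType.
Implicit Types (l alpha beta : tet_edge -> R) (a b c h x y z : R).

Lemma thetaC l j k : theta l j k = theta l k j.
Proof. by rewrite /theta teC addrAC. Qed.

Lemma simplex_vertex a b c h : angle_simplex a b c h -> a = pi ->
  [/\ b = 0, c = 0 & h = 0].
Proof.
by move=> [a0 b0 c0 h0 S] aE; split; apply/eqP; rewrite eq_le; apply/andP; split; lra.
Qed.

(** The cosines force the angles to be interior with log ratios [x, y, z], and then [objective_le]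
    applies. *)
Lemma triangle_maximizer x y z a b c h :
  0 < gram_disc x y z -> angle_simplex a b c h ->
  0 <= a <= pi -> 0 <= b <= pi -> 0 <= c <= pi ->
  cos a = (cosh_side y * cosh_side z - cosh_side x) /
          Num.sqrt ((cosh_side y ^+ 2 - 1) * (cosh_side z ^+ 2 - 1)) ->
  cos b = (cosh_side z * cosh_side x - cosh_side y) /
          Num.sqrt ((cosh_side z ^+ 2 - 1) * (cosh_side x ^+ 2 - 1)) ->
  cos c = (cosh_side x * cosh_side y - cosh_side z) /
          Num.sqrt ((cosh_side x ^+ 2 - 1) * (cosh_side y ^+ 2 - 1)) ->
  maximizer x y z a b c h.
Proof.
move=> D S ai bi ci ca cb cc; have [_ _ _ h0 E] := S.
have hE : (pi - a - b - c) / 2 = h by rewrite -E; field.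
have T : a + b + c <= pi by lra.
have D1 := D; rewrite gram_disc_rot in D1.
have D2 := D1; rewrite gram_disc_rot in D2.
have [I xE] := triangle_log_ratio D ai bi ci ca cb cc T.
have T1 : b + c + a <= pi by rewrite addrC addrA.
have T2 : c + a + b <= pi by rewrite -addrA addrC.
have [_ yE] := triangle_log_ratio D1 bi ci ai cb cc ca T1.
have [_ zE] := triangle_log_ratio D2 ci ai bi cc ca cb T2.
have h1 : (pi - b - c - a) / 2 = h by rewrite -hE; field.
have h2 : (pi - c - a - b) / 2 = h by rewrite -hE; field.
rewrite hE in I xE; rewrite h1 in yE; rewrite h2 in zE.
split => // a' b' c' h' S'; rewrite xE yE zE.
exact: objective_le.
Qed.

Lemma vertex_sides l alpha :
  (theta l o1 o2 + theta l o1 o3 <= theta l o2 o3 -> alpha (te ord0 o1) = pi ->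
   tet_polytope alpha -> tet_maximizer l alpha) /\
  (theta l o2 o3 + theta l o2 o1 <= theta l o3 o1 -> alpha (te ord0 o2) = pi ->
   tet_polytope alpha -> tet_maximizer l alpha) /\
  (theta l o3 o1 + theta l o3 o2 <= theta l o1 o2 -> alpha (te ord0 o3) = pi ->
   tet_polytope alpha -> tet_maximizer l alpha).
Proof.
split; [|split] => H aE P; apply/tet_maximizerP => //; have S := tet_polytope_simplex P.
- have [-> -> ->] := simplex_vertex S aE; rewrite aE.
  by apply: arcosh_triangle_maximizer; move: H; rewrite addrC (thetaC l o1 o3).
- have S1 := angle_simplex_rot S; have [-> -> ->] := simplex_vertex S1 aE; rewrite aE.
  do 2 apply: maximizer_rot.
  by apply: arcosh_triangle_maximizer; move: H; rewrite addrC (thetaC l o2 o1).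
- have S1 := angle_simplex_rot (angle_simplex_rot S).
  have [-> -> ->] := simplex_vertex S1 aE; rewrite aE.
  apply: maximizer_rot.
  by apply: arcosh_triangle_maximizer; move: H; rewrite addrC (thetaC l o3 o2).
Qed.

(** For geometric [l] the law of cosines makes [alpha] an interior critical point; otherwise
    [degenerate_angles] supplies the inequality between the [theta] that makes the vertex a
    maximizer. *)
Lemma corresponding_angles_maximizer l alpha :
  tet_polytope alpha -> tet_corresponding_angles l alpha -> tet_maximizer l alpha.
Proof.
move=> P [Hg Hd].
have [G|NG] := pselect (Defs.geometric l).
  have A := Hg G; apply/tet_maximizerP => //.
  have [ai ca] := @geometric_edge_angle _ _ _ o1 o2 o3 A isT.
  have [bi cb] := @geometric_edge_angle _ _ _ o2 o3 o1 A isT.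
  have [ci cc] := @geometric_edge_angle _ _ _ o3 o1 o2 A isT.
  have D := @geometric_disc_gt0 _ _ o1 o2 o3 G isT.
  exact: (triangle_maximizer D (tet_polytope_simplex P)).
have [V1 [V2 V3]] := vertex_sides l alpha.
have [i [j [k [U H aE]]]] := Hd NG.
have ai := aE (te ord0 i); rewrite eqxx /= in ai.
move: U H ai; clear aE.
move=> /ord4_perms; rewrite !inE; do 5?[case/orP] => /eqP[-> -> ->] H ai.
- exact: V1.
- by apply: V1 => //; rewrite addrC (thetaC l o2).
- by apply: V2 => //; rewrite addrC (thetaC l o3).
- exact: V2.
- exact: V3.
- by apply: V3 => //; rewrite addrC (thetaC l o1).
Qed.

Lemma vertex_degenerate l x y z :
  x = side_log l o2 o3 -> y = side_log l o3 o1 -> z = side_log l o1 o2 ->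
  gram_disc x y z <= 0 -> ~ Defs.geometric l.
Proof.
move=> -> -> -> D G; have := @geometric_disc_gt0 _ _ o1 o2 o3 G isT.
by rewrite ltNge D.
Qed.

Lemma perm_degenerate alpha : tet_polytope alpha ->
  [\/ alpha (te ord0 o1) = pi, alpha (te ord0 o2) = pi | alpha (te ord0 o3) = pi] ->
  perm_eq [seq alpha e | e : tet_edge] [:: 0; 0; 0; 0; pi; pi] /\
  exists e, alpha e = 0.
Proof.
move=> P H; have S := tet_polytope_simplex P.
have S1 := angle_simplex_rot S; have S2 := angle_simplex_rot S1.
have [_ V _] := P; have [E1 E2 E3] := opposite_angles V.
split; last first.
  case: H => aE.
  - by exists (te ord0 o2); have [] := simplex_vertex S aE.
  - by exists (te ord0 o3); have [] := simplex_vertex S1 aE.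
  - by exists (te ord0 o1); have [] := simplex_vertex S2 aE.
apply: (perm_trans (perm_tet_angles alpha)); rewrite /= E1 E2 E3.
case: H => aE; rewrite aE.
- have [-> -> ->] := simplex_vertex S aE; rewrite !addr0.
  by apply/seq.permP => p /=; lia.
- have [-> -> ->] := simplex_vertex S1 aE; rewrite !addr0.
  by apply/seq.permP => p /=; lia.
- have [-> -> ->] := simplex_vertex S2 aE; rewrite !addr0.
  by apply/seq.permP => p /=; lia.
Qed.

(** If an angle at the hyperideal vertex is pi, all angles are known and [gram_disc] is
    non-positive, whereas geometric lengths make it positive. Otherwise the maximizer is interior
    and solves the critical equations. *)
Lemma tet_maximizer_conditions l alpha : tet_maximizer l alpha ->
  ((forall e, 0 < alpha e) -> geometric_angles l alpha) /\
  ((exists e, alpha e = 0) ->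
   perm_eq [seq alpha e | e : tet_edge] [:: 0; 0; 0; 0; pi; pi] /\ ~ Defs.geometric l).
Proof.
move=> TM; have P := TM.1; have M := (tet_maximizerP l P).1 TM.
have S := tet_polytope_simplex P.
have M1 := maximizer_rot M; have M2 := maximizer_rot M1.
have [_ V _] := P; have E := opposite_angles V.
have vertex : [\/ alpha (te ord0 o1) = pi, alpha (te ord0 o2) = pi | alpha (te ord0 o3) = pi] ->
    gram_disc (side_log l o2 o3) (side_log l o3 o1) (side_log l o1 o2) <= 0 ->
    ((forall e, 0 < alpha e) -> geometric_angles l alpha) /\
    ((exists e, alpha e = 0) ->
     perm_eq [seq alpha e | e : tet_edge] [:: 0; 0; 0; 0; pi; pi] /\ ~ Defs.geometric l).
  move=> H D; have [Q [e e0]] := perm_degenerate P H; split.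
    by move=> /(_ e); rewrite e0 ltxx.
  by split => //; exact: vertex_degenerate D.
have [ap|pa] := ltP (alpha (te ord0 o1)) pi; last first.
  have aE : alpha (te ord0 o1) = pi.
    by apply/eqP; rewrite eq_le pa andbT; have [/(_ (te ord0 o1))/andP[]] := P.
  apply: vertex; first by apply: Or31.
  have [b0 c0 h0] := simplex_vertex S aE; rewrite aE b0 c0 h0 in M.
  exact: maximizer_vertex_disc M.
have [bp|pb] := ltP (alpha (te ord0 o2)) pi; last first.
  have aE : alpha (te ord0 o2) = pi.
    by apply/eqP; rewrite eq_le pb andbT; have [/(_ (te ord0 o2))/andP[]] := P.
  apply: vertex; first by apply: Or32.
  have [b0 c0 h0] := simplex_vertex (angle_simplex_rot S) aE; rewrite aE b0 c0 h0 in M1.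
  by rewrite gram_disc_rot; exact: maximizer_vertex_disc M1.
have [cp|pc] := ltP (alpha (te ord0 o3)) pi; last first.
  have aE : alpha (te ord0 o3) = pi.
    by apply/eqP; rewrite eq_le pc andbT; have [/(_ (te ord0 o3))/andP[]] := P.
  apply: vertex; first by apply: Or33.
  have [b0 c0 h0] := simplex_vertex (angle_simplex_rot (angle_simplex_rot S)) aE.
  rewrite aE b0 c0 h0 in M2.
  by rewrite -(gram_disc_rot (side_log l o1 o2)); exact: maximizer_vertex_disc M2.
have I := maximizer_not_vertex M ap bp cp.
have I1 := angle_interior_rot I; have I2 := angle_interior_rot I1.
split => [_|[e e0]].
  by apply: (realize_angles I (maximizer_interior M I) (maximizer_interior M1 I1)
    (maximizer_interior M2 I2)).
exfalso; have [E1 E2 E3] := E; have [a0 b0 c0 h0 _] := I.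
suff : 0 < alpha e by rewrite e0 ltxx.
by move: (e); elim/tet_edge_ind; rewrite ?E1 ?E2 ?E3// addr_gt0.
Qed.
End TetrahedronMaximizer.

(** * Lagrange multipliers of a concave function under affine constraints *)

Section LagrangeMultipliers.
Variables (R : realType) (V : Type) (mix : R -> V -> V -> V) (K : V -> Prop).
Variables (J : finType) (g : J -> V -> R) (f : V -> R).
Hypothesis K_mix : forall s x y, 0 <= s <= 1 -> K x -> K y -> K (mix s x y).
Hypothesis g_mix : forall j s x y, g j (mix s x y) = (1 - s) * g j x + s * g j y.
Hypothesis K_opp : forall x, K x ->
  exists y e, [/\ K y, 0 < e & forall j, g j y = - (e * g j x)].
Hypothesis f_concave : forall s x y, 0 <= s <= 1 -> K x -> K y ->
  (1 - s) * f x + s * f y <= f (mix s x y).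
Hypothesis f_le0 : forall x, K x -> (forall j, g j x = 0) -> f x <= 0.

(* The multipliers are found one constraint at a time: each one separates the
   slopes on the two sides of the hyperplane [g j = 0]. *)
Lemma lagrange_multipliers : exists lambda : J -> R,
  forall x, K x -> f x + \sum_j lambda j * g j x <= 0.
Proof.
suff H (r : seq J) : uniq r -> exists lambda : J -> R, forall x, K x ->
    (forall j, j \notin r -> g j x = 0) -> f x + \sum_(j <- r) lambda j * g j x <= 0.
  have [lambda Hl] := H _ (index_enum_uniq J); exists lambda => x Kx.
  by apply: Hl => // j; rewrite mem_index_enum.
elim: r => [_|j r IH /= /andP[jr ur]].
  by exists (fun=> 0) => x Kx gx; rewrite big_nil addr0 f_le0// => j; exact: gx.
have [lambda Hl] := IH ur.
pose F x := f x + \sum_(i <- r) lambda i * g i x.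
pose C x := K x /\ forall i, i \notin j :: r -> g i x = 0.
have Fmix s x y : 0 <= s <= 1 -> K x -> K y -> (1 - s) * F x + s * F y <= F (mix s x y).
  move=> s01 Kx Ky; have := f_concave s01 Kx Ky; rewrite /F.
  have -> : \sum_(i <- r) lambda i * g i (mix s x y) =
      (1 - s) * (\sum_(i <- r) lambda i * g i x) + s * (\sum_(i <- r) lambda i * g i y).
    rewrite !mulr_sumr -big_split/=; apply: eq_bigr => i _; rewrite g_mix; ring.
  lra.
have F0 x : C x -> g j x = 0 -> F x <= 0.
  move=> [Kx Cx] gx; apply: Hl => // i ir; have [->//|ij] := eqVneq i j.
  by apply: Cx; rewrite inE negb_or ij.
(* The mixture of [x] and [y] on which [g j] vanishes has [F <= 0]; by concavity this separates the
   slopes of the two sides. *)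
have cross x y : C x -> C y -> 0 < g j x -> g j y < 0 -> F y / - g j y <= - (F x / g j x).
  move=> [Kx Cx] [Ky Cy] px py.
  set p := g j x in px *; set q := g j y in py *.
  have pq : 0 < p - q by lra.
  have s01 : 0 <= p / (p - q) <= 1.
    apply/andP; split; first by apply: divr_ge0; exact: ltW.
    by rewrite ler_pdivrMr// mul1r; lra.
  have Cm : C (mix (p / (p - q)) x y).
    split; first exact: K_mix.
    by move=> i ir; rewrite g_mix Cx// Cy// !mulr0 addr0.
  have gm : g j (mix (p / (p - q)) x y) = 0.
    by rewrite g_mix -/p -/q; field; rewrite gt_eqF.
  have := le_trans (Fmix _ _ _ s01 Kx Ky) (F0 _ Cm gm).
  have -> : (1 - p / (p - q)) * F x + p / (p - q) * F y = (- q * F x + p * F y) / (p - q).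
    by field; rewrite gt_eqF.
  rewrite pmulr_lle0 ?invr_gt0// => H.
  have q0 : 0 < - q by rewrite oppr_gt0.
  rewrite ler_pdivrMr// -mulNr mulrAC ler_pdivlMr//.
  by lra.
have ext (mu : R) : (forall x, C x -> F x + mu * g j x <= 0) ->
    exists lambda' : J -> R, forall x, K x -> (forall i, i \notin j :: r -> g i x = 0) ->
    f x + \sum_(i <- j :: r) lambda' i * g i x <= 0.
  move=> Hmu; exists (fun i => if i == j then mu else lambda i) => x Kx Cx.
  have := Hmu x (conj Kx Cx); rewrite big_cons eqxx /F.
  have -> : \sum_(i <- r) (if i == j then mu else lambda i) * g i x = \sum_(i <- r) lambda i * g i x.
    rewrite big_seq [RHS]big_seq; apply: eq_bigr => i ir.
    by case: eqP => // ij; rewrite ij (negPf jr) in ir.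
  by rewrite addrAC addrA.
have [[x1 [C1 g1]]|N] := pselect (exists x, C x /\ g j x != 0); last first.
  apply: (ext 0) => x Cx; rewrite mul0r addr0; apply: F0 => //.
  by apply/eqP; apply/negPn/negP => gx; apply: N; exists x.
(* [K_opp] supplies a point at which all constraints change sign, so both sides are inhabited: [S]
   is non-empty and bounded above. *)
have both : (exists x, C x /\ 0 < g j x) /\ (exists x, C x /\ g j x < 0).
  have [y [e [Ky e0 gy]]] := K_opp C1.1.
  have Cy : C y by split => // i ir; rewrite gy C1.2// mulr0 oppr0.
  have [gp|gn] := ltP 0 (g j x1).
    split; first by exists x1.
    by exists y; rewrite gy oppr_lt0 mulr_gt0.
  have gn' : g j x1 < 0 by rewrite lt_neqAle g1.
  split; last by exists x1.
  by exists y; rewrite gy oppr_gt0 pmulr_rlt0.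
have [[xp [Cp gp]] [xn [Cn gn]]] := both.
pose S : set R := [set z | exists y, [/\ C y, g j y < 0 & z = F y / - g j y]]%classic.
have S0 : (S !=set0)%classic by exists (F xn / - g j xn), xn.
have ubS x : C x -> 0 < g j x -> ubound S (- (F x / g j x)).
  by move=> Cx px z [y [Cy py ->]]; exact: cross.
have hS : has_sup S by split => //; exists (- (F xp / g j xp)); exact: ubS.
apply: (ext (sup S)) => x Cx.
have [px|] := ltP 0 (g j x).
  have := ge_sup S0 (ubS x Cx px); rewrite -mulNr ler_pdivlMr//; lra.
rewrite le_eqVlt => /predU1P[g0|px]; first by rewrite g0 mulr0 addr0; exact: F0.
have q0 : 0 < - g j x by rewrite oppr_gt0.
have : F x / - g j x <= sup S by apply: (sup_upper_bound hS); exists x.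
by rewrite ler_pdivrMr//; lra.
Qed.
End LagrangeMultipliers.

Lemma positive_lower_bound (R : realType) (T : finType) (F : T -> R) :
  (forall t, 0 < F t) -> exists2 e, 0 < e & forall t, e <= F t.
Proof.
move=> F0.
suff [e e0 He] : exists2 e, 0 < e & forall t, t \in enum T -> e <= F t.
  by exists e => // t; apply: He; rewrite mem_enum.
elim: (enum T) => [|t s [e e0 He]]; first by exists 1.
exists (Num.min e (F t)); first by rewrite lt_min e0 F0.
move=> t'; rewrite inE => /predU1P[->|/He]; first by rewrite ge_min lexx orbT.
by rewrite ge_min => ->.
Qed.

(** * Mixtures of angle assignments *)

Section TetrahedronMix.
Variable R : realType.
Implicit Types alpha beta : tet_edge -> R.

Definition tet_mix (s : R) alpha beta : tet_edge -> R :=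
  fun e => (1 - s) * alpha e + s * beta e.

Lemma sum_tet_mix s alpha beta (P : pred tet_edge) :
  \sum_(e | P e) tet_mix s alpha beta e =
  (1 - s) * (\sum_(e | P e) alpha e) + s * (\sum_(e | P e) beta e).
Proof. by rewrite !mulr_sumr -big_split. Qed.

Lemma tet_interior_mix s alpha beta : 0 < s <= 1 ->
  tet_polytope alpha -> tet_interior beta -> tet_interior (tet_mix s alpha beta).
Proof.
move=> /andP[s0 s1] [A1 A2 A3] [B1 B2 B3]; have s1' : 0 <= 1 - s by rewrite subr_ge0.
split=> [e|i i0|].
- have /andP[a0 _] := A1 e.
  by rewrite /tet_mix ltr_wpDl ?mulr_gt0 ?mulr_ge0.
- by rewrite sum_tet_mix A2// B2//; ring.
- rewrite sum_tet_mix.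
  have -> : pi = (1 - s) * pi + s * pi :> R by ring.
  by rewrite ler_ltD ?ler_wpM2l// ltr_pM2l.
Qed.

(** The mixture is [(1 + e) alpha - e beta]. As angles of [beta] are at most pi, for
    [e <= min (m, pi - A) / (2 pi)] an angle loses at most [m / 2] and the hyperideal sum gains at
    most half of its distance to pi, uniformly in [beta]. *)
Lemma tet_interior_open alpha : tet_interior alpha -> exists2 d, 0 < d &
  forall beta e, 0 < e <= d -> tet_interior beta -> tet_interior (tet_mix (- e) alpha beta).
Proof.
move=> [A1 A2 A3]; have [m m0 Hm] := positive_lower_bound A1.
have p0 := pi_gt0 R; set A := \sum_(e | _) _ in A3.
exists (Num.min m (pi - A) / (2 * pi)).
  by rewrite divr_gt0 ?mulr_gt0// lt_min m0 subr_gt0.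
move=> beta e /andP[e0]; rewrite ler_pdivlMr ?mulr_gt0// le_min => /andP[em eA] B.
have [B1 B2 B3] := tet_interiorW B.
have ep : 0 < e * pi by rewrite mulr_gt0.
split=> [t|i i0|].
- have /andP[b0 bp] := B1 t; have := Hm t.
  have : e * beta t <= e * pi by rewrite ler_pM2l.
  have : 0 <= e * alpha t by rewrite mulr_ge0// ltW.
  by rewrite /tet_mix; lra.
- by rewrite sum_tet_mix A2// B2//; ring.
- rewrite sum_tet_mix -/A.
  have : e * A < e * pi by rewrite ltr_pM2l.
  have : 0 <= e * \sum_(t : tet_edge | ord0 \in val t) beta t.
    apply: mulr_ge0; first exact: ltW.
    by apply: sumr_ge0 => t _; have /andP[] := B1 t.
  by lra.
Qed.
End TetrahedronMix.

(** * Edge sums and the energy of the whole triangulation *)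

Section EdgeSums.
Variables (R : realType) (M : closed_triangulation).
Implicit Types (alpha : tet M -> tet_edge -> R) (l : edge M -> R).

Lemma glued_edges_sym : symmetric (@glued_edges M).
Proof.
suff H (x y : tet M * tet_edge) : glued_edges x y -> glued_edges y x.
  by move=> x y; apply/idP/idP; exact: H.
case: x y => [t e] [t' e'] /existsP[f /and3P[/= fe /eqP tE /eqP eE]].
apply/existsP; exists ((Defs.glue t f).2 f); have := glueK t f; rewrite tE /= => gE.
apply/and3P; split; rewrite /=.
- by rewrite eE mem_imset//; exact: perm_inj.
- by rewrite gE.
- rewrite gE eE /= -imset_comp; apply/eqP/setP => x.
  rewrite (eq_imset _ (_ : _ =1 id)) ?imset_id// => {}x /=; exact: permK.
Qed.

(** Since [glued_edges] is symmetric, two classes with a common element coincide. *)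
Lemma edge_of_eq (x : tet M * tet_edge) (c : edge M) :
  (edge_of x.1 x.2 == c) = (x \in val c).
Proof.
have cs : connect_sym (@glued_edges M).
  exact: sym_connect_sym glued_edges_sym.
rewrite -val_eqE /= -surjective_pairing.
have /existsP[y /eqP cE] := valP c.
apply/eqP/idP => [<-|]; first by rewrite inE connect0.
rewrite cE inE => yx; apply/setP => z; rewrite !inE.
by apply/esym/(same_connect cs).
Qed.

Lemma sum_edge_lengths l alpha :
  \sum_t \sum_e tet_lengths l t e * alpha t e =
  \sum_(c : edge M) l c * \sum_(x in val c) alpha x.1 x.2.
Proof.
rewrite pair_big/= (partition_big (fun x : tet M * tet_edge => edge_of x.1 x.2) predT)//=.
apply: eq_bigr => c _; rewrite mulr_sumr; apply: eq_big => [x|x /eqP <-//].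
exact: edge_of_eq.
Qed.

Definition total_energy l alpha : R := \sum_t tet_energy (tet_lengths l t) (alpha t).

Lemma total_energyE l alpha : total_energy l alpha =
  vol alpha + 2^-1 * \sum_(c : edge M) l c * \sum_(x in val c) alpha x.1 x.2.
Proof. by rewrite -sum_edge_lengths /total_energy /vol mulr_sumr -big_split. Qed.

Lemma nonneg_tet_polytope alpha t : nonneg_angle_structure alpha -> tet_polytope (alpha t).
Proof. by move=> [A1 _ A2 A3]; split; [exact: A1|exact: A2|exact: A3]. Qed.

Lemma positive_tet_interior alpha t : positive_angle_structure alpha -> tet_interior (alpha t).
Proof.
move=> [A1 _ A2 A3]; split; [|exact: A2|exact: A3].
by move=> e; have /andP[] := A1 t e.
Qed.

Lemma corresponding_maximizes_volume l alpha :
  corresponding_angles l alpha -> nonneg_angle_structure alpha -> maximizes_volume alpha.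
Proof.
move=> C N; split => // beta NB.
have : total_energy l beta <= total_energy l alpha.
  apply: ler_sum => t _.
  have [_ H] := corresponding_angles_maximizer (nonneg_tet_polytope t N) (C t).
  exact/H/nonneg_tet_polytope.
rewrite !total_energyE.
have E gamma : nonneg_angle_structure gamma ->
    \sum_(c : edge M) l c * \sum_(x in val c) gamma x.1 x.2 = \sum_(c : edge M) l c * (2 * pi).
  by move=> [_ H _ _]; apply: eq_bigr => c _; rewrite H.
by rewrite !E// lerD2r.
Qed.

(** Separation takes place on the interior assignments without edge conditions, where mixtures
    remain inside and the energy is concave. Boundary assignments are then compared along segments
    to [alpha0], and one tetrahedron is isolated by changing [alpha] on it alone. *)
Lemma maximizes_volume_lengths alpha0 alpha :
  positive_angle_structure alpha0 -> maximizes_volume alpha ->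
  exists l, forall t, tet_maximizer (tet_lengths l t) (alpha t).
Proof.
move=> P0 [N Hmax].
pose V := tet M -> tet_edge -> R.
pose mix (s : R) (x y : V) : V := fun t => tet_mix s (x t) (y t).
pose K (x : V) := forall t, tet_interior (x t).
pose g (c : edge M) (x : V) := \sum_(u in val c) x u.1 u.2 - 2 * pi.
pose f (x : V) := vol x - vol alpha.
have K0 : K alpha0 by move=> t; exact: positive_tet_interior.
have g_mix c s x y : g c (mix s x y) = (1 - s) * g c x + s * g c y.
  rewrite /g /mix /tet_mix big_split/= -!mulr_sumr; ring.
have g0 c : g c alpha0 = 0 by case: P0 => _ H _ _; rewrite /g H subrr.
have K_mix s x y : 0 <= s <= 1 -> K x -> K y -> K (mix s x y).
  move=> /andP[]; rewrite le_eqVlt => /predU1P[<- _|s0 s1] Kx Ky t.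
    suff -> : mix 0 x y t = x t by exact: Kx.
    by apply/funext => e; rewrite /mix /tet_mix subr0 mul1r mul0r addr0.
  by apply: tet_interior_mix; [rewrite s0|exact: tet_interiorW|].
(* Extrapolation from [x] slightly beyond [alpha0], where every [g] vanishes. *)
have K_opp x : K x -> exists y e, [/\ K y, 0 < e & forall j, g j y = - (e * g j x)].
  move=> Kx.
  have H t := tet_interior_open (K0 t).
  pose d t := s2val (cid2 (H t)).
  have d0 t : 0 < d t by exact: (s2valP (cid2 (H t))).
  have [e e0 He] := positive_lower_bound d0.
  exists (mix (- e) alpha0 x), e; split => // [t|j].
    by apply: (s2valP' (cid2 (H t))) => //; rewrite e0 He.
  by rewrite g_mix g0 mulr0 add0r mulNr.
have energy_concave l s x y : 0 < s <= 1 -> (forall t, tet_polytope (x t)) -> K y ->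
    (1 - s) * total_energy l x + s * total_energy l y <= total_energy l (mix s x y).
  move=> s01 Px Ky; rewrite /total_energy !mulr_sumr -big_split/=.
  apply: ler_sum => t _; apply: tet_energy_concave => //.
  - exact: tet_interiorW.
  - by case/andP: s01 => /ltW-> ->.
  - exact: tet_interior_mix.
have vol_energy x : total_energy (fun=> 0) x = vol x.
  by rewrite total_energyE big1 ?mulr0 ?addr0// => c _; rewrite mul0r.
have f_concave s x y : 0 <= s <= 1 -> K x -> K y -> (1 - s) * f x + s * f y <= f (mix s x y).
  move=> /andP[]; rewrite le_eqVlt => /predU1P[<- _|s0 s1] Kx Ky.
    suff -> : mix 0 x y = x by rewrite subr0 mul1r mul0r addr0.
    by apply/funext => t; apply/funext => e; rewrite /mix /tet_mix subr0 mul1r mul0r addr0.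
  have s01 : 0 < s <= 1 by rewrite s0.
  have := energy_concave (fun=> 0) s x y s01 (fun t => tet_interiorW (Kx t)) Ky.
  by rewrite !vol_energy /f; lra.
have f_le0 x : K x -> (forall c, g c x = 0) -> f x <= 0.
  move=> Kx gx; rewrite subr_le0; apply: Hmax.
  have P t := tet_interiorW (Kx t); split.
  - by move=> t e; have [] := P t.
  - by move=> c; apply/eqP; rewrite -subr_eq0; apply/eqP; exact: gx.
  - by move=> t i i0; have [_ H _] := P t; exact: H.
  - by move=> t; have [] := P t.
have [lambda Hl] := lagrange_multipliers K_mix g_mix K_opp f_concave f_le0.
(* The factor 2 undoes the [2^-1] in [tet_energy]. *)
pose l c := 2 * lambda c.
have EK x : K x -> total_energy l x <= total_energy l alpha.
  move=> Kx; have := Hl x Kx; rewrite !total_energyE /f.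
  have -> : \sum_(c : edge M) l c * \sum_(u in val c) alpha u.1 u.2 =
      \sum_(c : edge M) l c * (2 * pi).
    by case: N => _ H _ _; apply: eq_bigr => c _; rewrite H.
  have -> : \sum_j lambda j * g j x =
      2^-1 * \sum_(c : edge M) l c * \sum_(u in val c) x u.1 u.2
      - 2^-1 * \sum_(c : edge M) l c * (2 * pi).
    rewrite !mulr_sumr -sumrB; apply: eq_bigr => c _.
    by rewrite /g /l; field.
  by lra.
exists l => t0; have Pa t := nonneg_tet_polytope t N; split => // beta Pb.
(* The energy bound holds without edge conditions, so the tetrahedra may be varied independently. *)
pose b : V := fun t => if t == t0 then beta else alpha t.
have PB t : tet_polytope (b t) by rewrite /b; case: eqP.
have Eb : total_energy l b <= total_energy l alpha.
  (* With [E] the total energy, concavity and the bound on interior points give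
     [E b <= E alpha + s (E b - E alpha0)] for all [s] in []0, 1]]. *)
  refine (at_right_le (@cvg_line_at_right R (total_energy l alpha)
    (total_energy l b - total_energy l alpha0)) _).
  move=> s s01; have Km : K (mix s b alpha0) by move=> t; apply: tet_interior_mix.
  by have := EK _ Km; have := energy_concave l s b alpha0 s01 PB K0; lra.
move: Eb; rewrite /total_energy (bigD1 t0)//= [leRHS](bigD1 t0)//= {1}/b eqxx.
have -> : \sum_(t | t != t0) tet_energy (tet_lengths l t) (b t) =
    \sum_(t | t != t0) tet_energy (tet_lengths l t) (alpha t).
  by apply: eq_bigr => t /negPf tt; rewrite /b tt.
by rewrite lerD2r.
Qed.
End EdgeSums.

Unset Implicit Arguments.
Theorem theorem1p2 (R : realType) (M : closed_triangulation)
  (h13 : type13 M)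
  (hpos : exists alpha : tet M -> tet_edge -> R,
            positive_angle_structure alpha) :
  (forall alpha : tet M -> tet_edge -> R,
     nonneg_angle_structure alpha -> maximizes_volume alpha ->
     exists l : edge M -> R,
       forall t : tet M, cond1 l alpha t /\ cond2 l alpha t) /\
  (forall (l : edge M -> R) (alpha : tet M -> tet_edge -> R),
     corresponding_angles l alpha ->
     nonneg_angle_structure alpha ->
     (forall t : tet M, cond1 l alpha t /\ cond2 l alpha t) ->
     maximizes_volume alpha).
Proof.
split=> [alpha _ Hmax|l alpha C N _].
  have [alpha0 P0] := hpos.
  have [l Hl] := maximizes_volume_lengths P0 Hmax.
  by exists l => t; have [H1 H2] := tet_maximizer_conditions (Hl t).
exact: (@corresponding_maximizes_volume _ _ l).
Qed.
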